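(* For every integer $n\ge 0$, \begin{align*} \widetilde{\mathrm{pp}}(3n+2) &\equiv 0 \pmod{3},\\ \widetilde{\mathrm{pp}}(5n+3) &\equiv 0 \pmod{5},\\ \widetilde{\mathrm{pp}}(5n+4) &\equiv 0 \pmod{5}. \end{align*}
   Context: A partition of a non-negative integer is a (finite) non-decreasing sequence of positive integers; $|\pi|$ denotes the sum of the parts of $\pi$, $s(\pi)$ its smallest part and $\ell(\pi)$ its largest part. The empty partition $\emptyset$ has $|\emptyset|=0$, $s(\emptyset)=\infty$ and $\ell(\emptyset)=0$. A partition pair of $n$ is an ordered pair of partitions $(\pi_1,\pi_2)$ with $|\pi_1|+|\pi_2|=n$. Let $\widetilde{\mathrm{PP}}$ be the set of all partition pairs $(\pi_1,\pi_2)$ such that $\pi_1\neq\emptyset$, $s(\pi_1)\le s(\pi_2)$ and $\ell(\pi_2)<2s(\pi_1)$ (that is, $\pi_1$ is non-empty and every part of $\pi_2$ lies in the interval $[s(\pi_1),2s(\pi_1))$; $\pi_2$ may be empty). $\widetilde{\mathrm{pp}}(n)$ denotes the number of partition pairs of $n$ belonging to $\widetilde{\mathrm{PP}}$. *)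

(* Defs.v *)
From mathcomp Require Import all_boot all_order all_algebra.
From mathcomp Require Import constructive_ereal.

Set Implicit Arguments.
Unset Strict Implicit.
Unset Printing Implicit Defensive.

Import Order.TTheory GRing.Theory Num.Theory.

Definition is_partition (p : seq nat) : bool := sorted leq p && all (ltn 0) p.

(* The smallest part takes values in the extended integers, so that the
   empty partition has smallest part +oo. *)
Definition smallest (p : seq nat) : \bar int :=
  \big[Order.min/+oo%E]_(x <- p) (x%:Z)%:E.

Definition largest (p : seq nat) : nat := \max_(x <- p) x.

Definition PPtilde (p : seq nat * seq nat) : bool :=
  [&& is_partition p.1, is_partition p.2, p.1 != [::],
      (smallest p.1 <= smallest p.2)%E
    & ((largest p.2)%:Z%:E < 2%:E * smallest p.1)%E].

(* A partition of weight at most n has at most n parts, all of them at most n,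
   so the pairs of bounded sequences below cover all partition pairs of n;
   see pptildeP. *)
Definition pptilde (n : nat) : nat :=
  #|[set p : n.-bseq 'I_n.+1 * n.-bseq 'I_n.+1 |
     let q := (map val p.1, map val p.2) in
     PPtilde q && (sumn q.1 + sumn q.2 == n)]|.

Lemma le_smallest (x : nat) p :
  ((x%:Z)%:E <= smallest p)%E = all (leq x) p.
Proof.
rewrite /smallest; elim: p => [|y p IH]; first by rewrite big_nil leey.
by rewrite big_cons le_min IH lee_fin lez_nat.
Qed.

Lemma smallest_sorted x p : sorted leq (x :: p) ->
  smallest (x :: p) = (x%:Z)%:E.
Proof.
move=> /(order_path_min leq_trans) xp; apply/le_anti/andP; split.
  by rewrite /smallest big_cons ge_min lexx.
by rewrite le_smallest /= leqnn.
Qed.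

Lemma largest_lt m p : 0 < m -> (largest p < m) = all (ltn^~ m) p.
Proof.
move=> m0; rewrite /largest; elim: p => [|y p IH]; first by rewrite big_nil.
by rewrite big_cons gtn_max IH.
Qed.

Lemma PPtildeE p : PPtilde p =
  [&& is_partition p.1, is_partition p.2, p.1 != [::]
    & all (fun x => head 0 p.1 <= x < 2 * head 0 p.1) p.2].
Proof.
rewrite /PPtilde; case: p => [[|x p] q] /=; first by rewrite ?andbF.
case: (boolP (is_partition (x :: p))) => //= /andP[sp /andP[x0 _]].
rewrite (smallest_sorted sp) le_smallest -EFinM lte_fin -PoszM ltz_nat.
by rewrite largest_lt ?muln_gt0 // -all_predI.
Qed.

Lemma size_le_sumn p : is_partition p -> size p <= sumn p.
Proof.
case/andP=> _; elim: p => //= x p IH /andP[x0 /IH h].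
by rewrite -add1n leq_add.
Qed.

Lemma mem_le_sumn p x : x \in p -> x <= sumn p.
Proof.
elim: p => //= y p IH; rewrite inE => /orP[/eqP->|/IH h].
  exact: leq_addr.
exact: leq_trans h (leq_addl _ _).
Qed.

Lemma bseq_lift n p : is_partition p -> sumn p <= n ->
  exists b : n.-bseq 'I_n.+1, map val b = p.
Proof.
move=> pP pn; have sz : size (map (@inord n) p) <= n.
  by rewrite size_map (leq_trans (size_le_sumn pP)).
exists (Bseq sz) => /=; rewrite -map_comp -[RHS]map_id.
apply/eq_in_map => x xp /=; rewrite inordK // ltnS.
exact: leq_trans (mem_le_sumn xp) pn.
Qed.

Lemma pptildeP n : exists s : seq (seq nat * seq nat),
  [/\ uniq s,
      forall p, (p \in s) = PPtilde p && (sumn p.1 + sumn p.2 == n)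
    & pptilde n = size s].
Proof.
pose f (p : n.-bseq 'I_n.+1 * n.-bseq 'I_n.+1) := (map val p.1, map val p.2).
have f_inj : injective f.
  move=> [a b] [c d] [/= /(inj_map val_inj) h1 /(inj_map val_inj) h2].
  by congr pair; apply: val_inj.
exists (map f (enum [set p | PPtilde (f p) &&
  (sumn (f p).1 + sumn (f p).2 == n)])).
split; last by rewrite size_map -cardE.
  by rewrite map_inj_uniq ?enum_uniq.
move=> p; apply/mapP/idP => [[q]|H].
  by rewrite mem_enum inE => h ->.
have /andP[] := H => /and5P[p1 p2 _ _ _] /eqP pn.
have [b1 e1] : exists b : n.-bseq 'I_n.+1, map val b = p.1.
  by apply: bseq_lift => //; rewrite -[leqRHS]pn leq_addr.
have [b2 e2] : exists b : n.-bseq 'I_n.+1, map val b = p.2.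
  by apply: bseq_lift => //; rewrite -[leqRHS]pn leq_addl.
have fE : f (b1, b2) = p by rewrite /f /= e1 e2; case: (p).
exists (b1, b2) => //; rewrite mem_enum inE.
by rewrite fE.
Qed.

(* Main.v *)
(** Write [F] for the generating function of pptilde, [P_k] for that of the sum of
    the [k]-th powers of the divisors, [P = P_1], [theta] for [q d/dq], and put
      [J = sum_(l >= 0) (-1)^l (2l+1) q^(l(l+1)/2)],
      [L = sum_(n >= 1) (-1)^n n q^(n(n+1)/2) / (1 - q^n)].
    The theorem rests on the identity
      [J(q^3) F(q) = P(q) - P(q^3) - 2 L(q^3)],
    which at once gives the congruence modulo 3, because 3 divides sigma(3n+2).
    The product of [F] and the Euler function is turned into a Lambert-type series
    by a Bailey pair; the product of [P(q) - P(q^3)] and the Euler function, in its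
    pentagonal form, is an Appell-type sum.  The two sums are compared through the
    involution [x -> N/x] on the divisors of an auxiliary [N].

    Modulo 5, multiply the identity by [P(q^3)].  From [theta J = -3 P J] and
    [12 P^2 = 5 P_3 + P - 6 theta P] one gets [theta (P J) = P J] mod 5, so [P J]
    is [q] times a series in [q^5], and it suffices that the coefficients of
    [(P(q) - P(q^3) - 2 L(q^3)) P(q^3)] at exponents 1 and 2 mod 5 vanish.
    The products [P^2] and [P(q) P(q^3)] are linearised by convolution identities.
    The product [L P] is read off the sums
      [S_k = sum (-1)^n a^k q^(n(n+1)/2 + n s)]  over [n >= 1], [s >= 0],
    with [a = 2(n+s)+1]: one has [S_1 = 2 L - P] and
    [S_3 = 2 L - 7 P_3 - 18 theta P - 48 L P], while 8 times the exponent is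
    [a^2 - (2s+1)^2], so that [a^3 = a] mod 5 at exponents 2 and 4 mod 5. *)

Require Import Defs.
From mathcomp Require Import all_boot.
From HB Require Import structures.
From mathcomp Require Import all_order all_algebra.
From mathcomp Require Import boolp.
From mathcomp Require Import zify ring lra.
Set Implicit Arguments.
Unset Strict Implicit.
Unset Printing Implicit Defensive.
Import Order.TTheory GRing.Theory Num.Theory.
Local Open Scope ring_scope.

(** * Formal power series over the integers *)

(** The Euler function enters because the pairs whose first partition has smallest part t+1
    contribute q^(t+1) times (q)_t/(q)_oo times (q)_t/(q)_(2t+1). The infinite product cancels, and
    the sum of q^(t+1) (q)_t^2/(q)_(2t+1) that remains has the shape of Bailey's lemma at unit
    parameters. The auxiliary N attached to an exponent e is 2(3e - 1): completing the square turns
    the exponents of both sums into factorisations x y = N, and N = 1 mod 3 gives x and N/x the same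
    value of the character mod 3. Modulo 3 the factor J(q^3) is harmless, being a series in q^3.
    Modulo 5 it mixes residue classes, which is why P(q^3) is brought in: P(q^3) J(q^3) starts at
    q^3 and is supported modulo 5 on exponents 3 mod 15, so the classes 3 and 4 move to 1 and 2. If
    3 divides such an exponent, the quotient is 2 or 4 mod 5, the classes in which S_3 and S_1
    agree. No product formula for J is used: theta J and L P both come from evaluating S_1 and S_3
    twice, directly and after multiplication by J. *)

Record fps := Fps { cf : nat -> int }.

HB.instance Definition _ := gen_eqMixin fps.
HB.instance Definition _ := gen_choiceMixin fps.

Lemma fpsP (f g : fps) : (forall n, cf f n = cf g n) -> f = g.
Proof. by case: f g => f [g] /= /funext->. Qed.

Definition fps_add f g := Fps (fun n => cf f n + cf g n).
Definition fps_opp f := Fps (fun n => - cf f n).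
Definition fps_mul f g :=
  Fps (fun n => \sum_(i < n.+1) cf f i * cf g (n - i)).
Definition fps_const (c : int) := Fps (fun n => if n == 0%N then c else 0).

Fact fps_addA : associative fps_add.
Proof. by move=> f g h; apply: fpsP => n /=; rewrite addrA. Qed.
Fact fps_addC : commutative fps_add.
Proof. by move=> f g; apply: fpsP => n /=; rewrite addrC. Qed.
Fact fps_add0 : left_id (fps_const 0) fps_add.
Proof. by move=> f; apply: fpsP => n /=; rewrite if_same add0r. Qed.
Fact fps_addN : left_inverse (fps_const 0) fps_opp fps_add.
Proof. by move=> f; apply: fpsP => n /=; rewrite if_same addNr. Qed.

HB.instance Definition _ :=
  GRing.isZmodule.Build fps fps_addA fps_addC fps_add0 fps_addN.

Lemma cf0 n : cf 0 n = 0. Proof. by rewrite /= if_same. Qed.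
Lemma cfD f g n : cf (f + g) n = cf f n + cf g n. Proof. by []. Qed.
Lemma cfN f n : cf (- f) n = - cf f n. Proof. by []. Qed.
Lemma cfB f g n : cf (f - g) n = cf f n - cf g n. Proof. by []. Qed.

Definition trunc n (f : fps) : {poly int} := \poly_(i < n.+1) cf f i.

(** Low coefficients of a product only see truncations, so commutativity and associativity are
    inherited from [{poly int}]. *)
Fact cf_mul_trunc f g m n : (n <= m)%N ->
  cf (fps_mul f g) n = (trunc m f * trunc m g)`_n.
Proof.
move=> nm; rewrite coefM /=; apply: eq_bigr => i _.
have ni : (i <= n)%N by rewrite -ltnS.
by rewrite !coef_poly !ltnS (leq_trans ni nm) (leq_trans (leq_subr _ _) nm).
Qed.

Fact fps_mulC : commutative fps_mul.
Proof.
by move=> f g; apply: fpsP => n; rewrite !(@cf_mul_trunc _ _ n n) // mulrC.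
Qed.

Fact fps_mulA : associative fps_mul.
Proof.
have E f g h n : cf (fps_mul f (fps_mul g h)) n =
    (trunc n f * (trunc n g * trunc n h))`_n.
  rewrite coefM /=; apply: eq_bigr => i _.
  have ni : (i <= n)%N by rewrite -ltnS.
  rewrite [in RHS]coef_poly ltnS ni; congr (_ * _).
  exact: (@cf_mul_trunc g h n (n - i)%N (leq_subr _ _)).
move=> f g h; apply: fpsP => n.
by rewrite E [in RHS]fps_mulC E mulrA [in RHS]mulrC.
Qed.

Fact fps_mul1 : left_id (fps_const 1) fps_mul.
Proof.
move=> f; apply: fpsP => n /=; rewrite big_ord_recl /= mul1r subn0.
by rewrite big1 ?addr0 // => i _; rewrite /= mul0r.
Qed.

Fact fps_mulDl : left_distributive fps_mul fps_add.
Proof.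
move=> f g h; apply: fpsP => n /=; rewrite -big_split /=.
by apply: eq_bigr => i _; rewrite mulrDl.
Qed.

Fact fps_1_neq0 : fps_const 1 != 0 :> fps.
Proof. by apply/eqP => /(congr1 (fun f => cf f 0%N)). Qed.

HB.instance Definition _ := GRing.Zmodule_isComNzRing.Build fps
  fps_mulA fps_mulC fps_mul1 fps_mulDl fps_1_neq0.

Lemma cf1 n : cf 1 n = (n == 0%N)%:R. Proof. by rewrite /=; case: eqP. Qed.
Lemma cfM (f g : fps) n :
  cf (f * g) n = \sum_(i < n.+1) cf f i * cf g (n - i).
Proof. by []. Qed.

Lemma cfMn f m n : cf (f *+ m) n = cf f n *+ m.
Proof.
elim: m => [|m IH]; first by rewrite !mulr0n cf0.
by rewrite !mulrSr cfD IH.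
Qed.

Lemma cf_sum I (r : seq I) (p : pred I) (F : I -> fps) n :
  cf (\sum_(i <- r | p i) F i) n = \sum_(i <- r | p i) cf (F i) n.
Proof.
apply: (big_morph (fun f => cf f n)) => [f g|]; first exact: cfD.
exact: cf0.
Qed.

Lemma cfnat m n : cf m%:R n = m%:R * (n == 0%N)%:R.
Proof. by rewrite cfMn cf1 mulr_natl. Qed.

Lemma cfint (z : int) n : cf z%:~R n = z * (n == 0%N)%:R.
Proof.
case: z => m; first by rewrite -pmulrn cfnat pmulrn intz.
by rewrite NegzE mulrNz cfN -pmulrn cfnat mulNr pmulrn intz.
Qed.

Lemma cfZint (z : int) (f : fps) n : cf (z%:~R * f) n = z * cf f n.
Proof.
rewrite cfM big_ord_recl /= subn0 cfint eqxx mulr1 big1 ?addr0 // => i _.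
by rewrite cfint /= mulr0 mul0r.
Qed.

Lemma cfZnat (m : nat) (f : fps) n : cf (m%:R * f) n = m%:R * cf f n.
Proof. by rewrite mulr_natl cfMn mulr_natl. Qed.

Definition X (m : nat) : fps := Fps (fun n => (n == m)%:R).

Lemma cfXM m (f : fps) n : cf (X m * f) n = if (m <= n)%N then cf f (n - m) else 0.
Proof.
rewrite cfM; case: leqP => mn.
  have lt : (m < n.+1)%N by [].
  rewrite (bigD1 (Ordinal lt)) //= eqxx mul1r big1 ?addr0 // => i.
  by rewrite -val_eqE /= => /negPf->; rewrite mul0r.
rewrite big1 // => i _ /=; case: eqP => [im|]; last by rewrite mul0r.
by move: (ltn_ord i); rewrite im ltnS leqNgt mn.
Qed.

Lemma X0 : X 0 = 1.
Proof. by apply: fpsP => n; rewrite cf1. Qed.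

Lemma XD m n : X (m + n) = X m * X n.
Proof.
apply: fpsP => k; rewrite cfXM /=; case: leqP => mk; last first.
  by case: eqP => // E; move: mk; rewrite E ltnNge leq_addr.
congr ((_ : bool)%:R); lia.
Qed.

Lemma XX m n : X m ^+ n = X (m * n).
Proof.
elim: n => [|n IH]; first by rewrite muln0 X0.
by rewrite exprS IH -XD mulnS.
Qed.

(* The inverse of [1 - X m] for [0 < m]; [geo 0] is a junk value. *)
Definition geo (m : nat) : fps := Fps (fun n => (m %| n)%:R).

Lemma geoE m : (0 < m)%N -> (1 - X m) * geo m = 1.
Proof.
move=> m0; apply: fpsP => n; rewrite mulrBl mul1r cfB cfXM cf1 /=.
case: leqP => mn; last first.
  rewrite subr0; case: n mn => [|n] mn; first by rewrite dvdn0.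
  by rewrite gtnNdvd.
rewrite dvdn_subl ?dvdnn // subrr; case: n mn => //.
by rewrite leqNgt m0.
Qed.

Lemma geoK m (f g : fps) : (0 < m)%N -> (1 - X m) * f = (1 - X m) * g -> f = g.
Proof.
move=> m0 E; rewrite -[f]mul1r -[g]mul1r -(geoE m0).
by rewrite [_ * geo m]mulrC -!mulrA E.
Qed.

(** The first nonzero coefficient of [f - g] would survive multiplication by [u]. In this way
    q-factorials, the Euler function and [Jac] are divided out. *)
Lemma unit_cancel (u f g : fps) : cf u 0 = 1 -> u * f = u * g -> f = g.
Proof.
move=> u0 E; apply/eqP; rewrite -subr_eq0; apply/eqP.
have {E} : u * (f - g) = 0 by rewrite mulrBr E subrr.
move: (f - g) => {f g} f E; apply: fpsP => n; rewrite cf0.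
elim/ltn_ind: n => n IH; have /(congr1 (fun f => cf f n)) := E.
rewrite cfM big_ord_recl /= u0 mul1r subn0 if_same big1 ?addr0 // => i _.
rewrite IH ?mulr0 //; case: i => i /= lti; rewrite /bump /=; lia.
Qed.

(** * Summable families *)

Definition lowz n (f : fps) := forall m, (m <= n)%N -> cf f m = 0.

Lemma lowz0 n : lowz n 0. Proof. by move=> m _; rewrite cf0. Qed.
Lemma lowzD n f g : lowz n f -> lowz n g -> lowz n (f + g).
Proof. by move=> f0 g0 m mn; rewrite cfD f0 ?g0. Qed.
Lemma lowzN n f : lowz n f -> lowz n (- f).
Proof. by move=> f0 m mn; rewrite cfN f0 ?oppr0. Qed.
Lemma lowzB n f g : lowz n f -> lowz n g -> lowz n (f - g).
Proof. by move=> f0 g0; apply/lowzD/lowzN. Qed.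
Lemma lowzMl n (f g : fps) : lowz n g -> lowz n (f * g).
Proof.
move=> g0 m mn; rewrite cfM big1 // => i _; rewrite g0 ?mulr0 //.
exact: leq_trans (leq_subr _ _) mn.
Qed.
Lemma lowzMr n (f g : fps) : lowz n f -> lowz n (f * g).
Proof. by move=> f0; rewrite mulrC; apply: lowzMl. Qed.
Lemma lowzX n m : (n < m)%N -> lowz n (X m).
Proof. by move=> nm k kn /=; case: eqP => // km; lia. Qed.
Lemma lowz_sum n I (r : seq I) (p : pred I) (F : I -> fps) :
  (forall i, p i -> lowz n (F i)) -> lowz n (\sum_(i <- r | p i) F i).
Proof.
by move=> F0; apply: big_ind => //; [apply: lowz0 | apply: lowzD].
Qed.
Lemma lowz_eq f g : (forall n, lowz n (f - g)) -> f = g.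
Proof.
by move=> fg; apply: fpsP => n; apply/eqP; rewrite -subr_eq0 -cfB (fg n).
Qed.

Definition summ (F : nat -> fps) :=
  forall n, exists B, forall k, (B <= k)%N -> lowz n (F k).

(* Where the [n]-th coefficients of the [F k] do not vanish eventually, the value
   is the junk coefficient 0. *)
Definition fsum (F : nat -> fps) : fps := Fps (fun n =>
  if pselect (exists B, forall k, (B <= k)%N -> cf (F k) n = 0) is left e
  then \sum_(0 <= k < projT1 (cid e)) cf (F k) n else 0).

Lemma sum_widen (R : zmodType) (F : nat -> R) B B' : (B <= B')%N ->
  (forall k, (B <= k)%N -> F k = 0) ->
  \sum_(0 <= k < B') F k = \sum_(0 <= k < B) F k.
Proof.
move=> BB F0; rewrite (@big_cat_nat _ _ _ B 0 B') //= [X in _ + X]big_nat_cond.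
by rewrite [X in _ + X]big1 ?addr0 // => k /andP[/andP[/F0]].
Qed.

Lemma fsum_approx F : summ F -> forall n, exists B0, forall B, (B0 <= B)%N ->
  lowz n (fsum F - \sum_(0 <= k < B) F k).
Proof.
move=> sF n; have [B0 F0] := sF n; exists B0 => B BB m mn.
rewrite cfB cf_sum /fsum /=; case: pselect => [e|[]]; last first.
  by exists B0 => k /F0; apply.
case: (cid e) => C /= C0; apply/eqP; rewrite subr_eq0; apply/eqP.
have z k : (B0 <= k)%N -> cf (F k) m = 0 by move=> /F0; apply.
rewrite -(@sum_widen _ _ C (maxn B C)) ?leq_maxr //.
rewrite (@sum_widen _ _ B (maxn B C)) ?leq_maxl // => k Bk.
exact/z/(leq_trans BB).
Qed.

Lemma eq_fsum F G : F =1 G -> fsum F = fsum G.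
Proof. by move=> /funext->. Qed.

Lemma eq_summ F G : F =1 G -> summ F -> summ G.
Proof. by move=> /funext->. Qed.

Lemma fsumP F S : summ F ->
  (forall n, exists B0, forall B, (B0 <= B)%N ->
     lowz n (S - \sum_(0 <= k < B) F k)) -> fsum F = S.
Proof.
move=> sF apx; apply: lowz_eq => n.
have [B1 H1] := fsum_approx sF n; have [B2 H2] := apx n.
rewrite -(subrKA (\sum_(0 <= k < maxn B1 B2) F k)) -[X in _ + X]opprB.
by apply: lowzB; [apply/H1/leq_maxl | apply/H2/leq_maxr].
Qed.

Lemma summD F G : summ F -> summ G -> summ (fun k => F k + G k).
Proof.
move=> sF sG n; have [B1 H1] := sF n; have [B2 H2] := sG n.
exists (maxn B1 B2) => k; rewrite geq_max => /andP[k1 k2].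
by apply: lowzD; [apply: H1|apply: H2].
Qed.
Lemma summZ (c : fps) F : summ F -> summ (fun k => c * F k).
Proof. by move=> sF n; have [B H] := sF n; exists B => k /H; apply: lowzMl. Qed.
Lemma summN F : summ F -> summ (fun k => - F k).
Proof. by move=> sF n; have [B H] := sF n; exists B => k /H; apply: lowzN. Qed.
Lemma summB F G : summ F -> summ G -> summ (fun k => F k - G k).
Proof. by move=> sF /summN; apply: summD. Qed.
Lemma summMl (c : nat -> fps) F : summ F -> summ (fun k => c k * F k).
Proof. by move=> sF n; have [B H] := sF n; exists B => k /H; apply: lowzMl. Qed.
Lemma summMr (c : nat -> fps) F : summ F -> summ (fun k => F k * c k).
Proof. by move=> sF n; have [B H] := sF n; exists B => k /H; apply: lowzMr. Qed.
Lemma summS a F : summ F -> summ (fun k => F (k + a)%N).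
Proof. by move=> sF n; have [B H] := sF n; exists B => k Bk; apply: H; lia. Qed.
Lemma summX (e : nat -> nat) : (forall k, (k <= e k)%N) -> summ (fun k => X (e k)).
Proof. by move=> le n; exists n.+1 => k nk; apply/lowzX/(leq_trans nk). Qed.

Lemma fsumD F G : summ F -> summ G ->
  fsum (fun k => F k + G k) = fsum F + fsum G.
Proof.
move=> sF sG; apply: fsumP => [|n]; first exact: summD.
have [B1 H1] := fsum_approx sF n; have [B2 H2] := fsum_approx sG n.
exists (maxn B1 B2) => B; rewrite geq_max => /andP[k1 k2].
by rewrite big_split /= opprD addrACA; apply: lowzD; [apply: H1|apply: H2].
Qed.

Lemma fsumZ (c : fps) F : summ F -> fsum (fun k => c * F k) = c * fsum F.
Proof.
move=> sF; apply: fsumP => [|n]; first exact: summZ.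
have [B0 H] := fsum_approx sF n; exists B0 => B BB.
by rewrite -mulr_sumr -mulrBr; apply/lowzMl/H.
Qed.

Lemma fsumN F : summ F -> fsum (fun k => - F k) = - fsum F.
Proof.
move=> sF; rewrite -mulN1r -fsumZ //; apply: eq_fsum => k.
by rewrite mulN1r.
Qed.

Lemma fsumB F G : summ F -> summ G ->
  fsum (fun k => F k - G k) = fsum F - fsum G.
Proof. by move=> sF sG; rewrite fsumD ?fsumN //; apply: summN. Qed.

Lemma fsum0 : fsum (fun=> 0) = 0.
Proof.
apply: fsumP => [n|n]; first by exists 0%N => k _; apply: lowz0.
by exists 0%N => B _; rewrite big1 ?subrr //; apply: lowz0.
Qed.

Lemma fsum_cut a F : summ F ->
  fsum F = \sum_(0 <= k < a) F k + fsum (fun k => F (k + a)%N).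
Proof.
move=> sF; apply: fsumP => // n.
have [B0 H] := fsum_approx (summS a sF) n; exists (B0 + a)%N => B BB.
rewrite (@big_cat_nat _ _ _ a 0 B) //=; last by lia.
rewrite opprD addrACA subrr add0r -{2}[a]add0n big_addn.
by apply: H; lia.
Qed.

Lemma fsum_recl F : summ F -> fsum F = F 0%N + fsum (fun k => F k.+1).
Proof.
move=> sF; rewrite (fsum_cut 1 sF) big_nat1; congr (_ + _).
by apply: eq_fsum => k; rewrite addn1.
Qed.

Lemma summ_fin B F : (forall k, (B <= k)%N -> F k = 0) -> summ F.
Proof. by move=> F0 n; exists B => k /F0->; apply: lowz0. Qed.

Lemma fsum_fin B F : (forall k, (B <= k)%N -> F k = 0) ->
  fsum F = \sum_(0 <= k < B) F k.
Proof.
move=> F0; rewrite (fsum_cut B (summ_fin F0)).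
rewrite (@eq_fsum _ (fun=> 0)) ?fsum0 ?addr0 // => k.
by rewrite F0 // leq_addl.
Qed.

Definition summ2 (F : nat -> nat -> fps) := forall n, exists B, forall k l,
  (B <= maxn k l)%N -> lowz n (F k l).

Lemma summ2_row F k : summ2 F -> summ (F k).
Proof. by move=> sF n; have [B H] := sF n; exists B => l Bl; apply: H; lia. Qed.

Lemma summ2C F : summ2 F -> summ2 (fun k l => F l k).
Proof.
by move=> sF n; have [B H] := sF n; exists B => k l; rewrite maxnC; apply: H.
Qed.

Lemma lowz_fsum n F : summ F -> (forall k, lowz n (F k)) -> lowz n (fsum F).
Proof.
move=> sF F0; have [B H] := fsum_approx sF n.
rewrite -(subrK (\sum_(0 <= k < B) F k) (fsum F)); apply: lowzD; first exact: H.
exact: lowz_sum.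
Qed.

Lemma summ2_fsum F : summ2 F -> summ (fun k => fsum (F k)).
Proof.
move=> sF n; have [B H] := sF n; exists B => k Bk.
by apply: lowz_fsum => [|l]; [apply: summ2_row | apply: H; lia].
Qed.

Lemma fsum_approx2 F : summ2 F -> forall n, exists B0, forall B, (B0 <= B)%N ->
  lowz n (fsum (fun k => fsum (F k)) -
          \sum_(0 <= k < B) \sum_(0 <= l < B) F k l).
Proof.
move=> sF n; have [B0 H0] := sF n.
have [B1 H1] := fsum_approx (summ2_fsum sF) n.
exists (maxn B0 B1) => B; rewrite geq_max => /andP[b0 b1].
rewrite -(subrKA (\sum_(0 <= k < B) fsum (F k))); apply: lowzD; first exact: H1.
rewrite -sumrB; apply: lowz_sum => k _.
rewrite (fsum_cut B (summ2_row k sF)) addrC addKr.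
by apply: lowz_fsum => [|l]; [apply/summS/summ2_row | apply: H0; lia].
Qed.

Lemma fsum_exch F : summ2 F ->
  fsum (fun k => fsum (F k)) = fsum (fun l => fsum (fun k => F k l)).
Proof.
move=> sF; apply: lowz_eq => n.
have [B1 H1] := fsum_approx2 sF n.
have [B2 H2] := fsum_approx2 (summ2C sF) n.
set B := maxn B1 B2.
rewrite -(subrKA (\sum_(0 <= k < B) \sum_(0 <= l < B) F k l)).
rewrite -[X in _ + X]opprB [X in _ - (_ - X)]exchange_big /=.
by apply: lowzB; [apply/H1/leq_maxl | apply/H2/leq_maxr].
Qed.

Lemma summ2_diag F : summ2 F ->
  summ2 (fun a c => if (a <= c)%N then F a (c - a)%N else 0).
Proof.
move=> sF n; have [B H] := sF n; exists (2 * B)%N => a c Bac.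
by case: leqP => ac; [apply: H; lia | apply: lowz0].
Qed.

Lemma fsum_diag F : summ2 F ->
  fsum (fun a => fsum (F a)) =
  fsum (fun c => \sum_(0 <= a < c.+1) F a (c - a)%N).
Proof.
move=> sF; pose G a c := if (a <= c)%N then F a (c - a)%N else 0.
transitivity (fsum (fun a => fsum (G a))).
  apply: eq_fsum => a.
  rewrite (fsum_cut a (summ2_row a (summ2_diag sF))) big_nat_cond big1 ?add0r.
    by apply: eq_fsum => b; rewrite leq_addl addnK.
  by move=> c; rewrite andbT /= => ca; rewrite leqNgt ca.
rewrite fsum_exch; last exact: summ2_diag.
apply: eq_fsum => c; rewrite (@fsum_fin c.+1) => [|a].
  by apply: eq_big_nat => a; rewrite /= ltnS /G => ->.
by rewrite /G ltnNge => /negPf->.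
Qed.

(** * The Euler operator and the substitution of q^3 *)

Definition theta (f : fps) : fps := Fps (fun n => n%:R * cf f n).

Lemma cf_theta f n : cf (theta f) n = n%:R * cf f n. Proof. by []. Qed.
Lemma thetaD f g : theta (f + g) = theta f + theta g.
Proof. by apply: fpsP => n; rewrite /= mulrDr. Qed.
Lemma thetaN f : theta (- f) = - theta f.
Proof. by apply: fpsP => n; rewrite /= mulrN. Qed.
Lemma theta_sum I (r : seq I) (p : pred I) (F : I -> fps) :
  theta (\sum_(i <- r | p i) F i) = \sum_(i <- r | p i) theta (F i).
Proof.
apply: (big_morph theta thetaD).
by apply: fpsP => n; rewrite cf0 /= if_same mulr0.
Qed.
Lemma thetaM (f g : fps) : theta (f * g) = theta f * g + f * theta g.
Proof.
apply: fpsP => n; rewrite cfD !cfM /= -big_split mulr_sumr.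
apply: eq_bigr => i _ /=; have : (i <= n)%N by rewrite -ltnS.
move=> /subnK {1}<-; rewrite natrD; ring.
Qed.
Lemma thetaX m : theta (X m) = m%:R * X m.
Proof.
by apply: fpsP => n; rewrite cfZnat /=; case: eqP => [->|]; rewrite ?mulr0.
Qed.
Lemma thetaZint (z : int) f : theta (z%:~R * f) = z%:~R * theta f.
Proof. by apply: fpsP => n; rewrite cf_theta !cfZint cf_theta mulrCA. Qed.
Lemma lowz_theta n f : lowz n f -> lowz n (theta f).
Proof. by move=> f0 m mn; rewrite /= f0 ?mulr0. Qed.
Lemma summ_theta F : summ F -> summ (fun k => theta (F k)).
Proof. by move=> sF n; have [B H] := sF n; exists B => k /H; apply: lowz_theta. Qed.
Lemma theta_fsum F : summ F -> theta (fsum F) = fsum (fun k => theta (F k)).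
Proof.
move=> sF; symmetry; apply: fsumP => [|n]; first exact: summ_theta.
have [B0 H] := fsum_approx sF n; exists B0 => B BB.
by rewrite -theta_sum -thetaN -thetaD; apply/lowz_theta/H.
Qed.

(* The substitution of [q^3] for [q]. *)
Definition sub3 (f : fps) : fps :=
  Fps (fun n => if (3 %| n)%N then cf f (n %/ 3) else 0).

Lemma cf_sub3 f n :
  cf (sub3 f) n = if (3 %| n)%N then cf f (n %/ 3) else 0.
Proof. by []. Qed.
Lemma sub3D f g : sub3 (f + g) = sub3 f + sub3 g.
Proof. by apply: fpsP => n /=; case: ifP; rewrite ?addr0. Qed.
Lemma sub3N f : sub3 (- f) = - sub3 f.
Proof. by apply: fpsP => n /=; case: ifP; rewrite ?oppr0. Qed.
Lemma sub3B f g : sub3 (f - g) = sub3 f - sub3 g.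
Proof. by rewrite sub3D sub3N. Qed.
Lemma sub3_sum I (r : seq I) (p : pred I) (F : I -> fps) :
  sub3 (\sum_(i <- r | p i) F i) = \sum_(i <- r | p i) sub3 (F i).
Proof.
apply: (big_morph sub3 sub3D).
by apply: fpsP => n /=; rewrite !if_same.
Qed.
Lemma sub3X m : sub3 (X m) = X (3 * m).
Proof.
apply: fpsP => n /=; case: ifP => [/dvdnP[k ->]|n3].
  by rewrite mulnK // mulnC eqn_pmul2l.
by case: eqP => // E; rewrite E dvdn_mulr in n3.
Qed.
Lemma sub31 : sub3 1 = 1.
Proof. by rewrite -X0 sub3X. Qed.
Lemma sub3Zint (z : int) f : sub3 (z%:~R * f) = z%:~R * sub3 f.
Proof.
by apply: fpsP => n; rewrite cf_sub3 !cfZint cf_sub3; case: ifP; rewrite ?mulr0.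
Qed.
Lemma lowz_sub3 n f : lowz n f -> lowz n (sub3 f).
Proof.
move=> f0 m mn /=; case: ifP => // _; apply: f0; apply: leq_trans mn.
exact: leq_div.
Qed.
Lemma sub3XM m (f : fps) : sub3 (X m * f) = X (3 * m) * sub3 f.
Proof.
apply: fpsP => n; rewrite cfXM !cf_sub3.
case: ifP => [/dvdnP[k ->]|n3].
  rewrite mulnK // [(k * 3)%N]mulnC leq_pmul2l // cfXM; case: leqP => // mk.
  by rewrite -mulnBr dvdn_mulr // mulKn.
case: leqP => // mn; case: ifP => // n3'.
by move: n3; rewrite -(subnK mn) dvdn_addl ?dvdn_mulr // n3'.
Qed.
Lemma summ_sub3 F : summ F -> summ (fun k => sub3 (F k)).
Proof. by move=> sF n; have [B H] := sF n; exists B => k /H; apply: lowz_sub3. Qed.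
Lemma sub3_fsum F : summ F -> sub3 (fsum F) = fsum (fun k => sub3 (F k)).
Proof.
move=> sF; symmetry; apply: fsumP => [|n]; first exact: summ_sub3.
have [B0 H] := fsum_approx sF n; exists B0 => B BB.
by rewrite -sub3_sum -sub3B; apply/lowz_sub3/H.
Qed.
(** Reduces the multiplicativity of [sub3] to a monomial factor. *)
Lemma fsum_mono f : summ (fun k => (cf f k)%:~R * X k) /\
  f = fsum (fun k => (cf f k)%:~R * X k).
Proof.
have s : summ (fun k => (cf f k)%:~R * X k) by apply/summMl/summX.
split=> //; symmetry; apply: fsumP => // n; exists n.+1 => B nB m mn.
rewrite cfB cf_sum (bigD1_seq m) ?iota_uniq ?mem_index_iota //; last by lia.
rewrite big1 => [|k km]; first by rewrite cfZint /= eqxx mulr1 addr0 subrr.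
by rewrite cfZint /= eq_sym (negPf km) mulr0.
Qed.
Lemma sub3M (f g : fps) : sub3 (f * g) = sub3 f * sub3 g.
Proof.
have [sf ef] := fsum_mono f.
rewrite {1}ef mulrC -fsumZ // sub3_fsum; last exact: summMl.
rewrite {2}ef sub3_fsum // mulrC -fsumZ; last exact: summ_sub3.
apply: eq_fsum => k.
by rewrite mulrCA [g * _]mulrC !sub3Zint sub3XM sub3X; ring.
Qed.
Lemma sub3_geo m : sub3 (geo m) = geo (3 * m).
Proof.
apply: fpsP => n /=; case: ifP => [/dvdnP[k ->]|n3].
  by rewrite mulnK // mulnC dvdn_pmul2r.
by case: (boolP (3 * m %| n)%N) => // /dvdnP[k E]; move: n3; rewrite E mulnCA dvdn_mulr.
Qed.

(** * Bilateral sums *)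

Definition zsumm (F : int -> fps) :=
  forall n, exists B : nat, forall k : int, (B <= `|k|)%N -> lowz n (F k).

Definition zsum (F : int -> fps) : fps :=
  fsum (fun k => F k%:Z) + fsum (fun k => F (- (k.+1)%:Z)).

(** The bound on [h] expresses that it leaves every finite set at a linear rate, as the affine
    reindexings below do. *)
Lemma zsumm_nat (F : int -> fps) (h : nat -> int) : zsumm F ->
  (exists c, forall k, (k <= `|h k| + c)%N) -> summ (fun k => F (h k)).
Proof.
move=> sF [c hk] n; have [B H] := sF n; exists (B + c)%N => k Bk.
by apply: H; have := hk k; lia.
Qed.

Lemma zsumm_int (F : int -> fps) (h : int -> int) : zsumm F ->
  (exists c, forall k, (`|k| <= `|h k| + c)%N) -> zsumm (fun k => F (h k)).
Proof.
move=> sF [c hk] n; have [B H] := sF n; exists (B + c)%N => k Bk.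
by apply: H; have := hk k; lia.
Qed.

Lemma zsumm_pos F : zsumm F -> summ (fun k => F k%:Z).
Proof. by move=> sF; apply: (zsumm_nat sF); exists 0%N => k; lia. Qed.
Lemma zsumm_neg F : zsumm F -> summ (fun k => F (- (k.+1)%:Z)).
Proof. by move=> sF; apply: (zsumm_nat sF); exists 0%N => k; lia. Qed.
Lemma zsumm_opp F : zsumm F -> summ (fun k => F (- k%:Z)).
Proof. by move=> sF; apply: (zsumm_nat sF); exists 0%N => k; lia. Qed.
#[local] Hint Resolve zsumm_pos zsumm_neg zsumm_opp : core.

Lemma zsummMl (c : int -> fps) F : zsumm F -> zsumm (fun k => c k * F k).
Proof. by move=> sF n; have [B H] := sF n; exists B => k /H; apply: lowzMl. Qed.
Lemma zsummD F G : zsumm F -> zsumm G -> zsumm (fun k => F k + G k).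
Proof.
move=> sF sG n; have [B1 H1] := sF n; have [B2 H2] := sG n.
exists (maxn B1 B2) => k; rewrite geq_max => /andP[k1 k2].
by apply: lowzD; [apply: H1|apply: H2].
Qed.
Lemma zsummN F : zsumm F -> zsumm (fun k => - F k).
Proof. by move=> sF n; have [B H] := sF n; exists B => k /H; apply: lowzN. Qed.

Lemma eq_zsum F G : F =1 G -> zsum F = zsum G.
Proof. by move=> /funext->. Qed.

Lemma zsumD F G : zsumm F -> zsumm G ->
  zsum (fun k => F k + G k) = zsum F + zsum G.
Proof. by move=> sF sG; rewrite /zsum fsumD 1?fsumD; auto; rewrite addrACA. Qed.
Lemma zsumZ (c : fps) F : zsumm F -> zsum (fun k => c * F k) = c * zsum F.
Proof. by move=> sF; rewrite /zsum fsumZ 1?fsumZ; auto; rewrite mulrDr. Qed.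
Lemma zsumN F : zsumm F -> zsum (fun k => - F k) = - zsum F.
Proof. by move=> sF; rewrite /zsum fsumN 1?fsumN; auto; rewrite opprD. Qed.
Lemma zsumB F G : zsumm F -> zsumm G ->
  zsum (fun k => F k - G k) = zsum F - zsum G.
Proof. by move=> sF sG; rewrite zsumD ?zsumN //; apply: zsummN. Qed.

Lemma zsum_opp F : zsumm F -> zsum (fun k => F (- k)) = zsum F.
Proof.
move=> sF; rewrite /zsum [X in X + _]fsum_recl; last by auto.
rewrite [in RHS]fsum_recl; last by auto.
by rewrite oppr0 -!addrA; congr (_ + _); rewrite addrC.
Qed.

Lemma zsum_succ F : zsumm F -> zsum (fun k => F (k + 1)) = zsum F.
Proof.
move=> sF; rewrite /zsum [X in _ = X + _]fsum_recl; last by auto.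
rewrite [X in _ + X]fsum_recl; last first.
  by apply: (zsumm_nat sF); exists 1%N => k; lia.
rewrite addrC -addrA [X in _ + X]addrC addrA; congr (_ + _ + _).
  by apply: eq_fsum => k; congr F; lia.
by apply: eq_fsum => k; congr F; lia.
Qed.

Lemma zsum_shift (m : int) F : zsumm F -> zsum (fun k => F (k + m)) = zsum F.
Proof.
move=> sF.
have shift n : zsum (fun k => F (k + n%:Z)) = zsum F.
  elim: n => [|n IH]; first by apply: eq_zsum => k; rewrite addr0.
  rewrite -IH -[RHS]zsum_succ; first by apply: eq_zsum => k; congr F; lia.
  by apply: (zsumm_int sF); exists n => k; lia.
case: m => n //; rewrite NegzE.
(* A negative shift: moving the shifted family up again gives back [F]. *)
have sG : zsumm (fun k => F (k - n.+1%:Z)).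
  by apply: (zsumm_int sF); exists n.+1 => k; lia.
rewrite -(shift n.+1); pose G k := F (k - n.+1%:Z).
transitivity (zsum G) => //.
have : zsum (fun k => G (k + n.+1%:Z)) = zsum G.
  have : forall n, zsum (fun k => G (k + n%:Z)) = zsum G.
    elim=> [|m IH]; first by apply: eq_zsum => k; rewrite addr0.
    rewrite -IH -[RHS]zsum_succ; first by apply: eq_zsum => k; congr G; lia.
    by apply: (zsumm_int sG); exists m => k; lia.
  exact.
move=> <-; rewrite shift; apply: eq_zsum => k.
by rewrite /G addrK.
Qed.

Lemma zsum_refl (m : int) F : zsumm F -> zsum (fun k => F (m - k)) = zsum F.
Proof.
move=> sF; rewrite -(zsum_shift m sF) -[RHS]zsum_opp; last first.
  by apply: (zsumm_int sF); exists `|m|%N => k; lia.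
by apply: eq_zsum => k; rewrite addrC.
Qed.

Lemma zsum_pair F : zsumm F ->
  zsum F = fsum (fun l => F (l.+1)%:Z + F (- l%:Z)).
Proof.
move=> sF; rewrite fsumD; last 2 first.
- by apply: (zsumm_nat sF); exists 0%N => k; lia.
- by auto.
rewrite /zsum fsum_recl; last by auto.
rewrite [X in _ = _ + X]fsum_recl; last by auto.
by rewrite oppr0 [F 0 + _]addrC -addrA.
Qed.

Lemma zsum_pair0 F : zsumm F -> F 0 = 0 ->
  zsum F = fsum (fun k => F k%:Z + F (- k%:Z)).
Proof.
move=> sF F0; rewrite fsumD; auto.
rewrite [X in _ = _ + X]fsum_recl; last by auto.
by rewrite oppr0 F0 add0r.
Qed.

Lemma torsion_free (n : nat) (f : fps) : n.+1%:R * f = 0 -> f = 0.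
Proof.
move=> E; apply: fpsP => k; have /(congr1 (fun f => cf f k)) := E.
by rewrite cfZnat cf0 => /eqP; rewrite mulf_eq0 pnatr_eq0 => /eqP.
Qed.

Lemma natmul_inj (n : nat) (f g : fps) : n.+1%:R * f = n.+1%:R * g -> f = g.
Proof.
move=> E; apply/eqP; rewrite -subr_eq0; apply/eqP/(@torsion_free n).
by rewrite mulrBr E subrr.
Qed.

(** * Partial theta sums and the Jacobi series *)

Definition tri (r : int) : nat := (`|(r * (r - 1))%R| %/ 2)%N.

Lemma triE r : (tri r)%:Z * 2 = r * (r - 1).
Proof.
rewrite /tri; have : exists m : nat, r * (r - 1) = (m * 2)%N%:Z; last first.
  by case=> m ->; rewrite absz_nat mulnK // PoszM.
case: r => n; last first.
  exists ('C(n.+2, 2)); have := mul_bin_diag n.+2 1; rewrite bin1 /=; nia.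
case: n => [|n]; first by exists 0%N.
by exists ('C(n.+1, 2)); have := mul_bin_diag n.+1 1; rewrite bin1 /=; nia.
Qed.

Lemma tri_ge r : (`|r| <= (tri r).+1)%N.
Proof. by have := triE r; nia. Qed.

Definition sgn (r : int) : fps := (-1) ^+ `|r|%N.

Lemma sgnS (r : int) : sgn (r + 1) = - sgn r.
Proof.
rewrite /sgn; case: r => n; first by rewrite [`|_|%N]addn1 exprS mulN1r.
case: n => [|n]; first by rewrite /= expr0 expr1 opprK.
have -> : (`|(Negz n.+1 + 1)%R| = n.+1)%N by lia.
by rewrite -[absz (Negz n.+1)]/(n.+2) [in RHS]exprS mulN1r opprK.
Qed.
Lemma sgnN (r : int) : sgn (- r) = sgn r. Proof. by rewrite /sgn abszN. Qed.
Lemma sgn0 : sgn 0 = 1. Proof. by []. Qed.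
Definition jj (r : int) : fps := sgn r * X (tri r).

Lemma tri_refl (r : int) : tri (1 - r) = tri r.
Proof. by have := triE (1 - r); have := triE r; lia. Qed.

Lemma jj_refl (r : int) : jj (1 - r) = - jj r.
Proof. by rewrite /jj tri_refl -mulNr addrC sgnS sgnN. Qed.

Lemma lowz_jj n r : (n.+1 < `|r|)%N -> lowz n (jj r).
Proof. by move=> nr; apply/lowzMl/lowzX; have := tri_ge r; lia. Qed.

Lemma zsumm_jj : zsumm jj.
Proof. by move=> n; exists n.+2 => k; apply: lowz_jj. Qed.

Lemma zsum_jj : zsum jj = 0.
Proof.
apply: (@torsion_free 1); rewrite mulr_natl mulr2n.
have {1}-> : zsum jj = - zsum jj; last by rewrite addNr.
rewrite -{1}(zsum_refl 1 zsumm_jj) -zsumN; last exact: zsumm_jj.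
by apply: eq_zsum => k; rewrite jj_refl.
Qed.

(** This is q^r jj(r) = -jj(r+1); writing r as a difference keeps the exponents natural when r is
    negative. *)
Lemma jj_shift (a b : nat) (r : int) : r = a%:Z - b%:Z ->
  X a * jj r = - (X b * jj (r + 1)).
Proof.
move=> E; rewrite /jj sgnS mulNr mulrN opprK ![X _ * (_ * _)]mulrCA -!XD.
by congr (_ * X _); have := triE r; have := triE (r + 1); nia.
Qed.

Lemma geo1 k : (0 < k)%N -> X k * geo k = geo k - 1.
Proof.
move=> k0; apply/eqP; rewrite -subr_eq0; apply/eqP.
by rewrite -[1 in X in _ - X](geoE k0); ring.
Qed.

Definition lam (k : nat) : fps := X k * geo k.

Lemma lowz_lam n k : (n < k)%N -> lowz n (lam k).
Proof. by move=> nk; apply/lowzMr/lowzX. Qed.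

Lemma summ_lam : summ lam.
Proof. by move=> n; exists n.+1 => k; apply: lowz_lam. Qed.

Lemma summ_jjD (m : int) : summ (fun k => jj (m + k%:Z)).
Proof. by apply: (zsumm_nat zsumm_jj); exists `|m|%N => k; lia. Qed.

Lemma summ_jjB (m : int) : summ (fun k => jj (m - k%:Z)).
Proof. by apply: (zsumm_nat zsumm_jj); exists `|m|%N => k; lia. Qed.

(** Pairing r = l+1 with r = -l yields the terms (-1)^l (2l+1) q^(l(l+1)/2) of the Jacobi series. *)
Definition Jac : fps := - zsum (fun r => r%:~R * jj r).

Lemma zsumm_rjj : zsumm (fun r => r%:~R * jj r).
Proof. exact/zsummMl/zsumm_jj. Qed.

(** The centre [m] is free: recentring a first moment adds a multiple of the zeroth moment, which
    vanishes by [zsum_jj]. *)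
Lemma JacE (m : int) :
  fsum (fun k => k%:R * (jj (m - k%:Z) - jj (m + k%:Z))) = Jac.
Proof.
pose F (k : int) := - (k%:~R * jj (m + k)) : fps.
pose G (r : int) := r%:~R * jj r - m%:~R * jj r.
have sG : zsumm G.
  by apply: zsummD; [|apply: zsummN]; apply/zsummMl/zsumm_jj.
have FG k : F k = - G (k + m).
  by rewrite /F /G [k + m]addrC rmorphD /=; ring.
have sF : zsumm F.
  have sG' : zsumm (fun k => G (k + m)).
    by apply: (zsumm_int sG); exists `|m|%N => k; lia.
  by move=> n; have [B H] := zsummN sG' n; exists B => k /H; rewrite FG.
transitivity (zsum F).
  rewrite zsum_pair0 //; last by rewrite /F mulr0z mul0r oppr0.
  apply: eq_fsum => k; rewrite /F rmorphN /= -pmulrn; ring.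
rewrite (eq_zsum FG) zsumN; last first.
  by apply: (zsumm_int sG); exists `|m|%N => k; lia.
rewrite zsum_shift // zsumB; last 2 first.
- exact: zsumm_rjj.
- exact/zsummMl/zsumm_jj.
by rewrite zsumZ ?zsum_jj ?mulr0 ?subr0 //; apply: zsumm_jj.
Qed.

Definition Lam : fps := fsum (fun k => k%:R * (lam k * jj k%:Z)).

Definition jj_conv (M : nat) : fps := fsum (fun k =>
  k%:R * (geo k * jj (M%:Z - k%:Z) + lam k * jj (M%:Z + k%:Z))).

Lemma summ_jj_conv (M : int) : summ (fun k =>
  k%:R * (geo k * jj (M - k%:Z) + lam k * jj (M + k%:Z))).
Proof.
by apply/summMl/summD; apply: summMl; [apply: summ_jjB|apply: summ_jjD].
Qed.

(** The solution starting at 0 of the recurrence [jj_convS] divided by [Jac]; unrolled in [ell_sum],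
    it is a partial theta sum. *)
Fixpoint ell (M : nat) : fps := if M is m.+1 then 1 - X m * ell m else 0.

Lemma jj_conv0 : jj_conv 0 = 2%:R * Lam.
Proof.
rewrite /jj_conv /Lam -fsumZ; last exact/summMl/summMr/summ_lam.
apply: eq_fsum => -[|k]; first by rewrite !mul0r mulr0.
have := @jj_shift k.+1 0 k.+1%:Z; rewrite subr0 X0 mul1r => /(_ erefl) H.
have -> : jj (0%:Z - k.+1%:Z) = X k.+1 * jj k.+1%:Z.
  rewrite H -jj_refl; congr jj; lia.
rewrite add0r /lam; ring.
Qed.

(** For each k, [jj_shift] brings all four terms to the arguments M+1-k and M+1+k. The factor 1 -
    q^k that appears cancels [geo k], and the first moment of [JacE] remains. *)
Lemma jj_convS M : jj_conv M.+1 + X M * jj_conv M = Jac.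
Proof.
rewrite -(JacE M.+1%:Z) /jj_conv -fsumZ; last exact: summ_jj_conv.
rewrite -fsumD; last 2 first; try exact: summ_jj_conv.
  exact/summZ/summ_jj_conv.
apply: eq_fsum => -[|k]; first by rewrite !mul0r mulr0 addr0.
set K := k.+1; have H1 := @jj_shift M K (M%:Z - K%:Z) erefl.
have := @jj_shift (M + K) 0 (M%:Z + K%:Z).
rewrite subr0 X0 mul1r XD PoszD => /(_ erefl) H2.
have E1 : M.+1%:Z - K%:Z = M%:Z - K%:Z + 1 by lia.
have E2 : M.+1%:Z + K%:Z = M%:Z + K%:Z + 1 by lia.
rewrite E1 E2; set a := jj (_ - _ + 1) in H1 *; set b := jj (_ + _ + 1) in H2 *.
have H3 := @geo1 K isT.
transitivity (K%:R * (geo K * a + X K * geo K * b + geo K * (X M * jj (M%:Z - K%:Z))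
  + geo K * (X M * X K * jj (M%:Z + K%:Z)))).
  rewrite /lam; ring.
rewrite H1 H2; transitivity (K%:R * ((geo K - X K * geo K) * (a - b))); first by ring.
by rewrite H3; ring.
Qed.

(** [ell] solves the inhomogeneous recurrence, [jj] the homogeneous one, and 2 Lam is the initial
    value. *)
Lemma jj_convE M : jj_conv M = Jac * ell M + 2%:R * Lam * jj M%:Z.
Proof.
elim: M => [|M IH]; first by rewrite jj_conv0 /= mulr0 add0r /jj sgn0 mul1r X0 mulr1.
have H := @jj_shift M 0 M%:Z; rewrite subr0 X0 mul1r in H.
have E : M.+1%:Z = M%:Z + 1 by lia.
have -> : jj_conv M.+1 = Jac - X M * jj_conv M by rewrite -(jj_convS M); ring.
have -> : jj M.+1%:Z = - (X M * jj M%:Z) by rewrite H // opprK E.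
by rewrite IH /=; ring.
Qed.

(** * The Appell-type expansion *)

Definition pent (r : int) : nat := `|(3 * (tri r)%:Z + r)%R|%N.

Lemma pentE r : (pent r)%:Z = 3 * (tri r)%:Z + r.
Proof. by rewrite /pent; have := triE r; nia. Qed.

(** Euler's function in its pentagonal form, the one needed for the Appell-type sum; [euler_lim]
    recovers the product. *)
Definition eul : fps := zsum (fun r => sgn r * X (pent r)).

Lemma zsumm_eul : zsumm (fun r => sgn r * X (pent r)).
Proof.
move=> n; exists n.+4 => k nk; apply/lowzMl/lowzX.
by have := pentE k; have := triE k; nia.
Qed.

Lemma sub3_sgn r (f : fps) : sub3 (sgn r * f) = sgn r * sub3 f.
Proof.
rewrite /sgn; elim: `|r|%N => [|n IH]; first by rewrite !mul1r.
by rewrite exprS !mulN1r !mulNr sub3N IH.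
Qed.

Lemma sub3_jj r : sub3 (jj r) = sgn r * X (3 * tri r).
Proof. by rewrite /jj sub3_sgn sub3X. Qed.

Lemma zsum_split F : zsumm F ->
  zsum F = F 0 + fsum (fun k => F (k.+1)%:Z + F (- (k.+1)%:Z)).
Proof.
move=> sF; rewrite /zsum fsum_recl; last exact: zsumm_pos.
rewrite fsumD ?addrA //; last exact: zsumm_neg.
by apply: (zsumm_nat sF); exists 0%N => k; lia.
Qed.

Definition psi (M : nat) : fps := X M + X (2 * M).

Lemma summ_psi (c : nat -> fps) : summ (fun M => psi M.+1 * c M).
Proof.
move=> n; exists n.+1 => M nM; apply/lowzMr/lowzD; apply: lowzX; lia.
Qed.

(** Recentre the pentagonal series by -k in q^k [eul] and by k in q^(2k) [eul]. Since pent r - 3 tri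
    r = r, the linear parts of the exponents absorb q^k and q^(2k), and the terms at M and -M of
    both series share the factor [psi M]. The term at 0 occurs twice. *)
Lemma psi_eul (k : nat) : psi k * eul =
  2%:R * (X (3 * k) * sub3 (jj k%:Z)) +
  fsum (fun M => psi M.+1 *
    (sub3 (jj (M.+1%:Z - k%:Z)) + X (3 * k) * sub3 (jj (M.+1%:Z + k%:Z)))).
Proof.
pose E (r : int) := sgn r * X (pent r) : fps.
have s1 : zsumm (fun M => X k * E (M - k%:Z)).
  by apply/zsummMl/(zsumm_int zsumm_eul); exists k => M; lia.
have s2 : zsumm (fun M => X (2 * k) * E (M + k%:Z)).
  by apply/zsummMl/(zsumm_int zsumm_eul); exists k => M; lia.
rewrite mulrDl.
have -> : X k * eul = zsum (fun M => X k * E (M - k%:Z)).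
  rewrite zsumZ; first by rewrite (zsum_shift (- k%:Z)) //; apply: zsumm_eul.
  by apply: (zsumm_int zsumm_eul); exists k => M; lia.
have -> : X (2 * k) * eul = zsum (fun M => X (2 * k) * E (M + k%:Z)).
  rewrite zsumZ; first by rewrite (zsum_shift k%:Z) //; apply: zsumm_eul.
  by apply: (zsumm_int zsumm_eul); exists k => M; lia.
have XE a b (r r' : int) : sgn r = sgn r' ->
    (a + pent r = b + 3 * tri r')%N -> X a * E r = X b * sub3 (jj r').
  by move=> sr e; rewrite sub3_jj /E sr ![X _ * (_ * _)]mulrCA -!XD e.
have F0 : X k * E (0 - k%:Z) = X (3 * k) * sub3 (jj k%:Z).
  apply: XE; first by rewrite add0r sgnN.
  by have := pentE (0 - k%:Z); have := triE (0 - k%:Z); have := triE k%:Z; lia.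
have G0 : X (2 * k) * E (0 + k%:Z) = X (3 * k) * sub3 (jj k%:Z).
  apply: XE; first by rewrite add0r.
  by have := pentE (0 + k%:Z); have := triE (0 + k%:Z); have := triE k%:Z; lia.
have F1 (M : nat) : X k * E (M%:Z - k%:Z) = X M * sub3 (jj (M%:Z - k%:Z)).
  by apply: XE => //; have := pentE (M%:Z - k%:Z); lia.
have F2 (M : nat) :
    X k * E (- M%:Z - k%:Z) = X (3 * k + 2 * M) * sub3 (jj (M%:Z + k%:Z)).
  apply: XE; first by rewrite -opprD sgnN.
  have := pentE (- M%:Z - k%:Z); have := triE (- M%:Z - k%:Z).
  by have := triE (M%:Z + k%:Z); lia.
have G1 (M : nat) :
    X (2 * k) * E (M%:Z + k%:Z) = X (3 * k + M) * sub3 (jj (M%:Z + k%:Z)).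
  by apply: XE => //; have := pentE (M%:Z + k%:Z); lia.
have G2 (M : nat) :
    X (2 * k) * E (- M%:Z + k%:Z) = X (2 * M) * sub3 (jj (M%:Z - k%:Z)).
  apply: XE; first by rewrite addrC -opprB sgnN.
  have := pentE (- M%:Z + k%:Z); have := triE (- M%:Z + k%:Z).
  by have := triE (M%:Z - k%:Z); lia.
rewrite !zsum_split // F0 G0 addrACA -mulr2n mulr_natl; congr (_ + _).
have sF (F : int -> fps) : zsumm F ->
    summ (fun M : nat => F M.+1%:Z + F (- M.+1%:Z)).
  by move=> sF; apply: summD; apply: (zsumm_nat sF); exists 0%N => M; lia.
rewrite -fsumD; last 2 first.
- exact: (sF _ s1).
- exact: (sF _ s2).
apply: eq_fsum => M; rewrite F1 F2 G1 G2 !XD /psi; ring.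
Qed.

Lemma eulE : eul = 1 + fsum (fun M => psi M.+1 * sub3 (jj M.+1%:Z)).
Proof.
have := psi_eul 0; rewrite /psi muln0 !X0 /jj sgn0 !mul1r X0 sub31 mulr1.
move=> H; apply: (@natmul_inj 1); transitivity ((1 + 1) * eul); first by ring.
rewrite H mulrDr mulr1 -fsumZ; last exact: summ_psi.
congr (_ + _); apply: eq_fsum => M.
rewrite subr0; ring.
Qed.

Definition sigma_gf (m : nat) : fps := fsum (fun k => (k ^ m)%:R * lam k).

Lemma summ_sigma_gf m : summ (fun k => (k ^ m)%:R * lam k).
Proof. exact/summMl/summ_lam. Qed.

Lemma geo3 k : (0 < k)%N -> geo k = (1 + X k + X (2 * k)) * geo (3 * k).
Proof.
move=> k0; have k3 : (0 < 3 * k)%N by lia.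
apply: (@geoK k) => //; rewrite geoE //.
rewrite -[LHS](geoE k3) mulrA; congr (_ * _).
have -> : X (3 * k) = X k * X (2 * k) by rewrite -XD; congr X; lia.
have -> : X (2 * k) = X k * X k by rewrite -XD; congr X; lia.
ring.
Qed.

Lemma sub3_lam k : sub3 (lam k) = X (3 * k) * geo (3 * k).
Proof. by rewrite /lam sub3M sub3X sub3_geo. Qed.

Lemma sub3Znat (m : nat) f : sub3 (m%:R * f) = m%:R * sub3 f.
Proof. by rewrite pmulrn sub3Zint. Qed.

Lemma sub30 : sub3 0 = 0.
Proof. by rewrite -(subrr 1) sub3B sub31. Qed.

Lemma summ_geo_psi : summ (fun k => k%:R * (geo (3 * k) * psi k)).
Proof.
do 2!apply: summMl; move=> n; exists n.+1 => M nM.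
by apply: lowzD; apply: lowzX; lia.
Qed.

Lemma sigma_gf_sub3 m : (0 < m)%N ->
  sigma_gf m - sub3 (sigma_gf m) = fsum (fun k => (k ^ m)%:R * (geo (3 * k) * psi k)).
Proof.
move=> m0; rewrite sub3_fsum; last exact: summ_sigma_gf.
rewrite -fsumB; last 2 first.
- exact: summ_sigma_gf.
- exact/summ_sub3/summ_sigma_gf.
apply: eq_fsum => -[|k]; first by rewrite exp0n // !mul0r sub30 subrr.
rewrite sub3Znat sub3_lam {1}/lam (@geo3 k.+1) // /psi.
have -> : X (3 * k.+1) = X k.+1 * X (2 * k.+1) by rewrite -XD; congr X; lia.
have -> : X (2 * k.+1) = X k.+1 * X k.+1 by rewrite -XD; congr X; lia.
move: (_%:R) => c; ring.
Qed.

Lemma sigma1_gf_sub3 : sigma_gf 1 - sub3 (sigma_gf 1) = fsum (fun k => k%:R * (geo (3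
  * k) * psi k)).
Proof. by rewrite sigma_gf_sub3 //; apply: eq_fsum => k; rewrite expn1. Qed.

Definition appell_sum : fps := fsum (fun M => psi M.+1 * sub3 (ell M.+1)).

(** Expand each [psi k * eul] and sum over k first: for fixed M the inner sum is [jj_conv M] in q^3.
    In [jj_convE], the parts with [Lam] and the terms at M = 0 rebuild [eul] through [eulE]; the
    parts with [Jac] make up [appell_sum]. *)
Lemma appell_identity :
  eul * (sigma_gf 1 - sub3 (sigma_gf 1)) = 2%:R * sub3 Lam * eul + sub3 Jac * appell_sum.
Proof.
rewrite sigma1_gf_sub3 -fsumZ; last exact: summ_geo_psi.
pose T k M := psi M.+1 * (k%:R * (geo (3 * k) * sub3 (jj (M.+1%:Z - k%:Z)) +
    sub3 (lam k) * sub3 (jj (M.+1%:Z + k%:Z)))).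
have sT : summ2 T.
  move=> n; exists (2 * n + 6)%N => k M B; rewrite /T.
  have [nM|Mn] := ltnP n M.
    by apply/lowzMr/lowzD; apply: lowzX; lia.
  by do 2!apply: lowzMl; apply: lowzD; apply/lowzMl/lowz_sub3/lowz_jj; lia.
have sL : summ (fun k => k%:R * (lam k * jj k%:Z)).
  exact/summMl/summMr/summ_lam.
transitivity (2%:R * sub3 Lam + fsum (fun k => fsum (T k))).
  rewrite /Lam sub3_fsum // -fsumZ ?summ_sub3 //; last exact: summ_sub3.
  rewrite -fsumD; last 2 first.
  - exact/summZ/summ_sub3.
  - exact: summ2_fsum.
  apply: eq_fsum => k.
  have -> : eul * (k%:R * (geo (3 * k) * psi k)) =
    k%:R * geo (3 * k) * (psi k * eul) by ring.
  rewrite psi_eul mulrDr -fsumZ; last exact: summ_psi.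
  rewrite sub3Znat sub3M sub3_lam; congr (_ + _); first by ring.
  by apply: eq_fsum => M; rewrite /T sub3_lam; ring.
rewrite fsum_exch // [in RHS]eulE mulrDr mulr1 -addrA; congr (_ + _).
rewrite -[X in _ = X + _]fsumZ; last exact: summ_psi.
rewrite -[X in _ = _ + X]fsumZ; last exact: summ_psi.
rewrite -fsumD; last 2 first; try exact/summZ/summ_psi.
apply: eq_fsum => M; rewrite /T fsumZ; last first.
  move=> n; exists (n + M + 4)%N => k B.
  by apply: lowzMl; apply: lowzD; apply/lowzMl/lowz_sub3/lowz_jj; lia.
have -> : fsum (fun k : nat => k%:R * (geo (3 * k) * sub3 (jj (M.+1%:Z - k%:Z)) +
   sub3 (lam k) * sub3 (jj (M.+1%:Z + k%:Z)))) = sub3 (jj_conv M.+1).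
  rewrite sub3_fsum; last exact: summ_jj_conv.
  by apply: eq_fsum => k; rewrite sub3Znat sub3D !sub3M sub3_geo.
rewrite jj_convE sub3D !sub3M (_ : sub3 2%:R = 2%:R); last first.
  by rewrite -[2%:R]mulr1 sub3Znat sub31.
ring.
Qed.

(** * A finite Bailey pair *)

Definition qfac (n : nat) : fps := \prod_(1 <= i < n.+1) (1 - X i).
Definition iq (n : nat) : fps := \prod_(1 <= i < n.+1) geo i.

Lemma qfac0 : qfac 0 = 1. Proof. by rewrite /qfac big_geq. Qed.
Lemma iq0 : iq 0 = 1. Proof. by rewrite /iq big_geq. Qed.
Lemma qfacS n : qfac n.+1 = (1 - X n.+1) * qfac n.
Proof. by rewrite /qfac big_nat_recr //= mulrC. Qed.
Lemma iqS n : iq n.+1 = geo n.+1 * iq n.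
Proof. by rewrite /iq big_nat_recr //= mulrC. Qed.
Lemma qfac_iq n : qfac n * iq n = 1.
Proof.
elim: n => [|n IH]; first by rewrite qfac0 iq0 mulr1.
by rewrite qfacS iqS mulrACA IH mulr1 geoE.
Qed.
Lemma iqP n : iq n = (1 - X n.+1) * iq n.+1.
Proof. by rewrite iqS mulrA geoE ?mul1r. Qed.

(** The usual convention 1/(q)_m = 0 for m < 0, by which bilateral sums terminate by themselves. *)
Definition iqz (m : int) : fps := if m is Posz n then iq n else 0.

Lemma iqz_pred (m : int) (n : nat) : m = n%:Z -> iqz (m - 1) = (1 - X n) * iqz m.
Proof.
move=> ->; case: n => [|n]; first by rewrite X0 subrr mul0r.
by rewrite intS addrC addrA addNr add0r /= iqP.
Qed.

Lemma iqz_neg (m : int) : m < 0 -> iqz m = 0.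
Proof. by case: m. Qed.

Definition qbinom (m : nat) (k : int) : fps := qfac m * (iqz k * iqz (m%:Z - k)).

Lemma qbinom_sym m (k l : int) : k + l = m%:Z -> qbinom m k = qbinom m l.
Proof.
move=> E; rewrite /qbinom [X in _ = _ * X]mulrC; congr (_ * (iqz _ * iqz _)); lia.
Qed.

Lemma qbinom_out m (k : int) : (k < 0) || (m%:Z < k) -> qbinom m k = 0.
Proof.
case/orP => h; first by rewrite /qbinom iqz_neg // mul0r mulr0.
by rewrite /qbinom [iqz (_ - _)]iqz_neg ?mulr0 //; lia.
Qed.

Lemma qbinom_pascal m (k : int) (a b : nat) : k = a%:Z -> m.+1%:Z - k = b%:Z ->
  qbinom m.+1 k = qbinom m (k - 1) + X a * qbinom m k /\
  qbinom m.+1 k = X b * qbinom m (k - 1) + qbinom m k.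
Proof.
move=> Ea Eb; rewrite /qbinom.
have -> : m%:Z - (k - 1) = m.+1%:Z - k by lia.
have -> : m%:Z - k = m.+1%:Z - k - 1 by lia.
rewrite (iqz_pred Ea) (iqz_pred Eb) qfacS.
have -> : m.+1 = (a + b)%N by lia.
by rewrite XD; split; ring.
Qed.

(** The relation between the exponents is asked only for k >= 0, since for k < 0 all terms vanish;
    thus k may run over all integers while [e'] stays natural. *)
Lemma qbinomA m (k : int) (e e' : nat) : (0 <= k -> e'%:Z = e%:Z + k) ->
  X e * qbinom m.+1 k = X e * qbinom m (k - 1) + X e' * qbinom m k.
Proof.
move=> ee; have [k0|k0] := ltrP k 0; first by rewrite !qbinom_out ?mulr0 ?addr0 //; lia.
have [km|km] := ltrP m.+1%:Z k; first by rewrite !qbinom_out ?mulr0 ?addr0 //; lia.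
have Ea : k = (absz k)%:Z by lia.
have Eb : m.+1%:Z - k = (absz (m.+1%:Z - k)) by lia.
rewrite (qbinom_pascal Ea Eb).1 mulrDr mulrA -XD; congr (_ + X _ * _).
by have := ee k0; lia.
Qed.

Lemma qbinomB m (k : int) (e e' : nat) :
  (k <= m.+1%:Z -> e'%:Z = e%:Z + (m.+1%:Z - k)) ->
  X e * qbinom m.+1 k = X e' * qbinom m (k - 1) + X e * qbinom m k.
Proof.
move=> ee; have [k0|k0] := ltrP k 0; first by rewrite !qbinom_out ?mulr0 ?addr0 //; lia.
have [km|km] := ltrP m.+1%:Z k; first by rewrite !qbinom_out ?mulr0 ?addr0 //; lia.
have Ea : k = (absz k)%:Z by lia.
have Eb : m.+1%:Z - k = (absz (m.+1%:Z - k)) by lia.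
rewrite (qbinom_pascal Ea Eb).2 mulrDr mulrA -XD; congr (X _ * _ + _).
by have := ee km; lia.
Qed.

Lemma zsumm_qbinom m (c : int -> fps) (h : int -> int) :
  (exists d : nat, forall k, (`|k| <= `|h k| + d)%N) ->
  zsumm (fun k => c k * qbinom m (h k)).
Proof.
case=> d hd n; exists (d + m).+1 => k B.
rewrite qbinom_out ?mulr0; first exact: lowz0.
by have := hd k; lia.
Qed.

Definition quad (c d : int) (k : int) : nat := `|(6 * k * k + c * k + d)%R|%N.

Lemma quad_ge0 c d k : 0 <= 6 * k * k + c * k + d ->
  (quad c d k)%:Z = 6 * k * k + c * k + d.
Proof. by rewrite /quad; lia. Qed.

(** The Bailey pair relative to 1 with beta_n = 1/(q)_(2n), cleared of denominators; [bodd] is its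
    companion relative to q, with beta_n = 1/(q)_(2n+1) up to normalisation. *)
Definition bevn n : fps := zsum (fun k =>
  X (quad 1 0 k) * qbinom (2 * n) (n%:Z - 3 * k)) -
  zsum (fun k => X (quad 5 1 k) * qbinom (2 * n) (n%:Z - 3 * k - 1)).

Definition bodd n : fps := zsum (fun k =>
  X (quad 1 0 k) * qbinom (2 * n).+1 (n%:Z - 3 * k)) -
  zsum (fun k => X (quad 7 2 k) * qbinom (2 * n).+1 (n%:Z - 3 * k - 1)).

Lemma quad10 (k : int) : (quad 1 0 k)%:Z = 6 * k * k + k.
Proof. by rewrite quad_ge0; case: (lerP 0 k) => ?; nia. Qed.
Lemma quad51 (k : int) : (quad 5 1 k)%:Z = 6 * k * k + 5 * k + 1.
Proof. by rewrite quad_ge0; case: (lerP 0 k) => ?; nia. Qed.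
Lemma quad72 (k : int) : (quad 7 2 k)%:Z = 6 * k * k + 7 * k + 2.
Proof. by rewrite quad_ge0; case: (lerP 0 k) => ?; nia. Qed.

Lemma quad_refl (k : int) : quad 7 2 (-1 - k) = quad 5 1 k.
Proof. by have := quad72 (-1 - k); have := quad51 k; lia. Qed.

(** The two sums are expanded by different q-Pascal rules, chosen so that the extra sums coincide
    and cancel; what is left matches under k -> -1-k. *)
Lemma bodd_bevn n : bodd n = bevn n.
Proof.
pose a (k : int) : int := n%:Z - 3 * k - 1.
have ha : exists d : nat, forall k : int, (`|k| <= `|a k| + d)%N.
  by exists n.+1 => k; rewrite /a; lia.
have ha0 : exists d : nat, forall k : int, (`|k| <= `|(n%:Z - 3 * k)%R| + d)%N.
  by exists n.+1 => k; lia.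
have ha1 : exists d : nat, forall k : int, (`|k| <= `|(a k - 1)%R| + d)%N.
  by exists n.+2 => k; rewrite /a; lia.
pose e (k : int) := `|(6 * k * k + 4 * k + 1 + n%:Z)%R|%N.
have E1 k : X (quad 1 0 k) * qbinom (2 * n).+1 (n%:Z - 3 * k) =
  X (e k) * qbinom (2 * n) (a k) + X (quad 1 0 k) * qbinom (2 * n) (n%:Z - 3 * k).
  by apply: qbinomB => h; rewrite quad10 /e; nia.
have E2 k : X (quad 7 2 k) * qbinom (2 * n).+1 (a k) =
  X (quad 7 2 k) * qbinom (2 * n) (a k - 1) + X (e k) * qbinom (2 * n) (a k).
  by apply: qbinomA => h; rewrite quad72 /e /a; nia.
rewrite /bodd (eq_zsum E1) (eq_zsum E2) /bevn !zsumD; try exact: zsumm_qbinom.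
set S := zsum (fun k => X (e k) * _); set U := zsum _.
have -> : zsum (fun k => X (quad 7 2 k) * qbinom (2 * n) (a k - 1)) =
    zsum (fun k => X (quad 5 1 k) * qbinom (2 * n) (a k)).
  rewrite -(zsum_refl (-1)); last exact: zsumm_qbinom.
  apply: eq_zsum => k; rewrite quad_refl; congr (_ * _).
  by apply: qbinom_sym; rewrite /a; lia.
by rewrite /a; ring.
Qed.

(** Here the same Pascal rule serves both sums, and the extra sums agree under k -> -k. *)
Lemma bevnS n : bevn n.+1 = bodd n.
Proof.
pose b (k : int) : int := n.+1%:Z - 3 * k.
have ha : exists d : nat, forall k : int, (`|k| <= `|(n%:Z - 3 * k - 1)%R| + d)%N.
  by exists n.+1 => k; lia.
have ha0 : exists d : nat, forall k : int, (`|k| <= `|(n%:Z - 3 * k)%R| + d)%N.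
  by exists n.+1 => k; lia.
have ha1 : exists d : nat, forall k : int, (`|k| <= `|b k| + d)%N.
  by exists n.+2 => k; rewrite /b; lia.
pose e (k : int) := `|(6 * k * k - 2 * k + 1 + n%:Z)%R|%N.
pose e' (k : int) := `|(6 * k * k + 2 * k + 1 + n%:Z)%R|%N.
have n2 : (2 * n.+1 = (2 * n).+2)%N by lia.
have E1 k : X (quad 1 0 k) * qbinom (2 * n.+1) (n.+1%:Z - 3 * k) =
  X (quad 1 0 k) * qbinom (2 * n).+1 (n%:Z - 3 * k) + X (e k) * qbinom (2 * n).+1 (b k).
  rewrite n2 (@qbinomA _ _ _ (e k)) => [|h]; last by rewrite quad10 /e; nia.
  by congr (_ * qbinom _ _ + _); lia.
have E2 k : X (quad 5 1 k) * qbinom (2 * n.+1) (n.+1%:Z - 3 * k - 1) =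
  X (quad 5 1 k) * qbinom (2 * n).+1 (n%:Z - 3 * k - 1) +
  X (e' k) * qbinom (2 * n).+1 (n%:Z - 3 * k).
  rewrite n2 (@qbinomA _ _ _ (e' k)) => [|h]; last by rewrite quad51 /e'; nia.
  by congr (_ * qbinom _ _ + _ * qbinom _ _); lia.
rewrite /bevn (eq_zsum E1) (eq_zsum E2) /bodd !zsumD; try exact: zsumm_qbinom.
have -> : zsum (fun k => X (e k) * qbinom (2 * n).+1 (b k)) =
    zsum (fun k => X (e' k) * qbinom (2 * n).+1 (n%:Z - 3 * k)).
  rewrite -[LHS]zsum_opp; last exact: zsumm_qbinom.
  apply: eq_zsum => k; congr (X _ * _); first by rewrite /e /e'; lia.
  by apply: qbinom_sym; rewrite /b; lia.
have -> : zsum (fun k => X (quad 5 1 k) * qbinom (2 * n).+1 (n%:Z - 3 * k - 1)) =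
    zsum (fun k => X (quad 7 2 k) * qbinom (2 * n).+1 (n%:Z - 3 * k - 1)).
  rewrite -[RHS](zsum_refl (-1)); last exact: zsumm_qbinom.
  apply: eq_zsum => k; rewrite quad_refl; congr (_ * _).
  by apply: qbinom_sym; lia.
ring.
Qed.

Lemma zsum_single F : (forall k, k != 0 -> F k = 0) -> zsum F = F 0.
Proof.
move=> F0; rewrite /zsum (@fsum_fin 1) => [|k k1]; last by apply: F0; lia.
rewrite (@fsum_fin 0) => [|k _]; last by apply: F0; lia.
by rewrite big_nat1 big_geq ?addr0.
Qed.

Lemma bevn1 n : bevn n = 1.
Proof.
elim: n => [|n IH]; last by rewrite bevnS bodd_bevn.
rewrite /bevn muln0 !zsum_single => [|k k0|k k0].
- by rewrite [qbinom _ (_ - 1)]qbinom_out // /qbinom /= qfac0 iq0 mulr0 subr0 -[quad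
  1 0 0]/0%N X0 !mulr1.
- by rewrite qbinom_out ?mulr0 //; lia.
by rewrite qbinom_out ?mulr0 //; lia.
Qed.

Lemma qfac_unit n : cf (qfac n) 0 = 1.
Proof.
elim: n => [|n IH]; first by rewrite qfac0 cf1.
by rewrite qfacS cfM big_ord1 subn0 IH cfB cf1 mulr1 /= subr0.
Qed.

Definition uu (N : nat) (r : int) : fps := iqz (N%:Z - r) * iqz (N%:Z + r).

Lemma uu_out N (r : int) : (N < `|r|)%N -> uu N r = 0.
Proof.
move=> h; rewrite /uu; have [r0|r0] := lerP 0 r.
  by rewrite iqz_neg ?mul0r //; lia.
by rewrite [X in _ * X]iqz_neg ?mulr0 //; lia.
Qed.

Definition vv (N : nat) (r : int) : fps := iqz (N.+1%:Z - r) * iqz (N%:Z + r).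

Lemma vv_refl N (r : int) : vv N (- r) = vv N (r + 1).
Proof. by rewrite /vv mulrC; congr (iqz _ * iqz _); lia. Qed.

(** Passes from the Bailey kernel relative to q at level N to the one relative to 1 at level N+1,
    which [gauss_telescope] sums. *)
Lemma vv_uu N (r : nat) :
  vv N r%:Z - X (2 * r) * vv N (- r%:Z) = (1 - X (2 * r)) * uu N.+1 r%:Z.
Proof.
have E1 : vv N r%:Z = (1 - X (N.+1 + r)) * uu N.+1 r%:Z.
  rewrite /vv /uu (_ : N%:Z + r%:Z = N.+1%:Z + r%:Z - 1); last by lia.
  by rewrite (@iqz_pred _ (N.+1 + r)) // mulrCA.
have [rN|Nr] := leqP r N.+1; last first.
  rewrite E1 uu_out ?mulr0 //.
  by rewrite /vv [iqz (N%:Z + _)]iqz_neg ?mulr0 ?subr0 //; lia.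
have E2 : vv N (- r%:Z) = (1 - X (N.+1 - r)) * uu N.+1 r%:Z.
  rewrite /vv /uu opprK (_ : N%:Z - r%:Z = N.+1%:Z - r%:Z - 1); last by lia.
  rewrite (@iqz_pred _ (N.+1 - r)); last by lia.
  ring.
rewrite E1 E2.
have -> : X (N.+1 + r) = X (2 * r) * X (N.+1 - r) by rewrite -XD; congr X; lia.
ring.
Qed.

(** This is [bodd N = 1] divided by (q)_(2N+1). The indices j and -j-1 are taken together; after
    [vv_refl] their four terms form two pairs with opposite arguments, to which [vv_uu] applies. *)
Lemma iq_bailey N : iq (2 * N).+1 = fsum (fun j =>
  X (quad 1 0 j%:Z) * ((1 - X (2 * (3 * j + 1))) * uu N.+1 (3 * j + 1)%N%:Z) -
  X (quad 5 1 j%:Z) * ((1 - X (2 * (3 * j + 2))) * uu N.+1 (3 * j + 2)%N%:Z)).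
Proof.
have sv (c : int -> fps) (h : int -> int) :
    (exists d : nat, forall k, (`|k| <= `|h k| + d)%N) ->
    zsumm (fun k => c k * vv N (h k)).
  case=> d hd n; exists (d + N + 1).+1 => k B.
  rewrite /vv; have := hd k => hk; have [r0|r0] := lerP 0 (h k).
    by rewrite iqz_neg ?mul0r ?mulr0; [apply: lowz0|lia].
  by rewrite [X in _ * (_ * X)]iqz_neg ?mulr0; [apply: lowz0|lia].
have qv (k : int) r : k = N%:Z - r + 1 -> qbinom (2 * N).+1 k = qfac (2 * N).+1 * vv N r.
  by move=> ->; rewrite /qbinom /vv; congr (_ * (iqz _ * iqz _)); lia.
have H1 : exists d : nat, forall k : int, (`|k| <= `|(3 * k + 1)%R| + d)%N.
  by exists 1%N => k; lia.
have H2 : exists d : nat, forall k : int, (`|k| <= `|(3 * k + 2)%R| + d)%N.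
  by exists 2%N => k; lia.
have : bodd N = 1 by rewrite bodd_bevn bevn1.
rewrite /bodd.
have -> : zsum (fun k => X (quad 1 0 k) * qbinom (2 * N).+1 (N%:Z - 3 * k)) =
    zsum (fun k => qfac (2 * N).+1 * (X (quad 1 0 k) * vv N (3 * k + 1))).
  apply: eq_zsum => k; rewrite (@qv _ (3 * k + 1)); first by rewrite mulrCA.
  by lia.
have -> : zsum (fun k => X (quad 7 2 k) * qbinom (2 * N).+1 (N%:Z - 3 * k - 1)) =
    zsum (fun k => qfac (2 * N).+1 * (X (quad 7 2 k) * vv N (3 * k + 2))).
  apply: eq_zsum => k; rewrite (@qv _ (3 * k + 2)); first by rewrite mulrCA.
  by lia.
have s1 := sv (fun k => X (quad 1 0 k)) _ H1.
have s2 := sv (fun k => X (quad 7 2 k)) _ H2.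
rewrite !zsumZ // -mulrBr => E.
apply: (@unit_cancel (qfac (2 * N).+1)); first exact: qfac_unit.
rewrite qfac_iq -[LHS]E; congr (_ * _); rewrite -zsumB // {1}/zsum.
have sB : zsumm (fun k => X (quad 1 0 k) * vv N (3 * k + 1) -
                          X (quad 7 2 k) * vv N (3 * k + 2)).
  by apply: zsummD => //; apply: zsummN.
rewrite -fsumD; last 2 first.
- exact: zsumm_pos sB.
- exact: zsumm_neg sB.
apply: eq_fsum => j; rewrite -!vv_uu !mulrBr ![X _ * (X _ * _)]mulrA -!XD.
have <- : quad 7 2 j%:Z = (quad 1 0 j%:Z + 2 * (3 * j + 1))%N.
  by have := quad10 j%:Z; have := quad72 j%:Z; lia.
have <- : quad 1 0 (- j.+1%:Z) = (quad 5 1 j%:Z + 2 * (3 * j + 2))%N.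
  by have := quad10 (- j.+1%:Z); have := quad51 j%:Z; lia.
have -> : quad 7 2 (- j.+1%:Z) = quad 5 1 j%:Z.
  by have := quad72 (- j.+1%:Z); have := quad51 j%:Z; lia.
have -> : 3 * j%:Z + 1 = (3 * j + 1)%N by lia.
have -> : 3 * j%:Z + 2 = (3 * j + 2)%N by lia.
have R : vv N (- (3 * j + 1)%N%:Z) = vv N (3 * j + 2)%N%:Z.
  by rewrite vv_refl; congr vv; lia.
have -> : 3 * (- j.+1%:Z) + 1 = - (3 * j + 2)%N%:Z by lia.
have -> : 3 * (- j.+1%:Z) + 2 = - (3 * j + 1)%N%:Z by lia.
by rewrite R; ring.
Qed.

Lemma iqz_nat (n : nat) : iqz n%:Z = iq n. Proof. by []. Qed.

Lemma uu_pred N (r : nat) : (r <= N.+1)%N ->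
  uu N r%:Z = (1 - X (N.+1 - r)) * (1 - X (N.+1 + r)) * uu N.+1 r%:Z.
Proof.
move=> rN; rewrite /uu (_ : N%:Z - r%:Z = N.+1%:Z - r%:Z - 1); last by lia.
rewrite (_ : N%:Z + r%:Z = N.+1%:Z + r%:Z - 1); last by lia.
rewrite (@iqz_pred _ (N.+1 - r)); last by lia.
by rewrite (@iqz_pred _ (N.+1 + r)) // mulrACA.
Qed.

(* The [q]-Gauss sum at unit parameters has closed partial sums, because
   [(1 - q^N)^2 - (1 - q^(N-r)) (1 - q^(N+r)) = q^(N-r) (1 - q^r)^2]. *)
Lemma gauss_telescope (r N : nat) : (0 < r)%N ->
  \sum_(0 <= n < N) X n.+1 * qfac n ^+ 2 * uu n.+1 r%:Z =
  X r * geo r ^+ 2 * qfac N ^+ 2 * uu N r%:Z.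
Proof.
move=> r0; elim: N => [|N IH].
  by rewrite big_geq // uu_out ?mulr0 //; lia.
rewrite big_nat_recr //= IH; have [rN|Nr] := leqP r N.+1; last first.
  by rewrite !uu_out ?mulr0 ?addr0 //; lia.
rewrite uu_pred // qfacS.
have Y1 : X N.+1 = X r * X (N.+1 - r) by rewrite -XD; congr X; lia.
have Y2 : X (N.+1 + r) = X r * X r * X (N.+1 - r) by rewrite -!XD; congr X; lia.
rewrite Y2; apply: (@geoK r) => //; apply: (@geoK r) => //.
have G := geoE r0; set g := geo r in G *; set Q := qfac N; set U := uu _ _.
set x := X r in G Y1 Y2 *; set z := X (N.+1 - r) in Y1 Y2 *.
transitivity (x * (((1 - x) * g) ^+ 2 * Q ^+ 2 *
   ((1 - z) * (1 - x * x * z) * U)) + (1 - x) ^+ 2 * X N.+1 * Q ^+ 2 * U).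
  ring.
transitivity (x * (((1 - x) * g) ^+ 2 * ((1 - X N.+1) * Q) ^+ 2 * U)); last by ring.
rewrite G Y1; ring.
Qed.

Lemma summ_bigsum N (F : nat -> nat -> fps) :
  (forall n, summ (F n)) -> summ (fun j => \sum_(0 <= n < N) F n j).
Proof.
move=> sF; elim: N => [|N IH].
  by apply: (@summ_fin 0) => j _; rewrite big_geq.
move: (summD IH (sF N)); apply: eq_summ => j.
by rewrite big_nat_recr.
Qed.

Lemma fsum_bigsum N (F : nat -> nat -> fps) : (forall n, summ (F n)) ->
  fsum (fun j => \sum_(0 <= n < N) F n j) = \sum_(0 <= n < N) fsum (F n).
Proof.
move=> sF; elim: N => [|N IH].
  by rewrite big_geq // -[RHS]fsum0; apply: eq_fsum => j; rewrite big_geq.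
rewrite big_nat_recr //= -IH -fsumD //; last exact: summ_bigsum.
by apply: eq_fsum => j; rewrite big_nat_recr.
Qed.

(** The correction factor of the truncated Bailey lemma; for fixed r it tends to 1 with N. *)
Definition rho (N r : nat) : fps := qfac N ^+ 2 * uu N r%:Z.

Lemma lowz_mul1 n (f g : fps) : lowz n (f - 1) -> lowz n (g - 1) ->
  lowz n (f * g - 1).
Proof.
move=> f1 g1; rewrite (_ : f * g - 1 = (f - 1) * g + (g - 1)); last by ring.
by apply: lowzD => //; apply: lowzMr.
Qed.

Lemma lowz_le m n (f : fps) : (m <= n)%N -> lowz n f -> lowz m f.
Proof. by move=> mn f0 k km; apply: f0; lia. Qed.

Lemma lowz_geo n k : (n < k)%N -> lowz n (geo k - 1).
Proof. by move=> nk; rewrite -geo1; [apply: lowz_lam|lia]. Qed.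

Lemma qfac_iq_add N k : lowz N (qfac N * iq (N + k) - 1).
Proof.
elim: k => [|k IH].
  by rewrite addn0 qfac_iq subrr; apply: lowz0.
rewrite addnS iqS mulrCA; apply: lowz_mul1 => //.
by apply: lowz_geo; lia.
Qed.

Lemma qfac_iq_sub m k : lowz m (qfac (m + k) * iq m - 1).
Proof.
elim: k => [|k IH].
  by rewrite addn0 qfac_iq subrr; apply: lowz0.
rewrite addnS qfacS -mulrA; apply: lowz_mul1 => //.
by rewrite addrAC subrr add0r; apply/lowzN/lowzX; lia.
Qed.

(** The factor 1/(q)_(N-r) agrees with its limit only up to degree N - r; [X r] makes up for the
    loss, uniformly in r. *)
Lemma lowz_rho N r : lowz N (X r * (rho N r - 1)).
Proof.
have [rN|Nr] := leqP r N; last exact/lowzMr/lowzX.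
have lw : lowz (N - r) (rho N r - 1).
  rewrite /rho /uu.
  have -> : N%:Z - r%:Z = (N - r)%N by lia.
  rewrite -PoszD !iqz_nat expr2 mulrACA; apply: lowz_mul1.
    by rewrite -{2}(subnK rN); apply: qfac_iq_sub.
  by apply: (@lowz_le _ N); [lia|apply: qfac_iq_add].
move=> m mN; rewrite cfXM; case: leqP => // rm.
by apply: lw; lia.
Qed.

Definition bterm (c : nat -> fps) (j : nat) : fps :=
  X (quad 1 0 j%:Z) * c (3 * j + 1)%N - X (quad 5 1 j%:Z) * c (3 * j + 2)%N.

Lemma summ_bterm c : summ (bterm c).
Proof.
apply: summB; apply: summMr => n; exists n.+1 => j nj; apply: lowzX.
  by have := quad10 j%:Z; nia.
by have := quad51 j%:Z; nia.
Qed.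

Definition bailey_sum : fps := fsum (bterm (fun r => X r * (1 + X r) * geo r)).

Definition bailey_partial N : fps := \sum_(0 <= n < N) X n.+1 * qfac n ^+ 2 * iq (2 *
  n).+1.

(** The weight 1 - q^(2r) of [iq_bailey] meets q^r/(1-q^r)^2 from [gauss_telescope], so one factor 1
    - q^r cancels. *)
Lemma bailey_partialE N : bailey_partial N = fsum (bterm (fun r => X r * (1 + X r) *
  geo r * rho N r)).
Proof.
rewrite /bailey_partial; under eq_big_nat => n _.
  rewrite iq_bailey -fsumZ; last first.
    exact: (summ_bterm (fun r => (1 - X (2 * r)) * uu n.+1 r)).
  over.
rewrite -fsum_bigsum => [|n]; last first.
  exact/summZ/(summ_bterm (fun r => (1 - X (2 * r)) * uu n.+1 r)).
have key r : (0 < r)%N -> X r * (1 + X r) * geo r * rho N r =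
    (1 - X (2 * r)) * \sum_(0 <= n < N) X n.+1 * qfac n ^+ 2 * uu n.+1 r%:Z.
  move=> r0; rewrite gauss_telescope // /rho.
  have -> : X (2 * r) = X r ^+ 2 by rewrite XX mulnC.
  transitivity (((1 - X r) * geo r) *
     (X r * (1 + X r) * geo r * (qfac N ^+ 2 * uu N r%:Z))); last by ring.
  by rewrite geoE // mul1r.
apply: eq_fsum => j; rewrite /bterm !key ?addn1 ?addn2 // !mulr_sumr -sumrB.
by apply: eq_bigr => n _; ring.
Qed.

Lemma bailey_partial_lim N : lowz N (bailey_partial N - bailey_sum).
Proof.
rewrite bailey_partialE /bailey_sum -fsumB; try exact: summ_bterm.
apply: lowz_fsum => [|j]; first by apply: summB; apply: summ_bterm.
rewrite /bterm.
set a := X (quad 1 0 j%:Z); set b := X (quad 5 1 j%:Z).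
set r := (3 * j + 1)%N; set s := (3 * j + 2)%N.
rewrite (_ : _ - _ = a * (1 + X r) * geo r * (X r * (rho N r - 1)) -
   b * (1 + X s) * geo s * (X s * (rho N s - 1))); last by ring.
by apply: lowzB; apply/lowzMl/lowz_rho.
Qed.

(** A Pascal step and [jj_shift] reduce this to sums over the odd row 2n-1, which are antisymmetric
    under r -> 1-r. *)
Lemma sum_jj_uu n : (0 < n)%N ->
  zsum (fun r => jj r * qbinom (2 * n) (n%:Z + r)) = 0.
Proof.
case: n => // n _.
have n2 : (2 * n.+1 = (2 * n).+2)%N by lia.
pose G (r : int) := jj r * qbinom (2 * n).+1 (n%:Z + r) : fps.
have hr (m : int) : exists d : nat, forall k : int, (`|k| <= `|(m + k)%R| + d)%N.
  by exists `|m|%N => k; lia.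
have sG : zsumm G by apply: zsumm_qbinom.
have G0 : zsum G = 0.
  apply: (@torsion_free 1); rewrite mulr_natl mulr2n.
  have {1}-> : zsum G = - zsum G; last by rewrite addNr.
  rewrite -{1}(zsum_refl 1 sG) -zsumN //.
  apply: eq_zsum => k; rewrite /G jj_refl mulNr; congr (- (_ * _)).
  by apply: qbinom_sym; lia.
have E (r : int) : jj r * qbinom (2 * n.+1) (n.+1%:Z + r) = G r - X n.+1 * G (r + 1).
  have [h|h] := lerP 0 (n.+1%:Z + r); last first.
    by rewrite /G !qbinom_out ?mulr0 ?subr0 //; lia.
  pose a := `|(n.+1%:Z + r)%R|%N.
  have := @qbinomA (2 * n).+1 (n.+1%:Z + r) 0 a => H.
  rewrite n2 -[qbinom _ _]mul1r -X0 H => [|_]; last by rewrite /a; lia.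
  have := @jj_shift a n.+1 r => HJ.
  rewrite X0 mul1r mulrDr mulrA [jj r * X a]mulrC HJ; last by rewrite /a; lia.
  rewrite /G (_ : n%:Z + (r + 1) = n.+1%:Z + r); last by lia.
  by rewrite (_ : n.+1%:Z + r - 1 = n%:Z + r); [ring|lia].
rewrite (eq_zsum E) zsumB //; last first.
  by apply/zsummMl/(zsumm_int sG); exists 1%N => k; lia.
rewrite zsumZ; last by apply: (zsumm_int sG); exists 1%N => k; lia.
by rewrite zsum_succ // G0 mulr0 subr0.
Qed.

(** The unit Bailey pair, whose beta_n vanishes for n > 0; the right side is its term r = 0. *)
Lemma unit_bailey n : (0 < n)%N ->
  fsum (fun r => (1 + X r.+1) * jj r.+1%:Z * uu n r.+1%:Z) = - iq n ^+ 2.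
Proof.
move=> n0; apply: (@unit_cancel (qfac (2 * n))); first exact: qfac_unit.
have hr : exists d : nat, forall k : int, (`|k| <= `|(n%:Z + k)%R| + d)%N.
  by exists n => k; lia.
have := sum_jj_uu n0; rewrite zsum_split; last exact: zsumm_qbinom.
have qbE (r : int) : qbinom (2 * n) (n%:Z + r) = qfac (2 * n) * uu n r.
  rewrite /qbinom /uu [iqz (n%:Z - r) * _]mulrC; congr (_ * (_ * iqz _)); lia.
have u0 : uu n 0 = iq n ^+ 2.
  by rewrite /uu; have -> : n%:Z - 0 = n by lia; have -> : n%:Z + 0 = n by lia.
have j0 : jj 0 = 1 by rewrite /jj sgn0 X0 mulr1.
rewrite qbE u0 j0 mul1r.
move=> E; apply/eqP; rewrite mulrN -addr_eq0 addrC -[X in _ == X]E; apply/eqP.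
have su : summ (fun r => (1 + X r.+1) * jj r.+1%:Z * uu n r.+1%:Z).
  apply: (@summ_fin n) => k nk.
  by rewrite uu_out ?mulr0 //; lia.
rewrite -fsumZ //; congr (_ + _); apply: eq_fsum => r.
rewrite !qbE.
have -> : uu n (- r.+1%:Z) = uu n r.+1%:Z by rewrite /uu opprK mulrC.
have -> : jj (- r.+1%:Z) = X r.+1 * jj r.+1%:Z.
  have := @jj_shift r.+1 0 r.+1%:Z; rewrite subr0 X0 mul1r => /(_ erefl) ->.
  by rewrite -jj_refl; congr jj; lia.
ring.
Qed.

Definition Q2 (r : nat) : fps := X r * (1 + X r) * geo r ^+ 2 * jj r%:Z.

Lemma summ_Q2 (c : nat -> fps) : summ (fun r => Q2 r.+1 * c r).
Proof. by move=> n; exists n => k nk; rewrite /Q2; do 4!apply: lowzMr; apply: lowzX. Qed.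

Lemma sum_geo2 N : \sum_(0 <= n < N) X n.+1 * geo n.+1 ^+ 2 =
  - fsum (fun r => Q2 r.+1 * rho N r.+1).
Proof.
pose T (n r : nat) := (1 + X r.+1) * jj r.+1%:Z *
   (X n.+1 * qfac n ^+ 2 * uu n.+1 r.+1%:Z) : fps.
have sT n : summ (T n).
  apply: (@summ_fin n.+1) => k nk.
  by rewrite /T uu_out ?mulr0 //; lia.
have -> : fsum (fun r => Q2 r.+1 * rho N r.+1) =
    fsum (fun r => \sum_(0 <= n < N) T n r).
  apply: eq_fsum => r; rewrite /T -mulr_sumr gauss_telescope // /Q2 /rho.
  ring.
rewrite fsum_bigsum // -sumrN; apply: eq_bigr => n _.
rewrite (@eq_fsum _ (fun r => (X n.+1 * qfac n ^+ 2) *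
   ((1 + X r.+1) * jj r.+1%:Z * uu n.+1 r.+1%:Z))); last first.
  by move=> r; rewrite /T; ring.
rewrite fsumZ; last first.
  apply: (@summ_fin n.+1) => k nk.
  by rewrite uu_out ?mulr0 //; lia.
rewrite unit_bailey // iqS mulrN opprK.
transitivity (X n.+1 * geo n.+1 ^+ 2 * (qfac n * iq n) ^+ 2); last by ring.
by rewrite qfac_iq expr1n mulr1.
Qed.

Lemma geo_fsum n : (0 < n)%N -> geo n = fsum (fun m => X (n * m)).
Proof.
move=> n0; have s : summ (fun m => X (n * m)).
  by apply: summX => k; rewrite leq_pmull.
apply: (@geoK n) => //; rewrite geoE // mulrBl mul1r -fsumZ //.
rewrite [X in X - _]fsum_recl // muln0 X0.
by under eq_fsum => m do rewrite mulnS XD; rewrite addrK.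
Qed.

Lemma geo2_fsum n : (0 < n)%N ->
  X n * geo n ^+ 2 = fsum (fun m => m%:R * X (n * m)).
Proof.
move=> n0; have s0 : summ (fun m => X (n * m)).
  by apply: summX => k; rewrite leq_pmull.
have s : summ (fun m => m%:R * X (n * m)) by apply: summMl.
apply: (@geoK n) => //; transitivity (X n * geo n * ((1 - X n) * geo n)).
  ring.
rewrite geoE // mulr1 mulrBl mul1r -fsumZ // [X in X - _]fsum_recl //.
rewrite mul0r add0r -fsumB; last 2 first.
- by apply: (eq_summ _ (summS 1 s)) => k; rewrite addn1.
- exact: summZ.
rewrite geo_fsum // -fsumZ //; apply: eq_fsum => m.
by rewrite mulnS XD mulrSr; ring.
Qed.

Lemma sigma1_gf_geo2 : sigma_gf 1 = fsum (fun n => X n.+1 * geo n.+1 ^+ 2).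
Proof.
rewrite /sigma_gf fsum_recl ?mul0r ?add0r; last exact: summ_sigma_gf.
pose T (k m : nat) := k.+1%:R * X (k.+1 * m.+1) : fps.
have sT : summ2 T.
  by move=> n; exists n.+1 => k l kl; apply/lowzMl/lowzX; nia.
transitivity (fsum (fun k => fsum (T k))).
  apply: eq_fsum => k; rewrite expn1 /lam geo_fsum //.
  have s : summ (fun m => X (k.+1 * m)) by apply: summX => m; rewrite leq_pmull.
  rewrite -!fsumZ //; last exact: summZ.
  by apply: eq_fsum => m; rewrite /T -XD mulnS.
rewrite fsum_exch //; apply: eq_fsum => m; rewrite geo2_fsum //.
rewrite [RHS]fsum_recl ?mul0r ?add0r.
  by apply: eq_fsum => k; rewrite /T mulnC.
by apply/summMl/summX => k; rewrite leq_pmull.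
Qed.

(** The same Gauss sum as for [bailey_sum], now applied to the unit pair: (q)_n^2 times the square
    of [iq n.+1] is the square of [geo n.+1]. It serves to evaluate [ell_moment1]. *)
Lemma sigma1_gf_jj : sigma_gf 1 = - fsum (fun r => Q2 r.+1).
Proof.
apply: lowz_eq => n; rewrite sigma1_gf_geo2.
have s1 : summ (fun n => X n.+1 * geo n.+1 ^+ 2).
  by apply/summMr => m; exists m.+1 => k mk; apply: lowzX; lia.
have sQ : summ (fun r => Q2 r.+1).
  by apply: (eq_summ _ (summ_Q2 (fun=> 1))) => k; rewrite mulr1.
have [B0 H] := fsum_approx s1 n; have {H} := H (maxn B0 n) (leq_maxl _ _).
set N := maxn _ _; have nN : (n <= N)%N by apply: leq_maxr.
rewrite sum_geo2 => H; set S := fsum _ in H *.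
rewrite -(subrKA (- fsum (fun r => Q2 r.+1 * rho N r.+1)) S).
apply: lowzD => //; rewrite opprK addrC -fsumB //; last exact: summ_Q2.
apply: lowz_fsum => [|r]; first by apply: summB => //; apply: summ_Q2.
rewrite /Q2 (_ : _ - _ = - (1 + X r.+1) * geo r.+1 ^+ 2 * jj r.+1%:Z *
   (X r.+1 * (rho N r.+1 - 1))); last by ring.
by apply/lowzMl/(lowz_le nN)/lowz_rho.
Qed.

Lemma tri_nat (s : nat) : ((tri s.+1%:Z) * 2 = s.+1 * s)%N.
Proof. by have := triE s.+1%:Z; nia. Qed.

(** * The pentagonal number theorem *)

(* Shanks' finite form of the pentagonal number theorem. *)
Definition shanks (n : nat) : fps := \sum_(0 <= s < n.+1)
  (-1) ^+ s * qfac n * iq s * X (s * n + tri s.+1%:Z).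

(** The differences [b s - a s] telescope with partial sums [- c m]; the boundary terms [c n] and
    [b n.+1] are the two new pentagonal powers. *)
Lemma shanksS n : shanks n.+1 = shanks n +
  (-1) ^+ n.+1 * (X (pent n.+1%:Z) + X (pent (- n.+1%:Z))).
Proof.
pose a s := (-1) ^+ s * qfac n * iq s * X (s * n + tri s.+1%:Z) : fps.
pose c s := (-1) ^+ s * qfac n * iq s * X (s.+1 * n.+1 + tri s.+1%:Z) : fps.
pose b s := (-1) ^+ s * qfac n.+1 * iq s * X (s * n.+1 + tri s.+1%:Z) : fps.
have bE s : b s = (-1) ^+ s * qfac n * iq s * X (s * n.+1 + tri s.+1%:Z) - c s.
  rewrite /b /c qfacS (_ : (s.+1 * n.+1 + tri s.+1%:Z =
    n.+1 + (s * n.+1 + tri s.+1%:Z))%N); last by lia.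
  by rewrite [X (n.+1 + _)]XD; ring.
have H m : \sum_(0 <= s < m.+1) b s = \sum_(0 <= s < m.+1) a s - c m.
  elim: m => [|m IH]; first by rewrite !big_nat1 bE /a !mul0n.
  rewrite big_nat_recr //= IH [in RHS]big_nat_recr //= bE.
  have -> : X (m.+1 * n.+1 + tri m.+2%:Z) = X m.+1 * X (m.+1 * n + tri m.+2%:Z).
    by rewrite -XD; congr X; lia.
  rewrite /a /c (_ : (m.+1 * n.+1 + tri m.+1%:Z = m.+1 * n + tri m.+2%:Z)%N).
    by rewrite [iq m]iqP exprS; ring.
  by have := tri_nat m; have := tri_nat m.+1; nia.
have cE : c n = (-1) ^+ n * X (pent n.+1%:Z).
  rewrite /c -[_ * _ * iq n]mulrA qfac_iq mulr1; congr (_ * X _).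
  by have := pentE n.+1%:Z; have := tri_nat n; nia.
have b1 : b n.+1 = (-1) ^+ n.+1 * X (pent (- n.+1%:Z)).
  rewrite /b -[_ * _ * iq _]mulrA qfac_iq mulr1; congr (_ * X _).
  have := pentE (- n.+1%:Z); have := triE (- n.+1%:Z).
  by have := tri_nat n.+1; nia.
transitivity (\sum_(0 <= s < n.+1) b s + b n.+1); first by rewrite -big_nat_recr.
by rewrite H cE b1 /shanks exprS; ring.
Qed.

Lemma euler_lim N : lowz N (eul - qfac N).
Proof.
pose F (r : int) := sgn r * X (pent r) : fps.
have t1 : tri 1%:Z = 0%N by have := tri_nat 0; lia.
have E n : shanks n = 1 + \sum_(0 <= k < n) (F k.+1%:Z + F (- k.+1%:Z)).
  elim: n => [|n IH].
    rewrite /shanks big_nat1 big_geq // addr0 qfac0 iq0 !mulr1 mul0n.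
    by rewrite t1 addn0 X0 mulr1.
  by rewrite shanksS IH big_nat_recr //= /F sgnN /sgn -mulrDr addrA.
(* [shanks N] is a partial sum of the pentagonal series. Its terms with s >= 1 have degree above N,
   and its term s = 0 is [qfac N]. *)
rewrite -(subrKA (shanks N)); apply: lowzD.
  rewrite E /eul zsum_split; last exact: zsumm_eul.
  have -> : sgn 0 * X (pent 0) = 1.
    by rewrite sgn0 mul1r (_ : pent 0 = 0%N) ?X0 //; have := pentE 0; have := triE 0; lia.
  have sF : summ (fun k : nat => F k.+1%:Z + F (- k.+1%:Z)).
    have sE : zsumm F by apply: zsumm_eul.
    apply: summD.
      by apply: (@zsumm_nat F (fun k => k.+1%:Z) sE); exists 0%N => k; lia.
    by apply: (@zsumm_nat F (fun k => - k.+1%:Z) sE); exists 0%N => k; lia.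
  rewrite (fsum_cut N sF) opprD addrACA subrr add0r addrAC subrr add0r.
  apply: lowz_fsum => [|k]; first exact: (summS N sF).
  apply: lowzD; apply/lowzMl/lowzX.
    by have := pentE (k + N).+1%:Z; lia.
  by have := pentE (- (k + N).+1%:Z); have := triE (- (k + N).+1%:Z); nia.
rewrite /shanks big_nat_recl // iq0 !mulr1 mul0n mul1r.
rewrite t1 addn0 X0 mulr1 addrAC subrr add0r big_nat_cond; apply: lowz_sum => s.
rewrite andbT => /andP[_ sN]; apply/lowzMl/lowzX.
by have := tri_nat s.+1; nia.
Qed.

(** * Counting partition pairs *)

(** Cardinality through a duplicate-free list, usable on the infinite type of sequences and directly
    comparable with coefficients. *)
Definition has_card (T : eqType) (P : pred T) (z : int) :=
  exists s : seq T, [/\ uniq s, forall x, (x \in s) = P x & (size s)%:Z = z].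

Lemma has_card_ext (T : eqType) (P Q : pred T) z :
  P =1 Q -> has_card P z -> has_card Q z.
Proof. by move=> PQ [s [us ms zs]]; exists s; split=> // x; rewrite ms. Qed.

Lemma has_card_uniq (T : eqType) (P : pred T) z z' :
  has_card P z -> has_card P z' -> z = z'.
Proof.
move=> [s [us ms <-]] [t [ut mt <-]]; congr (_%:Z).
by apply/perm_size/uniq_perm => // x; rewrite ms mt.
Qed.

Lemma has_card0 (T : eqType) (P : pred T) : (forall x, P x = false) -> has_card P 0.
Proof. by move=> P0; exists [::]; split=> // x; rewrite P0. Qed.

Lemma has_card_or (T : eqType) (P Q : pred T) a b :
  (forall x, P x -> Q x -> False) -> has_card P a -> has_card Q b ->
  has_card (fun x => P x || Q x) (a + b).
Proof.
move=> PQ [s [us ms <-]] [t [ut mt <-]]; exists (s ++ t); split.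
- rewrite cat_uniq us ut andbT; apply/hasPn => x; rewrite mt ms => Qx.
  by apply/negP => Px; apply: (PQ x).
- by move=> x; rewrite mem_cat ms mt.
- by rewrite size_cat PoszD.
Qed.

Lemma has_card_prod (T S : eqType) (P : pred T) (Q : pred S) a b :
  has_card P a -> has_card Q b ->
  has_card (fun p : T * S => P p.1 && Q p.2) (a * b).
Proof.
move=> [s [us ms <-]] [t [ut mt <-]].
exists [seq (x, y) | x <- s, y <- t]; split.
- by apply: allpairs_uniq => // -[? ?] [? ?].
- move=> [x y] /=; apply/allpairsP/andP => [[[u v] [/= us' vt [-> ->]]]|[Px Qy]].
    by rewrite -ms -mt.
  by exists (x, y); rewrite ms mt.
- by rewrite size_allpairs PoszM.
Qed.

Lemma has_card_map (T S : eqType) (f : T -> S) (P : pred T) (Q : pred S) z :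
  injective f -> (forall x, Q (f x) = P x) -> (forall y, Q y -> exists x, y = f x) ->
  has_card P z -> has_card Q z.
Proof.
move=> fI QP Qf [s [us ms <-]]; exists (map f s); split.
- by rewrite map_inj_uniq.
- move=> y; apply/mapP/idP => [[x xs ->]|Qy]; first by rewrite QP -ms.
  by have [x xy] := Qf y Qy; exists x => //; rewrite ms -QP -xy.
- by rewrite size_map.
Qed.

Lemma has_card_sum (T : eqType) (key : T -> nat) (P : nat -> pred T)
    (z : nat -> int) m :
  (forall i, (i < m)%N -> has_card (P i) (z i)) ->
  (forall i x, P i x -> key x = i) ->
  has_card (fun x => (key x < m)%N && P (key x) x) (\sum_(0 <= i < m) z i).
Proof.
move=> Pz Pkey; elim: m Pz => [|m IH] Pz.
  by rewrite big_geq //; apply: has_card0.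
rewrite big_nat_recr //=.
have := has_card_or _ (IH (fun i im => Pz i (ltnW im))) (Pz m (ltnSn m)).
move=> H; apply: has_card_ext (H _) => [x|x /andP[km _] /Pkey kx]; last first.
  by rewrite kx ltnn in km.
rewrite ltnS [in RHS]leq_eqVlt.
have [->|km] := eqVneq (key x) m; first by rewrite ltnn.
have -> : P m x = false by apply/negP => /Pkey E; rewrite E eqxx in km.
by rewrite orbF.
Qed.

Definition parts_gf (a m : nat) : fps := \prod_(a <= i < a + m) geo i.

Definition parts (a m n : nat) (p : seq nat) : bool :=
  [&& sorted leq p, all (fun x => a <= x < a + m)%N p & sumn p == n].

Lemma parts_gfE a m : (0 < a)%N -> parts_gf a m.+1 = parts_gf a.+1 m + X a * parts_gf
  a m.+1.
Proof.
move=> a0; have -> : parts_gf a m.+1 = geo a * parts_gf a.+1 m.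
  by rewrite /parts_gf big_ltn ?addSnnS //; lia.
by rewrite -{1}(subrK 1 (geo a)) -geo1 //; ring.
Qed.

(** Either the size [a] does not occur, or it is the first entry and can be removed; this is the
    recurrence [parts_gfE]. *)
Lemma card_parts a m n : (0 < a)%N -> has_card (parts a m n) (cf (parts_gf a m) n).
Proof.
move=> a0; elim: m a a0 n => [|m IH] a a0 n.
  rewrite /parts_gf addn0 big_geq // cf1.
  have E p : parts a 0 n p = (p == [::]) && (n == 0%N).
    rewrite /parts addn0; case: p => [|x p] /=; first by rewrite eq_sym.
    by rewrite (_ : (a <= x < a)%N = false) ?andbF //; lia.
  case: n E => [|n] E.
    by exists [:: [::]]; split=> // p; rewrite E inE andbT.
  by apply: has_card0 => p; rewrite E andbF.
elim/ltn_ind: n => n IHn; rewrite parts_gfE // cfD cfXM.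
have Q2' : has_card (fun p => if p is x :: q then
      [&& x == a, (a <= n)%N & parts a m.+1 (n - a) q] else false)
    (if (a <= n)%N then cf (parts_gf a m.+1) (n - a) else 0).
  case: leqP => an; last by apply: has_card0 => -[|x q] //=; rewrite andbF.
  apply: (@has_card_map _ _ (cons a) (parts a m.+1 (n - a))).
  - by move=> x y [].
  - by move=> x /=; rewrite eqxx.
  - by move=> [|x q] //= /andP[/eqP-> _]; exists q.
  by apply: IHn; lia.
apply: has_card_ext (has_card_or _ (IH _ _ n) Q2') => //.
  move=> [|x q]; first by rewrite orbF.
  rewrite /parts /=.
  have pE : path leq x q = all (leq x) q && sorted leq q.
    by rewrite path_sortedE //; apply: leq_trans.
  rewrite pE; case: (ltngtP x a) => xa /=.
  - by rewrite !andbF.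
  - rewrite addSnnS orbF; case: (boolP (all (leq x) q)) => //= /allP xq.
    rewrite ?(ltnW xa) ?xa /=; congr [&& _, _ & _]; congr (_ && _).
    by apply: eq_in_all => y /xq xy; lia.
  rewrite xa andbF /=.
  rewrite (_ : (a < a + m.+1)%N) /=; last by lia.
  have -> : (a + sumn q == n) = (a <= n)%N && (sumn q == n - a)%N.
    by apply/idP/idP; lia.
  case: (boolP (all _ q)) => /= [/allP aq|]; last first.
    by move=> aq; rewrite !(andbF, andFb).
  have -> : all (leq a) q by apply/allP => y /aq /andP[].
  by case: (a <= n)%N; rewrite ?andbF //=.
move=> [|x q] // /and3P[_ /= /andP[/andP[xa _] _] _] /and3P[/eqP E _ _].
by rewrite E ltnn in xa.
Qed.

(** One copy of the smallest part t+1 of the first partition is split off. Its other parts are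
    capped at N, which changes nothing in degrees up to N; the last factor is for parts in [t+1,
    2t+2). *)
Definition pair_sum (N : nat) : fps :=
  \sum_(0 <= t < N) X t.+1 * (parts_gf t.+1 (N - t) * parts_gf t.+1 t.+1).

Lemma pptildeE N n : (n <= N)%N -> (pptilde n)%:Z = cf (pair_sum N) n.
Proof.
move=> nN; have [s [us ms ->]] := pptildeP n.
apply: (@has_card_uniq _ (fun p => PPtilde p && (sumn p.1 + sumn p.2 == n))).
  by exists s; split.
(* The slice with smallest part t+1. The inequalities guard the truncated subtractions in the weight
   left for the second partition. *)
pose Qt t (p : seq nat * seq nat) := if p.1 is x :: q then
  [&& x == t.+1, (t.+1 <= n)%N, parts t.+1 (N - t) (sumn q) q &
      (sumn q < (n - t.+1).+1)%N && parts t.+1 t.+1 (n - t.+1 - sumn q) p.2]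
  else false.
have Qcard t : (t < N)%N ->
    has_card (Qt t) (cf (X t.+1 * (parts_gf t.+1 (N - t) * parts_gf t.+1 t.+1)) n).
  move=> tN; rewrite cfXM; case: ltnP => tn; last first.
    by apply: has_card0 => -[[|x q] p2] //=; rewrite /Qt /= ltnNge tn andbF.
  rewrite cfM -(big_mkord xpredT (fun i => cf (parts_gf t.+1 (N - t)) i *
    cf (parts_gf t.+1 t.+1) (n - t.+1 - i))).
  pose R i (p : seq nat * seq nat) :=
    parts t.+1 (N - t) i p.1 && parts t.+1 t.+1 (n - t.+1 - i) p.2.
  have HR := @has_card_sum _ (fun p => sumn p.1) R _ (n - t.+1).+1
    (fun i _ => has_card_prod (@card_parts t.+1 (N - t) i isT)
                              (@card_parts t.+1 t.+1 (n - t.+1 - i) isT)).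
  apply: (@has_card_map _ _ (fun p => (t.+1 :: p.1, p.2)) _ _ _ _ _ _ (HR _)).
  - by move=> [a b] [c d] [-> ->].
  - by move=> [a b]; rewrite /Qt /R /= eqxx tn /= andbCA.
  - by move=> [[|x q] p2] //= /andP[/eqP-> _]; exists (q, p2).
  by move=> i [a b] /andP[/and3P[_ _ /eqP]].
have H := has_card_sum Qcard.
have {H} := H (fun p => (head 0 p.1).-1) _.
rewrite /pair_sum cf_sum => H; apply: has_card_ext (H _) => [|i [[|x q] p2] //=];
  last first.
  by move=> /andP[/eqP-> _].
move=> [[|x q] p2]; rewrite PPtildeE /Qt /=; first by rewrite !andbF.
rewrite /is_partition /=; case: x => [|x] /=; first by rewrite !andbF.
rewrite eqxx /= path_sortedE; last exact: leq_trans.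
rewrite /parts eqxx andbT; apply/idP/idP.
  move=> /and5P[_ xn /andP[sq aq] sn /and3P[s2 a2 /eqP e2]].
  rewrite sq s2 /= !andbT; apply/andP; split; last by lia.
  apply/and3P; split.
  - apply/andP; split; apply/allP => y yq; move/allP: aq => /(_ y yq) /=; lia.
  - by apply/allP => y yq; move/allP: a2 => /(_ y yq) /=; lia.
  by apply/allP => y yq; move/allP: a2 => /(_ y yq) /=; lia.
move=> /andP[/and3P[/andP[/andP[xq sq] pq] /andP[s2 p2'] a2] /eqP e].
apply/and5P; split; try by lia.
  rewrite sq /=; apply/allP => y yq; move/allP: xq => /(_ y yq).
  have := mem_le_sumn yq; move=> /= *; lia.
rewrite s2 /=; apply/andP; split; last by apply/eqP; lia.
by apply/allP => y yq; move/allP: a2 => /(_ y yq) /=; lia.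
Qed.

Definition pptilde_gf : fps := Fps (fun n => (pptilde n)%:Z).

Lemma parts_gf_qfac a m : parts_gf a.+1 m * qfac (a + m) = qfac a.
Proof.
elim: m => [|m IH]; first by rewrite /parts_gf addn0 big_geq ?mul1r ?addn0.
rewrite {1}/parts_gf addnS big_nat_recr ?leq_addr //= -/(parts_gf _ _) addnS qfacS addSn.
transitivity (parts_gf a.+1 m * qfac (a + m) * ((1 - X (a + m).+1) * geo (a + m).+1)).
  by rewrite /parts_gf addSn; ring.
by rewrite geoE // mulr1 IH.
Qed.

Lemma pair_sum_bailey N : qfac N * pair_sum N = bailey_partial N.
Proof.
rewrite /pair_sum /bailey_partial mulr_sumr; apply: eq_big_nat => t /andP[_ tN].
have P1 := parts_gf_qfac t (N - t); rewrite subnKC in P1; last exact: ltnW.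
have P2 := parts_gf_qfac t t.+1; rewrite addnS addnn -mul2n in P2.
have -> : parts_gf t.+1 t.+1 = qfac t * iq (2 * t).+1.
  by rewrite -P2 -mulrA qfac_iq mulr1.
transitivity (X t.+1 * (parts_gf t.+1 (N - t) * qfac N) * (qfac t * iq (2 * t).+1)).
  ring.
by rewrite P1; ring.
Qed.

Lemma eul_pptilde_gf : eul * pptilde_gf = bailey_sum.
Proof.
apply: lowz_eq => N.
have FE : lowz N (pptilde_gf - pair_sum N).
  by move=> m mN; rewrite cfB -pptildeE // subrr.
rewrite (_ : eul * pptilde_gf - bailey_sum = eul * (pptilde_gf - pair_sum N) + (eul -
  qfac N) * pair_sum N +
   (bailey_partial N - bailey_sum)); last by rewrite -pair_sum_bailey; ring.
apply: lowzD; last exact: bailey_partial_lim.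
by apply: lowzD; [apply: lowzMl|apply/lowzMr/euler_lim].
Qed.

(** * Comparison of the two sums over divisors *)

Lemma cf_fsum F n B : summ F -> (forall k, (B <= k)%N -> cf (F k) n = 0) ->
  cf (fsum F) n = \sum_(0 <= k < B) cf (F k) n.
Proof.
move=> sF F0; have [B0 H] := fsum_approx sF n.
have := H (maxn B B0) (leq_maxr _ _) n (leqnn n).
rewrite cfB cf_sum => /eqP; rewrite subr_eq0 => /eqP->.
by apply: sum_widen => //; apply: leq_maxl.
Qed.

(** The exponent is given in terms of n and M - n, so that sums over M become double sums by
    [fsum_diag], geometric in M - n. *)
Lemma ell_sum M : ell M.+1 =
  \sum_(0 <= n < M.+1) (-1) ^+ n * X (tri n.+1%:Z + n * (M - n)).
Proof.
have t1 : tri 1%:Z = 0%N by have := tri_nat 0; lia.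
elim: M => [|M IH].
  by rewrite big_nat1 /= mulr0 subr0 t1 X0 mulr1.
rewrite big_nat_recl // -[ell M.+2]/(1 - X M.+1 * ell M.+1) IH mulr_sumr -sumrN.
rewrite t1 X0 mulr1; congr (_ + _); rewrite [LHS]big_nat_cond [RHS]big_nat_cond.
apply: eq_bigr => n /andP[/andP[_ nM] _].
rewrite mulrCA -XD exprS mulN1r mulNr; congr (- (_ * X _)).
rewrite subSS; have := tri_nat n; have := tri_nat n.+1.
have := subnKC (nM : (n <= M)%N); set d := (M - n)%N => <-; nia.
Qed.

Definition dterm (n : nat) : fps := (-1) ^+ n *
  (X (3 * tri n.+1%:Z + n.+1) * geo (3 * n + 1) +
   X (3 * tri n.+1%:Z + 2 * n.+1) * geo (3 * n + 2)).

Lemma appell_sumE : appell_sum = fsum dterm.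
Proof.
pose G n s := (-1) ^+ n * (psi (n + s).+1 * X (3 * (tri n.+1%:Z + n * s))) : fps.
have sG : summ2 G.
  move=> N; exists (2 * N + 2)%N => n s ns.
  by apply/lowzMl/lowzMr/lowzD; apply: lowzX; lia.
transitivity (fsum (fun n => fsum (G n))); last first.
  apply: eq_fsum => n.
  have s1 : summ (fun s => X ((3 * n + 1) * s)) by apply: summX => s; lia.
  have s2 : summ (fun s => X ((3 * n + 2) * s)) by apply: summX => s; lia.
  rewrite /dterm !geo_fsum; try by lia.
  rewrite -!fsumZ // -fsumD; try exact: summZ.
  rewrite -fsumZ; last by apply: summD; apply: summZ.
  apply: eq_fsum => s; rewrite /G /psi mulrDl -!XD.
  by congr (_ * (X _ + X _)); lia.
rewrite fsum_diag // /appell_sum; apply: eq_fsum => M.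
rewrite ell_sum sub3_sum mulr_sumr [LHS]big_nat_cond [RHS]big_nat_cond.
apply: eq_bigr => n /andP[/andP[_ nM] _]; rewrite /G subnKC //.
rewrite -sub3X mulrCA; congr (_ * _).
exact: (sub3_sgn n%:Z).
Qed.

Definition chi (x : nat) : int :=
  if (x %% 3 == 1)%N then 1 else if (x %% 3 == 2)%N then -1 else 0.

Lemma mod3P x : [\/ (x %% 3 = 0)%N, (x %% 3 = 1)%N | (x %% 3 = 2)%N].
Proof.
have : (x %% 3 < 3)%N by rewrite ltn_mod.
by case: (x %% 3)%N => [|[|[|m]]] // _; [apply: Or31|apply: Or32|apply: Or33].
Qed.

Lemma chi_double x : chi (2 * x) = - chi x.
Proof. by rewrite /chi -modnMmr; case: (mod3P x) => ->. Qed.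

Lemma chi_div L x : (L %% 3 = 1)%N -> (x %| L)%N -> chi (L %/ x) = chi x.
Proof.
move=> L1 /divnK E; rewrite -E -modnMm in L1; rewrite /chi; move: L1.
by case: (mod3P (L %/ x)) => ->; case: (mod3P x) => ->.
Qed.

Lemma divisors_inv L (F : nat -> int) : (0 < L)%N ->
  \sum_(x <- divisors L) F x = \sum_(x <- divisors L) F (L %/ x)%N.
Proof.
move=> L0; rewrite -[RHS](big_map (divn L) xpredT).
apply/perm_big/uniq_perm; first exact: divisors_uniq.
  rewrite map_inj_in_uniq ?divisors_uniq // => x y.
  rewrite -!dvdn_divisors // => xL yL E.
  have x0 := dvdn_gt0 L0 xL; have y0 := dvdn_gt0 L0 yL.
  apply/eqP; have q0 : (0 < L %/ x)%N by rewrite divn_gt0 // dvdn_leq.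
  by rewrite -(eqn_pmul2l q0) (divnK xL) E (divnK yL).
move=> x; rewrite -dvdn_divisors //; apply/idP/mapP => [xL|[y]].
  exists (L %/ x)%N; last by rewrite divnA // mulKn.
  by rewrite -dvdn_divisors // dvdn_div.
by rewrite -dvdn_divisors // => yL ->; apply: dvdn_div.
Qed.

(* The pairs [(x, 2 d)] and [(2 x, d)] with [x d = N] cancel since [chi 2 = -1]. *)
Lemma chi_cancel N : (0 < N)%N ->
  \sum_(x <- divisors (2 * N)) chi x * ((~~ odd x)%:R + (~~ odd (2 * N %/ x))%:R)
  = 0.
Proof.
move=> N0; have L0 : (0 < 2 * N)%N by lia.
under eq_bigr => x _ do rewrite mulrDr !mulr_natr !mulrb.
rewrite big_split /= -!big_mkcond /=.
rewrite -big_filter -[X in _ + X]big_filter.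
rewrite (perm_big (map (muln 2) (divisors N))); last first.
  apply: uniq_perm.
  - by rewrite filter_uniq ?divisors_uniq.
  - by rewrite map_inj_uniq ?divisors_uniq // => x y; lia.
  move=> x; rewrite mem_filter -dvdn_divisors //.
  apply/andP/mapP => [[xo xL]|[d]].
    exists (x %/ 2)%N; last by lia.
    rewrite -dvdn_divisors // -(@dvdn_pmul2l 2) // (_ : 2 * (x %/ 2) = x)%N //.
    lia.
  by rewrite -dvdn_divisors // => dN ->; rewrite dvdn_pmul2l // oddM.
rewrite big_map [X in _ + X](perm_big (divisors N)); last first.
  apply: uniq_perm; rewrite ?filter_uniq ?divisors_uniq // => x.
  rewrite mem_filter -!dvdn_divisors //.
  apply/andP/idP => [[yo xL]|xN].
    have /dvdnP[d E] : (2 %| 2 * N %/ x)%N by rewrite dvdn2.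
    apply/dvdnP; exists d; have := divnK xL; rewrite E; lia.
  by rewrite -muln_divA // oddM dvdn_mull.
rewrite -big_split big1 //= => x _.
by rewrite chi_double addNr.
Qed.

Lemma cf_sign n (f : fps) e : cf ((-1) ^+ n * f) e = (-1) ^+ n * cf f e.
Proof.
rewrite (_ : (-1) ^+ n = ((-1) ^+ n)%:~R :> fps) ?cfZint //.
by rewrite rmorphXn /= rmorphN1.
Qed.

Lemma cf_Xgeo a c e : cf (X a * geo c) e = ((a <= e)%N && (c %| e - a)%N)%:R.
Proof. by rewrite cfXM; case: leqP. Qed.

Lemma sum_div (F : nat -> int) L M : (0 < L)%N -> (L < M)%N ->
  (forall x, ~~ (x %| L)%N -> F x = 0) ->
  \sum_(0 <= x < M) F x = \sum_(x <- divisors L) F x.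
Proof.
move=> L0 LM F0.
rewrite (bigID (fun x => (x %| L)%N)) /= [X in _ + X]big1 ?addr0; last first.
  by move=> x /F0.
rewrite -big_filter; apply/perm_big/uniq_perm.
- by rewrite filter_uniq ?iota_uniq.
- exact: divisors_uniq.
move=> x; rewrite mem_filter mem_index_iota -dvdn_divisors //.
by case: (boolP (x %| L)%N) => //= /(dvdn_leq L0); lia.
Qed.

Lemma sum_mod3 (F : nat -> int) B : (forall n, F (3 * n)%N = 0) ->
  \sum_(0 <= n < B) (F (3 * n + 1)%N + F (3 * n + 2)%N) =
  \sum_(0 <= x < 3 * B) F x.
Proof.
move=> F0; elim: B => [|B IH]; first by rewrite muln0 !big_geq.
rewrite big_nat_recr //= IH (_ : 3 * B.+1 = (3 * B).+3)%N; last by lia.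
by rewrite !big_nat_recr //= F0 addr0 -addrA addn1 addn2.
Qed.

Lemma sum_even (F : nat -> int) B : (forall x, odd x -> F x = 0) ->
  \sum_(0 <= r < B) F (2 * r)%N = \sum_(0 <= x < 2 * B) F x.
Proof.
move=> F0; elim: B => [|B IH]; first by rewrite muln0 !big_geq.
rewrite big_nat_recr //= IH (_ : 2 * B.+1 = (2 * B).+2)%N; last by lia.
by rewrite !big_nat_recr //= [F (2 * B).+1]F0 ?addr0 //= oddM.
Qed.

Lemma chi3 n : chi (3 * n) = 0.
Proof. by rewrite /chi modnMr. Qed.
Lemma chi31 n : chi (3 * n + 1) = 1.
Proof. by rewrite /chi mulnC modnMDl. Qed.
Lemma chi32 n : chi (3 * n + 2) = -1.
Proof. by rewrite /chi mulnC modnMDl. Qed.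

Section Coef.
Variable e : nat.
Hypothesis e0 : (0 < e)%N.
Let L := (2 * (3 * e - 1))%N.

Lemma L_gt0 : (0 < L)%N. Proof. by rewrite /L; lia. Qed.

Definition i1 (x : nat) := [&& x %| L, x < L %/ x & odd (x + L %/ x)]%N.

(** The equation e = a + k x reads L = x (x + 3 + 6k). Conversely L = 1 mod 3 forces L/x = x mod 3,
    so a cofactor larger than x and of opposite parity has this form. *)
Lemma i1P x a : (0 < x)%N -> ~~ (3 %| x)%N -> (6 * a = x * x + 3 * x + 2)%N ->
  (a <= e)%N && (x %| e - a)%N = i1 x.
Proof.
move=> x0 x3 E; apply/andP/and3P => [[ae /dvdnP[k Ek]]|[xL xy od]].
  have EL : (L = (x + 3 + 6 * k) * x)%N by rewrite /L; lia.
  rewrite EL mulnK // dvdn_mull //; split=> //; first by lia.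
  by lia.
have EL := divnK xL; set y := (L %/ x)%N in EL xy od.
have : ((y * x) %% 3 = 1)%N by rewrite EL /L; lia.
have [k Ek] : exists k, y = (x + 3 + 6 * k)%N.
  have m3 : (y = x %[mod 3])%N.
    have : ((y * x) %% 3 = 1)%N by rewrite EL /L; lia.
    rewrite -modnMm; case: (mod3P y) => ->; case: (mod3P x) => -> //.
  exists ((y - x - 3) %/ 6)%N; lia.
rewrite Ek in EL => _.
have -> : e = (a + k * x)%N by rewrite /L in EL; lia.
by rewrite leq_addr addKn dvdn_mull.
Qed.

Definition i4 (x : nat) : int :=
  (~~ odd x && (x %| L)%N)%:R * (2 * (x <= L %/ x)%N%:R - (x == L %/ x)%N%:R).

(** The equation e = b + k r reads L = 2r (2r + 3k). The case k = 0, where 2r = L/(2r), is counted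
    once and the others twice. *)
Lemma i4P r b : (0 < r)%N -> (3 * b = 2 * r * r + 1)%N ->
  2 * ((b <= e)%N && (r %| e - b)%N)%:R - (e == b)%:R = i4 (2 * r).
Proof.
move=> r0 E; rewrite /i4 oddM /=.
have r3 : ~~ (3 %| r)%N by apply/negP => /dvdnP[k Ek]; rewrite Ek in E; lia.
have -> : (b <= e)%N && (r %| e - b)%N = (2 * r %| L)%N && (2 * r <= L %/ (2 * r))%N.
  apply/andP/andP => [[be /dvdnP[k Ek]]|[xL xy]].
    have EL : (L = (2 * r + 3 * k) * (2 * r))%N by rewrite /L; lia.
    rewrite EL mulnK; last by lia.
    by split; [rewrite dvdn_mull|lia].
  have EL := divnK xL; set y := (L %/ _)%N in EL xy.
  have m3 : ((y * (2 * r)) %% 3 = 1)%N by rewrite EL /L; lia.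
  have [k Ek] : exists k, y = (2 * r + 3 * k)%N.
    exists ((y - 2 * r) %/ 3)%N; move: m3; rewrite -modnMm.
    by case: (mod3P y) => Y; case: (mod3P (2 * r)) => R; rewrite Y R //; lia.
  rewrite Ek in EL; have -> : e = (b + k * r)%N by rewrite /L in EL; lia.
  by rewrite leq_addr addKn dvdn_mull.
have -> : (e == b) = (2 * r %| L)%N && (2 * r == L %/ (2 * r))%N.
  apply/eqP/andP => [eb|[xL /eqP xy]].
    have EL : (L = (2 * r) * (2 * r))%N by rewrite /L; lia.
    rewrite EL mulnK; last by lia.
    by rewrite dvdn_mull.
  have EL := divnK xL; rewrite -xy in EL; rewrite /L in EL; lia.
by case: (2 * r %| L)%N; rewrite ?mul1r ?mul0r //= mulr0 subr0.
Qed.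

(** For x = 3n+1 and x = 3n+2 alike, (-1)^n is [chi x] times the parity sign of x. *)
Lemma cf_appell_sum : cf appell_sum e =
  \sum_(x <- divisors L) chi x * ((if odd x then 1 else -1) * (i1 x)%:R).
Proof.
rewrite appell_sumE (@cf_fsum _ _ L.+1) => [||k Lk].
- have E n : cf (dterm n) e =
    chi (3 * n + 1) * ((if odd (3 * n + 1) then 1 else -1) * (i1 (3 * n + 1))%:R) +
    chi (3 * n + 2) * ((if odd (3 * n + 2) then 1 else -1) * (i1 (3 * n + 2))%:R).
    rewrite /dterm cf_sign cfD !cf_Xgeo chi31 chi32.
    have -> : odd (3 * n + 1) = ~~ odd n by lia.
    have -> : odd (3 * n + 2) = odd n by lia.
    have tn := tri_nat n.
    rewrite (@i1P (3 * n + 1)) ?(@i1P (3 * n + 2)); try lia.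
    rewrite -signr_odd; case: (odd n) => /=; rewrite ?expr0 ?expr1; ring.
  under eq_bigr => n _ do rewrite E.
  rewrite (@sum_mod3 (fun x => chi x * ((if odd x then 1 else -1) * (i1 x)%:R))).
    apply: sum_div; [exact: L_gt0 | lia|].
    by move=> x /negPf xL; rewrite /i1 xL /= !mulr0.
  by move=> n; rewrite chi3 mul0r.
- apply: summMl; apply: summD; apply: summMr; apply: summX => k; lia.
suff : lowz e (dterm k) by apply.
by apply/lowzMl/lowzD; apply/lowzMr/lowzX; rewrite /L in Lk; lia.
Qed.

(** Here (1 + q^r)/(1 - q^r) is 2 [geo r] - 1, the shape of [i4P]; the minus sign is chi(r) =
    -chi(2r) with x = 2r. *)
Lemma cf_bailey_sum : cf bailey_sum e = - \sum_(x <- divisors L) chi x * i4 x.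
Proof.
have bt r b : (0 < r)%N -> (3 * b = 2 * r * r + 1)%N ->
    cf (X b * (2%:R * geo r - 1)) e = i4 (2 * r).
  move=> r0 E; rewrite -(@i4P r b) // mulrBr mulr1 mulrCA cfB cfZnat cf_Xgeo.
  by rewrite /=.
have geo1p r : (0 < r)%N -> (1 + X r) * geo r = 2%:R * geo r - 1.
  by move=> r0; rewrite mulrDl geo1 //; ring.
have Q j : bterm (fun r => X r * (1 + X r) * geo r) j =
    X (quad 1 0 j%:Z + (3 * j + 1)) * (2%:R * geo (3 * j + 1) - 1) -
    X (quad 5 1 j%:Z + (3 * j + 2)) * (2%:R * geo (3 * j + 2) - 1).
  by rewrite /bterm -!geo1p ?XD; try lia; ring.
have E j : cf (bterm (fun r => X r * (1 + X r) * geo r) j) e =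
    chi (3 * j + 1) * i4 (2 * (3 * j + 1)) +
    chi (3 * j + 2) * i4 (2 * (3 * j + 2)).
  rewrite Q cfB !bt ?chi31 ?chi32 ?mul1r ?mulN1r //; try lia.
    by have := quad51 j%:Z; lia.
  by have := quad10 j%:Z; lia.
rewrite /bailey_sum (@cf_fsum _ _ L.+1) => [||k Lk].
- under eq_bigr => j _ do rewrite E.
  rewrite (@sum_mod3 (fun r => chi r * i4 (2 * r))); last first.
    by move=> n; rewrite chi3 mul0r.
  under eq_bigr => r _ do rewrite -[chi r]opprK -chi_double mulNr.
  rewrite sumrN (@sum_even (fun x => chi x * i4 x)); last first.
    by move=> x ox; rewrite /i4 ox mul0r mulr0.
  congr (- _); apply: sum_div; [exact: L_gt0 | lia|].
  by move=> x /negPf xL; rewrite /i4 xL andbF mul0r mulr0.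
- exact: summ_bterm.
suff : lowz e (bterm (fun r => X r * (1 + X r) * geo r) k) by apply.
by rewrite Q; apply: lowzB; apply/lowzMr/lowzX; rewrite /L in Lk; lia.
Qed.

(** Add the sum to its image under x -> L/x, which preserves [chi]. By cases on order and parity,
    the weights at x and L/x add up to the number of even ones among x and L/x, and [chi_cancel]
    applies. *)
Lemma cf_appell_bailey : cf appell_sum e = cf bailey_sum e.
Proof.
apply/eqP; rewrite cf_appell_sum cf_bailey_sum -subr_eq0 opprK -big_split /=.
set w := fun x => (if odd x then 1 else -1) * (i1 x)%:R + i4 x.
rewrite (eq_bigr (fun x => chi x * w x)) => [|x _]; last by rewrite -mulrDr.
set S := \sum_(x <- _) _; suff : S + S = 0 by lia.
have L0 := L_gt0; have L3 : (L %% 3 = 1)%N by rewrite /L; lia.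
rewrite {2}/S divisors_inv // -big_split /=.
rewrite -[RHS](@chi_cancel (3 * e - 1)); last by lia.
rewrite -/L; apply: eq_big_seq => x; rewrite -dvdn_divisors // => xL.
rewrite chi_div // -mulrDr; congr (_ * _); rewrite /w /i1 /i4.
have yL : (L %/ x %| L)%N by apply: dvdn_div.
rewrite divnA // mulKn // xL yL /= !andbT; set y := (L %/ x)%N.
have : odd x -> ~~ odd y by have := divnK xL; rewrite -/y /L; lia.
rewrite [(y + x)%N]addnC oddD.
by case: (odd x) => [/(_ isT)|_]; [case: (odd y) => // _|case: (odd y)];
  case: (ltngtP x y).
Qed.
End Coef.

Lemma appell_bailey : appell_sum = bailey_sum.
Proof.
apply: fpsP => -[|e]; last exact: cf_appell_bailey.
have lz f : lowz 0 f -> cf f 0 = 0 by apply.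
rewrite !lz //.
  apply: lowz_fsum; first exact: summ_bterm.
  by move=> j; apply: lowzB; apply/lowzMl/lowzMr/lowzMr/lowzX; lia.
rewrite appell_sumE; apply: lowz_fsum => [|n].
  apply: summMl; apply: summD; apply: summMr; apply: summX => k; lia.
by apply/lowzMl/lowzD; apply/lowzMr/lowzX; lia.
Qed.

Lemma eul_unit : cf eul 0 = 1.
Proof.
have := @euler_lim 0 0 (leqnn 0).
by rewrite cfB qfac_unit => /eqP; rewrite subr_eq0 => /eqP.
Qed.

Lemma generating_identity :
  sub3 Jac * pptilde_gf = sigma_gf 1 - sub3 (sigma_gf 1) - 2%:R * sub3 Lam.
Proof.
apply: (unit_cancel eul_unit); rewrite mulrBr appell_identity.
by rewrite mulrCA eul_pptilde_gf -appell_bailey; ring.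
Qed.

(** * Convolution identities *)

Lemma fsumM F G : summ F -> summ G ->
  fsum F * fsum G = fsum (fun a => fsum (fun b => F a * G b)).
Proof.
move=> sF sG; rewrite mulrC -fsumZ //; apply: eq_fsum => a.
by rewrite fsumZ // mulrC.
Qed.

Lemma summ2M F G : summ F -> summ G -> summ2 (fun a b => F a * G b).
Proof.
move=> sF sG n; have [B1 H1'] := sF n; have [B2 H2] := sG n.
exists (maxn B1 B2) => k l kl.
have [k1|k1] := leqP B1 k; first exact/lowzMr/H1'.
by apply/lowzMl/H2; lia.
Qed.

Lemma summ2Ml (c : nat -> nat -> fps) F : summ2 F -> summ2 (fun a b => c a b * F a b).
Proof. by move=> sF n; have [B H] := sF n; exists B => k l /H; apply: lowzMl. Qed.

Lemma summ2D F G : summ2 F -> summ2 G -> summ2 (fun a b => F a b + G a b).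
Proof.
move=> sF sG n; have [B1 H1'] := sF n; have [B2 H2] := sG n.
exists (maxn B1 B2) => k l kl.
by apply: lowzD; [apply: H1'|apply: H2]; lia.
Qed.

Lemma fsum2D F G : summ2 F -> summ2 G ->
  fsum (fun a => fsum (fun b => F a b + G a b)) =
  fsum (fun a => fsum (F a)) + fsum (fun a => fsum (G a)).
Proof.
move=> sF sG; rewrite -fsumD; try exact: summ2_fsum.
by apply: eq_fsum => a; rewrite fsumD //; apply: summ2_row.
Qed.

Lemma fsum2Z (c : fps) F : summ2 F ->
  fsum (fun a => fsum (fun b => c * F a b)) = c * fsum (fun a => fsum (F a)).
Proof.
move=> sF; rewrite -fsumZ; last exact: summ2_fsum.
by apply: eq_fsum => a; rewrite fsumZ //; apply: summ2_row.
Qed.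

Lemma eq_fsum2 F G : (forall a b, F a b = G a b) ->
  fsum (fun a => fsum (F a)) = fsum (fun a => fsum (G a)).
Proof. by move=> FG; apply: eq_fsum => a; apply: eq_fsum => b. Qed.

Lemma fsum_trichotomy F : summ2 F ->
  fsum (fun a => fsum (F a)) =
  fsum (fun a => fsum (fun b => F a (a + b).+1)) +
  fsum (fun a => fsum (fun b => F (a + b).+1 a)) + fsum (fun a => F a a).
Proof.
move=> sF; have s1 : summ2 (fun a b => F a (a + b).+1).
  by move=> n; have [B H] := sF n; exists B => k l kl; apply: H; lia.
have s2 : summ2 (fun a b => F (a + b).+1 a).
  by move=> n; have [B H] := sF n; exists B => k l kl; apply: H; lia.
have s3 : summ (fun a => F a a).
  by move=> n; have [B H] := sF n; exists B => k l; apply: H; lia.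
have s4 : summ (fun a => \sum_(0 <= c < a) F a c).
  move=> n; have [B H] := sF n; exists B => k Bk; apply: lowz_sum => c _.
  by apply: H; lia.
rewrite (fsum_diag s2).
have -> : fsum (fun c => \sum_(0 <= a < c.+1) F (a + (c - a)).+1 a) =
    fsum (fun a => \sum_(0 <= c < a) F a c).
  rewrite [RHS]fsum_recl // big_geq // add0r; apply: eq_fsum => c.
  by apply: eq_big_nat => a ac; rewrite subnKC //; lia.
rewrite -!fsumD; try by [|apply: summD; [apply: summ2_fsum|]|apply: summ2_fsum].
  apply: eq_fsum => a; rewrite (fsum_cut a.+1 (summ2_row a sF)).
  rewrite big_nat_recr //= [LHS]addrC addrA; congr (_ + _ + _).
  by apply: eq_fsum => b; rewrite addnS addnC.
Qed.

Lemma theta_lam a : (0 < a)%N -> theta (lam a) = a%:R * (lam a * geo a).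
Proof.
move=> a0; have E : lam a = geo a - 1 by rewrite -geo1.
have t1 : theta 1 = 0 by rewrite -X0 thetaX mul0r.
have G := geoE a0; apply: (@geoK a) => //.
have -> : theta (lam a) = theta (geo a) by rewrite E thetaD thetaN t1 subr0.
have := congr1 theta G; rewrite thetaM t1 thetaD thetaN t1 thetaX add0r => H.
transitivity (a%:R * X a * geo a).
  by apply/eqP; rewrite -subr_eq0 -H; apply/eqP; ring.
transitivity (a%:R * X a * geo a * ((1 - X a) * geo a)); last by rewrite /lam; ring.
by rewrite G mulr1.
Qed.

(** The addition formula of the hyperbolic cotangent, of which lam + 1/2 is half a value. *)
Lemma lam_mul a b : (0 < a)%N -> (0 < b)%N ->
  lam a * lam b = lam (a + b) * (1 + lam a + lam b).
Proof.
move=> a0 b0; have ab0 : (0 < a + b)%N by lia.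
apply: (@geoK (a + b)) => //.
rewrite /lam; transitivity (X (a + b) * (((1 - X (a + b)) * geo (a + b)) *
   (1 + X a * geo a + X b * geo b))); last by ring.
rewrite (geoE ab0) mul1r !geo1 // XD.
have ha := geoE a0; have hb := geoE b0.
transitivity (X a * X b * (geo a * ((1 - X b) * geo b) +
   geo b * ((1 - X a) * geo a) - ((1 - X b) * geo b) * ((1 - X a) * geo a))).
  rewrite -!geo1 //; ring.
by rewrite ha hb; ring.
Qed.

Definition sigma0_gf : fps := fsum (fun k => lam k.+1).

Lemma summ_lamS : summ (fun k => lam k.+1).
Proof. by apply: (eq_summ _ (summS 1 summ_lam)) => k; rewrite addn1. Qed.

Lemma sigma_gfS m : (0 < m)%N -> sigma_gf m = fsum (fun k => (k.+1 ^ m)%:R * lam k.+1).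
Proof.
move=> m0; rewrite /sigma_gf fsum_recl; last exact: summ_sigma_gf.
by rewrite exp0n // mul0r add0r.
Qed.

Lemma thetaZnat (c : nat) f : theta (c%:R * f) = c%:R * theta f.
Proof. by apply: fpsP => n; rewrite cf_theta !cfZnat cf_theta mulrCA. Qed.

Lemma theta_sigma1_gf : theta (sigma_gf 1) = fsum (fun k => (k.+1 ^ 2)%:R * (lam k.+1
  * geo k.+1)).
Proof.
rewrite sigma_gfS // theta_fsum; last exact/summMl/summ_lamS.
apply: eq_fsum => k.
by rewrite thetaZnat expn1 theta_lam // natrX expr2 mulrA.
Qed.

Lemma lam_sq k : (0 < k)%N -> lam k ^+ 2 = lam k * geo k - lam k.
Proof. by move=> k0; rewrite expr2 {2}/lam geo1 // mulrBr mulr1. Qed.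

Ltac castr := rewrite ?natrM ?natrD ?natrX ?expn1 ?[(_.+1)%:R]mulrSr.

Lemma sum_weight (c : fps) m : 6%:R * (\sum_(0 <= a < m)
    (c ^+ 2 - c * (a.+1)%:R + (a.+1)%:R ^+ 2)) =
  6%:R * m%:R * c ^+ 2 - 3%:R * c * m%:R * (m%:R + 1) +
  m%:R * (m%:R + 1) * (2%:R * m%:R + 1) :> fps.
Proof.
elim: m => [|m IH]; first by rewrite big_geq //; ring.
by rewrite big_nat_recr //= mulrDr IH; castr; ring.
Qed.

(* Sum [lam a * lam b = lam (a + b) * (1 + lam a + lam b)] against the weight
   [a^2 + a b + b^2], which is [a^2 - a c + c^2] in terms of [a] and [c = a + b]. *)
Lemma convolution_sigma :
  12%:R * sigma_gf 1 ^+ 2 = 5%:R * sigma_gf 3 + sigma_gf 1 - 6%:R * theta (sigma_gf 1).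
Proof.
have sl := summ_lamS.
pose w (a b : nat) : fps :=
  (a.+1)%:R ^+ 2 + (a.+1)%:R * (b.+1)%:R + (b.+1)%:R ^+ 2.
have sP m : summ (fun k => (k.+1 ^ m)%:R * lam k.+1) by apply: summMl.
pose T a b := w a b * (lam a.+1 * lam b.+1) : fps.
have sll : summ2 (fun a b => lam a.+1 * lam b.+1) by apply: summ2M.
have T1 : fsum (fun a => fsum (T a)) = 2%:R * sigma_gf 2 * sigma0_gf + sigma_gf 1 ^+ 2.
  transitivity (sigma_gf 2 * sigma0_gf + sigma_gf 1 * sigma_gf 1 + sigma0_gf *
    sigma_gf 2); last by ring.
  rewrite !sigma_gfS // /sigma0_gf !fsumM // -!fsum2D; try exact: summ2M.
    by apply: eq_fsum2 => a b; rewrite /T /w; castr; ring.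
  by apply: summ2D; apply: summ2M.
pose U a b := w a b * lam (a + b).+2 : fps.
pose V a b := (((a.+1)%:R ^+ 2 - (a.+1)%:R * (b.+1)%:R + (b.+1)%:R ^+ 2) *
   (lam a.+1 * lam b.+1)) : fps.
have sU : summ2 U.
  by move=> n; exists n => k l kl; apply/lowzMl/lowz_lam; lia.
have sV : summ2 V by apply: summ2Ml.
have TE a b : T a b = U a b + (V a (a + b).+1 + V (b + a).+1 b).
  rewrite /T /U /V lam_mul // addSn addnS /w [(b + a)%N]addnC.
  by castr; ring.
have sV1 : summ2 (fun a b => V a (a + b).+1).
  by move=> n; have [B H] := sV n; exists B => k l kl; apply: H; lia.
have sV2 : summ2 (fun a b => V (b + a).+1 b).
  by move=> n; have [B H] := sV n; exists B => k l kl; apply: H; lia.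
(* The terms lam a lam (a+b) and lam b lam (a+b) fill the two off-diagonal halves of [V]. The totals
   of [T] and [V] both contain 2 [sigma_gf 2 * sigma0_gf], which drops out of their difference and
   leaves 2 P^2. *)
have T2 : fsum (fun a => fsum (T a)) = fsum (fun a => fsum (U a)) +
    (fsum (fun a => fsum (V a)) - fsum (fun a => V a a)).
  rewrite [in RHS](fsum_trichotomy sV) addrK (eq_fsum2 TE) !fsum2D //; last exact: summ2D.
  by rewrite [X in _ + (_ + X) = _]fsum_exch.
have V1 : fsum (fun a => fsum (V a)) = 2%:R * sigma_gf 2 * sigma0_gf - sigma_gf 1 ^+ 2.
  transitivity (sigma_gf 2 * sigma0_gf + (-1 * (sigma_gf 1 * sigma_gf 1)) + sigma0_gf
    * sigma_gf 2); last by ring.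
  rewrite !sigma_gfS // /sigma0_gf !fsumM // -fsum2Z -?fsum2D; try exact: summ2M.
  - by apply: eq_fsum2 => a b; rewrite /V; castr; ring.
  - by apply: summ2D; [exact: summ2M|apply/summ2Ml/summ2M].
  - exact/summ2Ml/summ2M.
have V2 : fsum (fun a => V a a) = theta (sigma_gf 1) - sigma_gf 2.
  rewrite theta_sigma1_gf sigma_gfS // -fsumB //; last exact/summMl/summMr.
  apply: eq_fsum => a; have := lam_sq (ltn0Sn a); rewrite expr2 => E.
  by rewrite /V E; castr; ring.
have U1 : 6%:R * fsum (fun a => fsum (U a)) = 5%:R * sigma_gf 3 - 6%:R * sigma_gf 2 +
  sigma_gf 1.
  rewrite fsum_diag // -fsumZ; last first.
    move=> n; exists n => k nk; apply: lowz_sum => a _.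
    by apply/lowzMl/lowz_lam; lia.
  rewrite /sigma_gf -!fsumZ; try exact: summ_sigma_gf.
  rewrite -fsumB; try exact/summZ/summ_sigma_gf.
  rewrite -fsumD; last 2 first; try exact: summ_sigma_gf.
    by apply: summB; apply/summZ/summ_sigma_gf.
  rewrite [RHS](fsum_cut 2); last first.
    by apply: summD; [apply: summB; apply/summZ/summ_sigma_gf|apply: summ_sigma_gf].
  rewrite big_nat_recr //= big_nat1 !exp0n // !exp1n.
  rewrite [X in _ = X + _](_ : _ = 0) ?add0r; last by ring.
  apply: eq_fsum => c.
  transitivity (6%:R * (\sum_(0 <= a < c.+1) ((c.+2)%:R ^+ 2 -
     (c.+2)%:R * (a.+1)%:R + (a.+1)%:R ^+ 2)) * lam c.+2).
    rewrite -mulrA mulr_suml; congr (_ * _); apply: eq_big_nat => a ac.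
    have ca : (a <= c)%N by lia.
    rewrite /U subnKC // /w; congr (_ * _).
    have -> : ((c - a).+1)%:R = (c.+2)%:R - (a.+1)%:R :> fps.
      by rewrite -natrB; [congr (_%:R); lia|lia].
    ring.
  by rewrite sum_weight addn2; castr; ring.
have E := T1; rewrite T2 V1 V2 in E.
have -> : 12%:R * sigma_gf 1 ^+ 2 = 6%:R * (2%:R * sigma_gf 2 * sigma0_gf + sigma_gf
  1 ^+ 2) -
   6%:R * (2%:R * sigma_gf 2 * sigma0_gf - sigma_gf 1 ^+ 2) by ring.
rewrite -E mulrDr U1; ring.
Qed.

(* The sum of the [q^(k m)] over the [m] prime to 3. *)
Definition lam_coprime3 k := geo (3 * k) * psi k.

Lemma lowz_lam_coprime3 n k : (n < k)%N -> lowz n (lam_coprime3 k).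
Proof. by move=> nk; apply/lowzMl/lowzD; apply: lowzX; lia. Qed.

Lemma summ_lam_coprime3 : summ lam_coprime3.
Proof. by move=> n; exists n.+1 => k; apply: lowz_lam_coprime3. Qed.

Lemma mulr1_inj (u v f g : fps) : u * v = 1 -> u * f = u * g -> f = g.
Proof.
move=> uv E; rewrite -[f]mul1r -[g]mul1r -uv.
by rewrite [u * v]mulrC -!mulrA E.
Qed.

(** The counterpart of [lam_mul]; multiplied by the four denominators it is a polynomial identity in
    q^b and q^c. *)
Lemma lam_coprime3_mul b c : (0 < b)%N -> (0 < c)%N ->
  lam_coprime3 b * lam_coprime3 (b + c) = lam_coprime3 (b + (b + c)) * (1 + lam (3 *
    b) + lam (3 * (b + c))) +
    lam_coprime3 c * (lam (3 * b) - lam (3 * (b + c))).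
Proof.
move=> b0 c0.
have h1 := @geoE (3 * b) ltac:(lia); have h2 := @geoE (3 * c) ltac:(lia).
have h3 := @geoE (3 * (b + c)) ltac:(lia).
have h4 := @geoE (3 * (b + (b + c))) ltac:(lia).
move: h1 h2 h3 h4; rewrite /lam_coprime3 /psi /lam.
move: (geo (3 * b)) (geo (3 * c)) (geo (3 * (b + c))) (geo (3 * (b + (b + c)))).
move=> g1 g2 g3 g4; rewrite ![(3 * _)%N]mulnC ![(2 * _)%N]mulnC -!XX !XD.
move: (X b) (X c) => x y h1 h2 h3 h4.
apply: (mulr1_inj h1); apply: (mulr1_inj h2).
apply: (mulr1_inj h3); apply: (mulr1_inj h4).
set u1 := 1 - _ in h1 *; set u2 := 1 - _ in h2 *.
set u3 := 1 - _ in h3 *; set u4 := 1 - _ in h4 *.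
transitivity ((u1 * g1) * (u3 * g3) * (u2 * u4) *
  ((x + x ^+ 2) * (x * y + (x * y) ^+ 2))); first by ring.
transitivity ((u4 * g4) * u2 * (x * (x * y) + (x * (x * y)) ^+ 2) *
   (u1 * u3 + x ^+ 3 * (u1 * g1) * u3 + (x * y) ^+ 3 * (u3 * g3) * u1) +
  (u2 * g2) * u4 * (y + y ^+ 2) *
   (x ^+ 3 * (u1 * g1) * u3 - (x * y) ^+ 3 * (u3 * g3) * u1)); last by ring.
rewrite h1 h2 h3 h4 /u1 /u2 /u3 /u4; ring.
Qed.

Lemma lam_coprime3_sq a : (0 < a)%N ->
  lam_coprime3 a ^+ 2 = lam_coprime3 (2 * a) * (1 + 2%:R * lam (3 * a)) +
    2%:R * (lam (3 * a) * geo (3 * a)).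
Proof.
move=> a0; have h1 := @geoE (3 * a) ltac:(lia).
have h2 := @geoE (3 * (2 * a)) ltac:(lia).
move: h1 h2; rewrite /lam_coprime3 /psi /lam.
move: (geo (3 * a)) (geo (3 * (2 * a))) => g1 g2.
rewrite ![(3 * _)%N]mulnC ![(2 * _)%N]mulnC -!XX.
move: (X a) => x h1 h2.
apply: (mulr1_inj h1); apply: (mulr1_inj h1); apply: (mulr1_inj h2).
set u1 := 1 - _ in h1 *; set u2 := 1 - _ in h2 *.
transitivity ((u1 * g1) ^+ 2 * u2 * (x + x ^+ 2) ^+ 2); first by ring.
transitivity ((u2 * g2) * u1 * (x ^+ 2 + (x ^+ 2) ^+ 2) *
   (u1 + 2%:R * (x ^+ 3 * (u1 * g1))) +
  2%:R * x ^+ 3 * (u1 * g1) ^+ 2 * u2); last by ring.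
rewrite h1 h2 /u1 /u2; ring.
Qed.

Lemma sub3_lamE k : sub3 (lam k) = lam (3 * k).
Proof. exact: sub3_lam. Qed.

Lemma sub3_sigma_gfS m : (0 < m)%N ->
  sub3 (sigma_gf m) = fsum (fun k => (k.+1 ^ m)%:R * lam (3 * k.+1)).
Proof.
move=> m0; rewrite sigma_gfS // sub3_fsum; last exact/summMl/summ_lamS.
by apply: eq_fsum => k; rewrite sub3Znat sub3_lamE.
Qed.

Lemma sigma_gf_sub3S m : (0 < m)%N ->
  sigma_gf m - sub3 (sigma_gf m) = fsum (fun k => (k.+1 ^ m)%:R * lam_coprime3 k.+1).
Proof.
move=> m0; rewrite sigma_gf_sub3 // fsum_recl; last exact/summMl/summ_lam_coprime3.
by rewrite exp0n // mul0r add0r.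
Qed.

Lemma sub3_theta_sigma1_gf : sub3 (theta (sigma_gf 1)) =
  fsum (fun k => (k.+1 ^ 2)%:R * (lam (3 * k.+1) * geo (3 * k.+1))).
Proof.
rewrite theta_sigma1_gf sub3_fsum; last exact/summMl/summMr/summ_lamS.
by apply: eq_fsum => k; rewrite sub3Znat sub3M sub3_lamE sub3_geo.
Qed.

Lemma sum_weight2 (c : fps) m :
  6%:R * (\sum_(0 <= a < m) ((a.+1)%:R * (c - (a.+1)%:R))) =
  3%:R * c * m%:R * (m%:R + 1) - m%:R * (m%:R + 1) * (2%:R * m%:R + 1) :> fps.
Proof.
elim: m => [|m IH]; first by rewrite big_geq //; ring.
by rewrite big_nat_recr //= mulrDr IH; castr; ring.
Qed.

(* Here [lam_coprime3_mul] is summed against the weight [a b]. *)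
Lemma convolution_sigma_sub3 : let p := sigma_gf 1 - sub3 (sigma_gf 1) in
  sigma_gf 3 - sub3 (sigma_gf 3) =
  6%:R * p ^+ 2 + p - 24%:R * sub3 (sigma_gf 1) * p - 12%:R * sub3 (theta (sigma_gf 1)).
Proof.
move=> p.
have sf : summ (fun k => lam (3 * k.+1)).
  by move=> n; exists n.+1 => k nk; apply: lowz_lam; lia.
have sg : summ (fun k => lam_coprime3 k.+1).
  by move=> n; exists n.+1 => k nk; apply: lowz_lam_coprime3; lia.
pose F a b := (a.+1)%:R * lam_coprime3 a.+1 * ((b.+1)%:R * lam_coprime3 b.+1) : fps.
have sF : summ2 F by apply: summ2M; apply: summMl.
have pF : p ^+ 2 = fsum (fun a => fsum (F a)).
  rewrite expr2 /p sigma_gf_sub3S // fsumM; try exact: summMl.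
  by apply: eq_fsum2 => a b; rewrite !expn1.
pose H a b := ((a.+1)%:R * (b.+1)%:R) * (lam_coprime3 (a.+1 + b.+1) *
  (1 + lam (3 * a.+1) + lam (3 * b.+1))) : fps.
have sH : summ2 H.
  by move=> n; exists n => k l kl; apply/lowzMl/lowzMr/lowz_lam_coprime3; lia.
pose K a b := (a.+1 + b.+1)%:R * (a.+1)%:R *
  (lam_coprime3 b.+1 * (lam (3 * a.+1) - lam (3 * (a.+1 + b.+1)))) : fps.
have sK : summ2 K.
  move=> n; exists n => k l kl; apply: lowzMl.
  have [nl|ln] := leqP n l; first by apply/lowzMr/lowz_lam_coprime3; lia.
  by apply/lowzMl/lowzB; apply: lowz_lam; lia.
have FK a b : F a (a + b).+1 = H a (a + b).+1 + K a b.
  rewrite /F /H /K.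
  have -> : (a + b).+2 = (a.+1 + b.+1)%N by lia.
  transitivity ((a.+1)%:R * ((a.+1 + b.+1)%:R) * (lam_coprime3 a.+1 * lam_coprime3
    (a.+1 + b.+1)));
    first by ring.
  by rewrite lam_coprime3_mul //; ring.
have FK' a b : F (a + b).+1 a = H (a + b).+1 a + K a b.
  have -> : F (a + b).+1 a = F a (a + b).+1 by rewrite /F; ring.
  by rewrite FK /H [(_.+2 + _)%N]addnC; congr (_ + _); ring.
have Fd a : F a a = H a a + 2%:R * ((a.+1 ^ 2)%:R *
    (lam (3 * a.+1) * geo (3 * a.+1))).
  rewrite /F /H; have := lam_coprime3_sq (ltn0Sn a).
  have -> : (2 * a.+1 = a.+1 + a.+1)%N by lia.
  by rewrite expr2 => E; rewrite mulrACA E; castr; ring.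
pose A a b := ((a.+1)%:R * (b.+1)%:R) * lam_coprime3 (a + b).+2 : fps.
pose C a b := ((a.+1)%:R * (b.+1)%:R) * (lam (3 * a.+1) * lam_coprime3 (a + b).+2) : fps.
pose D a b := ((a + b).+2%:R * (a.+1)%:R) * (lam_coprime3 b.+1 * lam (3 * (a +
  b).+2)) : fps.
(* In terms of the shifted indices, [W] turns the weight (a+b) a of [K] into 2 a b, for which the
   sum factors. It vanishes on the diagonal and its halves are [C] and -[D]; hence [D] cancels in
   the total of [K], and [C] in that of H + 2K. *)
pose W a b := (a.+1)%:R * (b%:R - a%:R) * (lam (3 * a.+1) * lam_coprime3 b.+1) : fps.
pose L a b := (a.+1)%:R * lam (3 * a.+1) * ((b.+1)%:R * lam_coprime3 b.+1) : fps.
have sA : summ2 A.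
  by move=> n; exists n => k l kl; apply/lowzMl/lowz_lam_coprime3; lia.
have sC : summ2 C.
  by move=> n; exists n => k l kl; apply/lowzMl/lowzMl/lowz_lam_coprime3; lia.
have sD : summ2 D.
  by move=> n; exists n => k l kl; apply/lowzMl/lowzMl/lowz_lam; lia.
have sW : summ2 W by apply/summ2Ml/summ2M.
have sL : summ2 L by apply: summ2M; apply: summMl.
have HE a b : H a b = A a b + (C a b + C b a).
  have -> : H a b = A a b * (1 + lam (3 * a.+1) + lam (3 * b.+1)).
    by rewrite /H /A addSn addnS; ring.
  by rewrite /A /C [(b + a)%N]addnC; ring.
have sDC : summ2 (fun a b => D b a) by apply: summ2C.
have KW a b : K a b + W a b = 2%:R * L a b - D a b.
  by rewrite /K /W /L /D !addSn !addnS; castr; ring.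
have WE : fsum (fun a => fsum (W a)) =
    fsum (fun a => fsum (C a)) - fsum (fun a => fsum (D a)).
  rewrite (fsum_trichotomy sW) [X in _ + X](_ : _ = 0) ?addr0; last first.
    by rewrite -fsum0; apply: eq_fsum => a; rewrite /W subrr; ring.
  congr (_ + _).
    by apply: eq_fsum2 => a b; rewrite /W /C; castr; rewrite natrD; ring.
  rewrite [in RHS](fsum_exch sD) -mulN1r -fsum2Z //.
  apply: eq_fsum2 => a b; rewrite /W /D [(b + a)%N]addnC; castr.
  by rewrite natrD; ring.
have AE : 6%:R * fsum (fun a => fsum (A a)) = sigma_gf 3 - sub3 (sigma_gf 3) - p.
  rewrite fsum_diag // -fsumZ; last first.
    move=> n; exists n => k nk; apply: lowz_sum => a _.
    by apply/lowzMl/lowz_lam_coprime3; lia.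
  rewrite /p !sigma_gf_sub3S // -fsumB; try exact: summMl.
  rewrite [RHS]fsum_recl; last by apply: summB; apply: summMl.
  rewrite !exp1n subrr add0r; apply: eq_fsum => c.
  transitivity (6%:R * (\sum_(0 <= a < c.+1) ((a.+1)%:R * ((c.+2)%:R -
     (a.+1)%:R))) * lam_coprime3 c.+2).
    rewrite -mulrA mulr_suml; congr (_ * _); apply: eq_big_nat => a ac.
    rewrite /A subnKC; last by lia.
    by rewrite -natrB; [congr (_ * _%:R * _); lia|lia].
  by rewrite sum_weight2; castr; ring.
have LE : fsum (fun a => fsum (L a)) = sub3 (sigma_gf 1) * p.
  rewrite /p (sigma_gf_sub3S (ltn0Sn 0)) sub3_sigma_gfS // fsumM; try exact: summMl.
  by apply: eq_fsum2 => a b; rewrite !expn1.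
have pE : p ^+ 2 = fsum (fun a => fsum (H a)) + 2%:R * fsum (fun a => fsum (K a)) +
    2%:R * sub3 (theta (sigma_gf 1)).
  have sH1 : summ2 (fun a b => H a (a + b).+1).
    by move=> n; have [B E] := sH n; exists B => k l kl; apply: E; lia.
  have sH2 : summ2 (fun a b => H (a + b).+1 a).
    by move=> n; have [B E] := sH n; exists B => k l kl; apply: E; lia.
  rewrite pF (fsum_trichotomy sF) (eq_fsum2 FK) (eq_fsum2 FK') !fsum2D //.
  rewrite (eq_fsum Fd) fsumD; last 2 first.
  - by move=> n; have [B E] := sH n; exists B => k kl; apply: E; lia.
  - by apply/summZ/summMl/summMr.
  rewrite fsumZ; last by apply/summMl/summMr.
  rewrite sub3_theta_sigma1_gf [in RHS](fsum_trichotomy sH); ring.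
have HS : fsum (fun a => fsum (H a)) =
    fsum (fun a => fsum (A a)) + 2%:R * fsum (fun a => fsum (C a)).
  rewrite (eq_fsum2 HE) !fsum2D //; last by apply: summ2D => //; apply: summ2C.
    by rewrite -(fsum_exch sC); ring.
  exact: summ2C.
have KS : fsum (fun a => fsum (K a)) =
    2%:R * (sub3 (sigma_gf 1) * p) - fsum (fun a => fsum (C a)).
  have KW' a b : K a b + W a b = 2%:R * L a b + (-1) * D a b.
    by rewrite KW; ring.
  have := eq_fsum2 KW'; rewrite !fsum2D ?fsum2Z ?LE ?WE //; try exact: summ2Ml.
  by move=> E; rewrite -[LHS](addrK (fsum (fun a => fsum (C a)) -
    fsum (fun a => fsum (D a)))) E; ring.
have -> : 6%:R * p ^+ 2 = 6%:R * fsum (fun a => fsum (A a)) +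
    24%:R * (sub3 (sigma_gf 1) * p) + 12%:R * sub3 (theta (sigma_gf 1)).
  by rewrite pE HS KS; ring.
by rewrite AE; ring.
Qed.

(** * Moments of the partial theta sums *)

Lemma zsum_half (F : int -> fps) : zsumm F -> (forall r : int, F (1 - r) = F r) ->
  zsum F = 2%:R * fsum (fun M : nat => F M.+1%:Z).
Proof.
move=> sF Fr; rewrite zsum_pair // -fsumZ; last first.
  by apply: (zsumm_nat sF); exists 0%N => k; lia.
apply: eq_fsum => M; rewrite -(Fr (- M%:Z)) mulr_natl mulr2n.
by congr (_ + F _); lia.
Qed.

(** Subtracting 1, the limit of [ell M], makes the sums over M converge. Taking [JacE] centred at M
    cancels the constant part of [geo k] against [jj (M - k)]. *)
Lemma Jac_ell M : Jac * (ell M - 1) =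
  fsum (fun k => k%:R * (jj (M%:Z + k%:Z) +
    lam k * (jj (M%:Z + k%:Z) + jj (M%:Z - k%:Z)))) - 2%:R * Lam * jj M%:Z.
Proof.
have s1 : summ (fun k => k%:R * (jj (M%:Z - k%:Z) - jj (M%:Z + k%:Z))).
  by apply/summMl/summB; [apply: summ_jjB|apply: summ_jjD].
rewrite mulrBr mulr1 -{2}(JacE M%:Z).
have -> : Jac * ell M = jj_conv M - 2%:R * Lam * jj M%:Z by rewrite jj_convE addrK.
rewrite addrAC; congr (_ - _); rewrite /jj_conv -fsumB //; last exact: summ_jj_conv.
apply: eq_fsum => -[|k]; first by rewrite !mul0r subrr.
have E : geo k.+1 = 1 + lam k.+1 by rewrite /lam geo1 // addrC subrK.
by rewrite E; ring.
Qed.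

Definition ellsum (w : int -> fps) : fps :=
  fsum (fun M => w M.+1%:Z * (ell M.+1 - 1)).

Lemma lowz_ell n M : (n < M)%N -> lowz n (ell M.+1 - 1).
Proof. by move=> nM; rewrite /= addrC addKr; apply/lowzN/lowzMr/lowzX. Qed.

Lemma summ_ell w : summ (fun M => w M.+1%:Z * (ell M.+1 - 1)).
Proof. by move=> n; exists n.+1 => M nM; apply/lowzMl/lowz_ell. Qed.

(** Since [w] and [jj] are both odd under r -> 1-r, sums over M >= 1 are half of bilateral ones, in
    which the shift by k moves from [jj] to [w]. The part without [lam] is a convolution of [w] with
    k, which [q] evaluates. *)
Lemma ellsum_moment (d : nat) (w q : int -> fps) :
  (forall r : int, w (1 - r) = - w r) -> (forall r : int, q (1 - r) = - q r) ->
  (forall c : nat, d%:R * (\sum_(0 <= a < c.+1) (c - a)%:R * w a.+1%:Z) = q c.+1%:Z) ->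
  2%:R * d%:R * Jac * ellsum w =
  zsum (fun r => q r * jj r) +
  d%:R * fsum (fun k => k%:R * (lam k *
     zsum (fun r => (w (r - k%:Z) + w (r + k%:Z)) * jj r))) -
  2%:R * d%:R * Lam * zsum (fun r => w r * jj r).
Proof.
move=> wodd qodd qE.
pose R1 M k := w M.+1%:Z * (k%:R * jj (M.+1%:Z + k%:Z)).
pose R2 M k := w M.+1%:Z * (k%:R * (lam k * (jj (M.+1%:Z + k%:Z) + jj (M.+1%:Z - k%:Z)))).
have s1 : summ2 R1.
  by move=> n; exists n.+2 => M k B; apply/lowzMl/lowzMl/lowz_jj; lia.
have s2 : summ2 R2.
  move=> n; exists (2 * n + 6)%N => M k B; do 2!apply: lowzMl.
  have [nk|kn] := ltnP n k; first exact/lowzMr/lowz_lam.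
  by apply/lowzMl/lowzD; apply: lowz_jj; lia.
have sw : zsumm (fun r => w r * jj r) by apply/zsummMl/zsumm_jj.
have sq : zsumm (fun r => q r * jj r) by apply/zsummMl/zsumm_jj.
have sk k : zsumm (fun r => w r * (jj (r + k%:Z) + jj (r - k%:Z))).
  apply/zsummMl/zsummD; apply: (zsumm_int zsumm_jj); exists k => r; lia.
have E1 : Jac * ellsum w = fsum (fun M => fsum (R1 M)) +
    fsum (fun M => fsum (R2 M)) -
    2%:R * Lam * fsum (fun M : nat => w M.+1%:Z * jj M.+1%:Z).
  rewrite /ellsum -fsumZ; last exact: summ_ell.
  rewrite -fsumZ; last by apply: (zsumm_nat sw); exists 0%N => k; lia.
  rewrite -fsum2D // -fsumB; last 2 first.
  - exact/summ2_fsum/summ2D.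
  - by apply: summZ; apply: (zsumm_nat sw); exists 0%N => k; lia.
  apply: eq_fsum => M; rewrite mulrCA Jac_ell mulrBr -fsumZ; last first.
    apply: summMl; apply: summD; first exact: summ_jjD.
    exact/summMr/summ_lam.
  by congr (_ - _); [apply: eq_fsum => k; rewrite /R1 /R2; ring|ring].
have E2 : 2%:R * d%:R * fsum (fun M => fsum (R1 M)) = zsum (fun r => q r * jj r).
  rewrite zsum_half //; last by move=> r; rewrite qodd jj_refl mulrNN.
  rewrite -mulrA; congr (_ * _); rewrite fsum_diag // -fsumZ; last first.
    move=> n; exists n.+2 => k nk; apply: lowz_sum => a _.
    by apply/lowzMl/lowzMl/lowz_jj; lia.
  apply: eq_fsum => c; rewrite -qE -mulrA mulr_suml.
  congr (_ * _); apply: eq_big_nat => a ac; rewrite /R1.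
  have -> : a.+1%:Z + (c - a)%N%:Z = c.+1%:Z by lia.
  ring.
have E3 : 2%:R * fsum (fun M => fsum (R2 M)) = fsum (fun k => k%:R * (lam k *
     zsum (fun r => (w (r - k%:Z) + w (r + k%:Z)) * jj r))).
  rewrite fsum_exch // -fsumZ; last exact/summ2_fsum/summ2C.
  apply: eq_fsum => k.
  have <- : zsum (fun r => w r * (jj (r + k%:Z) + jj (r - k%:Z))) =
      zsum (fun r => (w (r - k%:Z) + w (r + k%:Z)) * jj r).
    have t1 : zsumm (fun r => w (r - k%:Z) * jj r) by apply/zsummMl/zsumm_jj.
    have t2 : zsumm (fun r => w (r + k%:Z) * jj r) by apply/zsummMl/zsumm_jj.
    transitivity (zsum (fun r => w (r - k%:Z) * jj r) + zsum (fun r => w (r + k%:Z) *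
      jj r));
      last by rewrite -zsumD //; apply: eq_zsum => r; rewrite mulrDl.
    rewrite -(zsum_shift k%:Z t1) -(zsum_shift (- k%:Z) t2) -zsumD; last 2 first.
    - by apply: (zsumm_int t1); exists k => r; lia.
    - by apply: (zsumm_int t2); exists k => r; lia.
    by apply: eq_zsum => r; rewrite addrK subrK mulrDr.
  rewrite zsum_half //; last first.
    move=> r; rewrite wodd.
    have -> : 1 - r + k%:Z = 1 - (r - k%:Z) by lia.
    have -> : 1 - r - k%:Z = 1 - (r + k%:Z) by lia.
    by rewrite !jj_refl; ring.
  have sk' : summ (fun M : nat => w M.+1%:Z * (jj (M.+1%:Z + k%:Z) + jj (M.+1%:Z -
    k%:Z))).
    by apply: (zsumm_nat (sk k)); exists 0%N => M; lia.
  transitivity (2%:R * (k%:R * lam k * fsum (fun M : nat => w M.+1%:Z *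
    (jj (M.+1%:Z + k%:Z) + jj (M.+1%:Z - k%:Z))))); last by ring.
  by congr (_ * _); rewrite -fsumZ //; apply: eq_fsum => M; rewrite /R2; ring.
have E4 : zsum (fun r => w r * jj r) =
    2%:R * fsum (fun M : nat => w M.+1%:Z * jj M.+1%:Z).
  by rewrite zsum_half // => r; rewrite wodd jj_refl mulrNN.
by rewrite -E2 -E3 E4 -[LHS]mulrA E1; ring.
Qed.

Definition oddz (r : int) : fps := (2 * r - 1)%:~R.

Lemma oddz_refl r : oddz (1 - r) = - oddz r.
Proof. by rewrite /oddz -mulrNz; congr (_%:~R); lia. Qed.

Lemma oddzS (M : nat) : oddz M.+1%:Z = 2%:R * M%:R + 1.
Proof.
rewrite /oddz (_ : 2 * M.+1%:Z - 1 = (2 * M + 1)%N%:Z); last by lia.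
by rewrite -pmulrn natrD natrM.
Qed.

Lemma oddz_sq r : oddz r ^+ 2 = 8%:R * (tri r)%:R + 1.
Proof.
have E : (2 * r - 1) ^+ 2 = (8 * tri r + 1)%N%:Z by have := triE r; lia.
by rewrite /oddz -rmorphXn /= E -pmulrn natrD natrM.
Qed.

Definition theta_moment m : fps := zsum (fun r => oddz r ^+ m * jj r).

Lemma zsumm_oddz m : zsumm (fun r => oddz r ^+ m * jj r).
Proof. exact/zsummMl/zsumm_jj. Qed.

Lemma theta_moment1 : theta_moment 1 = - (2%:R * Jac).
Proof.
rewrite /Jac mulrN opprK -zsumZ; last exact: zsumm_rjj.
rewrite -[RHS]subr0 -[X in _ - X]zsum_jj -zsumB; last 2 first.
- exact: (zsummMl (fun=> 2%:R) zsumm_rjj).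
- exact: zsumm_jj.
apply: eq_zsum => r; rewrite expr1 /oddz rmorphB /= rmorphM /=.
by ring.
Qed.

Lemma theta_momentS m : theta_moment m.+2 = theta_moment m + 8%:R * theta
  (theta_moment m).
Proof.
have s := @zsumm_oddz m.
have T r : theta (oddz r ^+ m * jj r) = (tri r)%:R * (oddz r ^+ m * jj r).
  have tj : theta (jj r) = (tri r)%:R * jj r.
    have E : sgn r = ((-1) ^+ `|r|%N : int)%:~R by rewrite rmorphXn rmorphN1.
    by rewrite /jj E thetaZint thetaX; ring.
  by rewrite /oddz -rmorphXn /= thetaZint tj; ring.
have st : zsumm (fun r => theta (oddz r ^+ m * jj r)).
  by move=> n; have [B H] := s n; exists B => k /H; apply: lowz_theta.
have -> : theta (theta_moment m) = zsum (fun r => theta (oddz r ^+ m * jj r)).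
  rewrite /theta_moment /zsum thetaD theta_fsum; last exact: (zsumm_pos s).
  by rewrite theta_fsum //; apply: (zsumm_neg s).
rewrite -zsumZ // -zsumD //; last exact/zsummMl.
apply: eq_zsum => r; rewrite T -addn2 exprD oddz_sq; ring.
Qed.

Definition ell_moment m := ellsum (fun r => oddz r ^+ m).

(** [c] is kept apart from [m] for the induction; the use is at m = c+1. *)
Lemma sum_odd1 (c : fps) m :
  6%:R * (\sum_(0 <= a < m) (c - a%:R) * (2%:R * a%:R + 1)) =
  6%:R * c * m%:R ^+ 2 - m%:R * (m%:R - 1) * (4%:R * m%:R + 1).
Proof.
elim: m => [|m IH]; first by rewrite big_geq //; ring.
by rewrite big_nat_recr // mulrDr IH [m.+1%:R]mulrSr; ring.
Qed.

Lemma sum_odd3 (c : fps) m :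
  30%:R * (\sum_(0 <= a < m) (c - a%:R) * (2%:R * a%:R + 1) ^+ 3) =
  30%:R * c * m%:R ^+ 2 * (2%:R * m%:R ^+ 2 - 1) -
  (8%:R * m%:R * (m%:R - 1) * (2%:R * m%:R - 1) * (3%:R * m%:R ^+ 2 - 3%:R * m%:R - 1) +
   90%:R * m%:R ^+ 2 * (m%:R - 1) ^+ 2 +
   30%:R * m%:R * (m%:R - 1) * (2%:R * m%:R - 1) + 15%:R * m%:R * (m%:R - 1)).
Proof.
elim: m => [|m IH]; first by rewrite big_geq //; ring.
rewrite big_nat_recr // [LHS]mulrDr.
apply: (eq_trans (congr1 (fun z => z + _) IH)).
by rewrite [m.+1%:R]mulrSr; ring.
Qed.

Lemma ell_moment1_Jac : 48%:R * Jac * ell_moment 1 =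
  theta_moment 3 - theta_moment 1 + 48%:R * sigma_gf 1 * theta_moment 1 - 48%:R * Lam
    * theta_moment 1.
Proof.
(* With x = 2c+1, 24 times the sum of (c-a)(2a+1) is x^3 - x. *)
have := @ellsum_moment 24 (fun r => oddz r ^+ 1) (fun r => oddz r ^+ 3 - oddz r ^+ 1).
rewrite -/(ell_moment 1) => H.
transitivity (2%:R * 24%:R * Jac * ell_moment 1); first by ring.
rewrite H => [|r|r|c]; last 3 first.
- by rewrite oddz_refl; ring.
- by rewrite oddz_refl; ring.
- rewrite oddzS; transitivity (4%:R * (6%:R * (\sum_(0 <= a < c.+1)
    (c%:R - a%:R) * (2%:R * a%:R + 1) : fps))).
    rewrite [RHS]mulrA -natrM; congr (_ * _); apply: eq_big_nat => a ac.
    by rewrite oddzS expr1 natrB //; lia.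
  by rewrite sum_odd1 [c.+1%:R]mulrSr; ring.
rewrite -/(theta_moment 1).
have -> : zsum (fun r => (oddz r ^+ 3 - oddz r ^+ 1) * jj r) = theta_moment 3 -
  theta_moment 1.
  rewrite /theta_moment -zsumB; try exact: zsumm_oddz.
  by apply: eq_zsum => r; ring.
have -> : fsum (fun k => k%:R * (lam k * zsum (fun r =>
    (oddz (r - k%:Z) ^+ 1 + oddz (r + k%:Z) ^+ 1) * jj r))) = 2%:R * theta_moment 1 *
      sigma_gf 1.
  rewrite /sigma_gf -fsumZ; last exact: summ_sigma_gf.
  apply: eq_fsum => k.
  have -> : zsum (fun r => (oddz (r - k%:Z) ^+ 1 + oddz (r + k%:Z) ^+ 1) * jj r) =
     2%:R * theta_moment 1.
    rewrite -zsumZ; last exact: zsumm_oddz.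
    apply: eq_zsum => r; rewrite !expr1 /oddz.
    by rewrite !rmorphB /= !rmorphM /= rmorphB rmorphD /=; ring.
  by rewrite expn1; ring.
by ring.
Qed.

Lemma ell_moment3_Jac : 480%:R * Jac * ell_moment 3 =
  3%:R * theta_moment 5 - 20%:R * theta_moment 3 + 17%:R * theta_moment 1 +
  480%:R * sigma_gf 1 * theta_moment 3 + 5760%:R * sigma_gf 3 * theta_moment 1 -
    480%:R * Lam * theta_moment 3.
Proof.
(* With x = 2c+1, 240 times the sum of (c-a)(2a+1)^3 is 3x^5 - 20x^3 + 17x. *)
have := @ellsum_moment 240 (fun r => oddz r ^+ 3)
  (fun r => 3%:R * oddz r ^+ 5 - 20%:R * oddz r ^+ 3 + 17%:R * oddz r ^+ 1).
rewrite -/(ell_moment 3) => H.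
transitivity (2%:R * 240%:R * Jac * ell_moment 3); first by ring.
rewrite H => [|r|r|c]; last 3 first.
- by rewrite oddz_refl; ring.
- by rewrite oddz_refl; ring.
- rewrite oddzS; transitivity (8%:R * (30%:R * (\sum_(0 <= a < c.+1)
    (c%:R - a%:R) * (2%:R * a%:R + 1) ^+ 3 : fps))).
    rewrite [RHS]mulrA -natrM; congr (_ * _); apply: eq_big_nat => a ac.
    by rewrite oddzS natrB //; lia.
  apply: (eq_trans (congr1 (fun z => 8%:R * z) (sum_odd3 _ _))).
  by rewrite [c.+1%:R]mulrSr; ring.
rewrite -/(theta_moment 3).
have -> : zsum (fun r => (3%:R * oddz r ^+ 5 - 20%:R * oddz r ^+ 3 + 17%:R * oddz r
  ^+ 1) * jj r) =
    3%:R * theta_moment 5 - 20%:R * theta_moment 3 + 17%:R * theta_moment 1.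
  have sZ (c : fps) m : zsumm (fun r => c * (oddz r ^+ m * jj r)).
    exact/zsummMl/zsumm_oddz.
  have sD (F G : int -> fps) : zsumm F -> zsumm G -> zsumm (fun r => F r - G r).
    by move=> sF sG; apply: zsummD => //; apply: zsummN.
  rewrite (@eq_zsum _ (fun r => 3%:R * (oddz r ^+ 5 * jj r) -
    20%:R * (oddz r ^+ 3 * jj r) + 17%:R * (oddz r ^+ 1 * jj r))); last by move=> r; ring.
  rewrite zsumD; [|by apply: sD; apply: sZ|exact: sZ].
  rewrite zsumB; try exact: sZ.
  by rewrite !zsumZ //; exact: zsumm_oddz.
have -> : fsum (fun k => k%:R * (lam k * zsum (fun r =>
    (oddz (r - k%:Z) ^+ 3 + oddz (r + k%:Z) ^+ 3) * jj r))) =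
    2%:R * theta_moment 3 * sigma_gf 1 + 24%:R * theta_moment 1 * sigma_gf 3.
  rewrite /sigma_gf -!fsumZ; try exact: summ_sigma_gf.
  rewrite -fsumD; try exact/summZ/summ_sigma_gf.
  apply: eq_fsum => k.
  have -> : zsum (fun r => (oddz (r - k%:Z) ^+ 3 + oddz (r + k%:Z) ^+ 3) * jj r) =
     2%:R * theta_moment 3 + 24%:R * k%:R ^+ 2 * theta_moment 1.
    rewrite -!zsumZ; try exact: zsumm_oddz.
    rewrite -zsumD; try exact/zsummMl/zsumm_oddz.
    apply: eq_zsum => r; rewrite /oddz.
    by rewrite !rmorphB /= !rmorphM /= rmorphB rmorphD /= -pmulrn; ring.
  by rewrite natrX; ring.
by ring.
Qed.

Definition ellterm n s : fps := sgn n.+1%:Z * X (tri n.+2%:Z + n.+1 * s).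

Lemma triS (n : nat) : tri n.+1%:Z = (tri n%:Z + n)%N.
Proof. by have := triE n.+1%:Z; have := triE n%:Z; lia. Qed.

Lemma ell_expand M : ell M.+2 - 1 = \sum_(0 <= n < M.+1) ellterm n (M - n).
Proof.
rewrite ell_sum big_nat_recl // (_ : tri 1 = 0%N); last by have := triE 1; lia.
rewrite X0 mulr1 addrC addKr; apply: eq_big_nat => n nM.
by rewrite /ellterm subSS.
Qed.

Lemma lowz_ellterm m n s : (m <= maxn n s)%N -> lowz m (ellterm n s).
Proof. by move=> B; apply/lowzMl/lowzX; have := tri_ge n.+2%:Z; nia. Qed.

Lemma ell_momentE m :
  ell_moment m = fsum (fun n => fsum (fun s => oddz (n + s).+2%:Z ^+ m * ellterm n s)).
Proof.
have sT : summ2 (fun n s => oddz (n + s).+2%:Z ^+ m * ellterm n s).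
  by move=> n; exists n => k l kl; apply/lowzMl/lowz_ellterm.
rewrite fsum_diag // /ell_moment /ellsum fsum_recl; last exact: (summ_ell (fun r =>
  oddz r ^+ m)).
rewrite [ell 1](_ : _ = 1 - X 0 * 0) // mulr0 subr0 subrr mulr0 add0r.
apply: eq_fsum => c; rewrite ell_expand mulr_sumr; apply: eq_big_nat => n nc.
by rewrite subnKC //; lia.
Qed.

Lemma sgn_tri n : sgn n.+1%:Z * X (tri n.+2%:Z) = X n.+1 * jj n.+1%:Z.
Proof. by rewrite /jj triS mulrCA -XD addnC. Qed.

(** The odd weight is 2(n+1) + (2s+1). Summed over s, the first part gives [Lam], and the second
    gives (1+x)/(1-x)^2 at x = q^(n+1), the series of [sigma1_gf_jj]. *)
Lemma ell_moment1 : ell_moment 1 = 2%:R * Lam - sigma_gf 1.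
Proof.
pose T n s : fps := n.+1%:R * ellterm n s.
pose U n s : fps := (2%:R * s%:R + 1) * ellterm n s.
have sT : summ2 T by move=> n; exists n => k l kl; apply/lowzMl/lowz_ellterm.
have sU : summ2 U by move=> n; exists n => k l kl; apply/lowzMl/lowz_ellterm.
have sX n : summ (fun s => X (n.+1 * s)) by apply: summX => k; rewrite leq_pmull.
have sX' n : summ (fun s => s%:R * X (n.+1 * s)) by apply: summMl.
have -> : ell_moment 1 = 2%:R * fsum (fun n => fsum (T n)) + fsum (fun n => fsum (U n)).
  rewrite ell_momentE -fsum2Z // -fsum2D //; last exact: (summ2Ml (fun _ _ => 2%:R)).
  apply: eq_fsum2 => n s; rewrite expr1 oddzS /T /U; castr; ring.
have eT n s : ellterm n s = X n.+1 * jj n.+1%:Z * X (n.+1 * s).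
  by rewrite /ellterm XD mulrA sgn_tri.
congr (2%:R * _ + _).
  rewrite /Lam [RHS]fsum_recl; last exact/summMl/summMr/summ_lam.
  rewrite mul0r add0r; apply: eq_fsum => n.
  transitivity (fsum (fun s => n.+1%:R * (X n.+1 * jj n.+1%:Z) * X (n.+1 * s))).
    by apply: eq_fsum => s; rewrite /T eT; ring.
  by rewrite fsumZ // -geo_fsum // /lam; ring.
rewrite sigma1_gf_jj opprK; apply: eq_fsum => n.
transitivity (fsum (fun s => 2%:R * (X n.+1 * jj n.+1%:Z) * (s%:R * X (n.+1 * s)) +
    X n.+1 * jj n.+1%:Z * X (n.+1 * s))).
  by apply: eq_fsum => s; rewrite /U eT; ring.
rewrite fsumD; [|exact: summZ|exact: summZ].
rewrite !fsumZ // -geo_fsum // -geo2_fsum // /Q2.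
have -> : X n.+1 * jj n.+1%:Z * geo n.+1 =
    X n.+1 * jj n.+1%:Z * geo n.+1 * ((1 - X n.+1) * geo n.+1).
  by rewrite geoE // mulr1.
by ring.
Qed.

Lemma cf_Jac0 : cf Jac 0 = 1.
Proof.
have sj := zsumm_rjj; rewrite /Jac zsum_pair // cfN.
rewrite fsum_recl; last first.
  by apply: summD; apply: (zsumm_nat sj); exists 0%N => k; lia.
rewrite oppr0 mul0r addr0 cfD mul1r /jj /sgn expr1 mulN1r cfN.
rewrite [cf (fsum _) 0](_ : _ = 0) ?addr0 ?opprK //.
apply: (@lowz_fsum 0) => // [|k].
  by apply: summD; apply: (zsumm_nat sj); exists 2%N => k; lia.
by apply: lowzD; do 2!apply: lowzMl; apply: lowzX;
  [have := triE k.+2%:Z|have := triE (- k.+1%:Z)]; nia.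
Qed.

(** Equate the two evaluations of [ell_moment 1]: [Lam] cancels, and after division by 16 the
    logarithmic derivative of [Jac] remains. *)
Lemma theta_Jac : theta Jac = - (3%:R * sigma_gf 1 * Jac).
Proof.
have E := ell_moment1_Jac; rewrite ell_moment1 (theta_momentS 1) theta_moment1 in E.
have tJ : theta (- (2%:R * Jac)) = - (2%:R * theta Jac).
  by rewrite thetaN thetaZnat.
rewrite tJ in E; apply: (@natmul_inj 15).
apply/eqP; rewrite -subr_eq0; apply/eqP.
transitivity (48%:R * Jac * (2%:R * Lam - sigma_gf 1) - (- (2%:R * Jac) + 8%:R * -
  (2%:R * theta Jac) - - (2%:R * Jac) +
     48%:R * sigma_gf 1 * - (2%:R * Jac) - 48%:R * Lam * - (2%:R * Jac))); first by ring.
by rewrite E subrr.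
Qed.

Lemma ell_moment3 : ell_moment 3 = 2%:R * Lam - 7%:R * sigma_gf 3 - 18%:R * theta
  (sigma_gf 1) -
  48%:R * sigma_gf 1 * Lam.
Proof.
pose A := theta_moment 1; pose P := sigma_gf 1.
have tA : theta A = - (3%:R * P * A).
  rewrite /A theta_moment1 thetaN thetaZnat theta_Jac -/P; ring.
have A3 : theta_moment 3 = (1 - 24%:R * P) * A.
  by rewrite (theta_momentS 1) -/A tA; ring.
have t1 : theta 1 = 0 by rewrite -X0 thetaX mul0r.
have A5 : theta_moment 5 = ((1 - 24%:R * P) ^+ 2 - 192%:R * theta P) * A.
  rewrite (theta_momentS 3) A3 thetaM thetaD thetaN thetaZnat t1 tA; ring.
apply: (unit_cancel cf_Jac0); apply: (@natmul_inj 479).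
have := ell_moment3_Jac; rewrite A3 A5 -/A -/P /A theta_moment1 -/P => E.
rewrite [LHS]mulrA E; have := convolution_sigma; rewrite -/P => E2.
apply/eqP; rewrite -subr_eq0; apply/eqP.
(* P^2 enters with coefficient 19584 = 1632 * 12 and is eliminated by [convolution_sigma]. *)
transitivity (1632%:R * Jac * (12%:R * P ^+ 2 - (5%:R * sigma_gf 3 + P - 6%:R * theta
  P)));
  last by rewrite E2 subrr mulr0.
ring.
Qed.

(** * Coefficients modulo 3 and 5 *)

Lemma cf_sigma_gf m n : (0 < m)%N -> (0 < n)%N ->
  cf (sigma_gf m) n = \sum_(d <- divisors n) (d ^ m)%:R.
Proof.
move=> m0 n0; rewrite /sigma_gf (@cf_fsum _ _ n.+1); last 2 first.
- exact: summ_sigma_gf.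
- by move=> k nk; apply: (lowzMl _ (lowz_lam nk)).
transitivity (\sum_(d <- divisors n) if (d %| n)%N then (d ^ m)%:R else 0 : int);
  last by rewrite big_seq [RHS]big_seq; apply: eq_bigr => d; rewrite -dvdn_divisors
    // => ->.
rewrite -(@sum_div _ n n.+1) //; last by move=> d /negPf->.
apply: eq_big_nat => d dn; rewrite cfZnat /lam cf_Xgeo.
have dn' : (d <= n)%N by lia.
rewrite -{3}(subnK dn') dvdn_addl // dn'.
by case: ifP; rewrite ?mulr1 ?mulr0.
Qed.

Lemma dvdz_sum (d : int) (I : eqType) (r : seq I) (F : I -> int) :
  (forall x, x \in r -> (d %| F x)%Z) -> (d %| \sum_(x <- r) F x)%Z.
Proof. by move=> H; rewrite big_seq; apply: rpred_sum. Qed.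

(** If d e = 2 mod 3 then d + e = 0 mod 3; pairing d with n/d shows that 3 divides twice the sum. *)
Lemma sigma_mod3 n : (n %% 3 = 2)%N -> (3 %| cf (sigma_gf 1) n)%Z.
Proof.
move=> n2; have n0 : (0 < n)%N by lia.
have E : (3 %| cf (sigma_gf 1) n + cf (sigma_gf 1) n)%Z; last by lia.
rewrite {1}cf_sigma_gf // cf_sigma_gf // [X in _ + X]divisors_inv // -big_split /=.
apply: dvdz_sum => d; rewrite -dvdn_divisors // !expn1 => /divnK E.
move: n2; rewrite -E -modnMm mulnK ?(dvdn_gt0 n0) //; last by rewrite -E dvdn_mull.
rewrite !natz; move: (n %/ d)%N => e.
by case: (mod3P e) (mod3P d) => e3 [] d3; rewrite e3 d3 //; lia.
Qed.

Lemma edivn5 x : exists q, [\/ x = 5 * q, x = 5 * q + 1, x = 5 * q + 2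
  | x = 5 * q + 3 \/ x = 5 * q + 4]%N.
Proof.
exists (x %/ 5)%N; have : (x %% 5 < 5)%N by rewrite ltn_mod.
have := divn_eq x 5; case: (x %% 5)%N => [|[|[|[|[|r]]]]] // E _.
- by apply: Or41; lia.
- by apply: Or42; lia.
- by apply: Or43; lia.
- by apply: Or44; left; lia.
- by apply: Or44; right; lia.
Qed.

(** With e = n/d, Fermat gives n d^3 = e d^4 = e mod 5. *)
Lemma sigma3_mod5 n : (n %% 5 != 0)%N ->
  (5 %| n%:Z * cf (sigma_gf 3) n - cf (sigma_gf 1) n)%Z.
Proof.
move=> n5; have n0 : (0 < n)%N by lia.
rewrite !cf_sigma_gf // [X in _ - X]divisors_inv // mulr_sumr -sumrB.
apply: dvdz_sum => d; rewrite -dvdn_divisors // expn1 => /divnK E.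
have : (d %% 5 != 0)%N.
  apply: contra n5 => /eqP d0; by rewrite -E -modnMm d0 muln0.
rewrite -{1}E; set e := (n %/ d)%N; rewrite natrX PoszM.
have -> : e%:Z * d%:Z * d%:R ^+ 3 - e%:R = e%:Z * (d%:Z ^+ 4 - 1) by ring.
move=> d5; apply: dvdz_mull.
have pw (q r : int) : (5 %| r ^+ 4 - 1)%Z -> (5 %| (5 * q + r) ^+ 4 - 1)%Z.
  move=> H; rewrite (_ : _ - 1 = 5 * (q * ((5 * q + r) ^+ 3 + (5 * q + r) ^+ 2 * r +
     (5 * q + r) * r ^+ 2 + r ^+ 3)) + (r ^+ 4 - 1)); last by ring.
  by apply: rpredD => //; apply: dvdz_mulr.
have [q [dE|dE|dE|[dE|dE]]] := edivn5 d; first by lia.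
all: by rewrite dE PoszD PoszM; apply: pw.
Qed.

Lemma dvdz_fsum (d : int) F n : (forall k, (d %| cf (F k) n)%Z) -> (d %| cf (fsum F) n)%Z.
Proof.
move=> H; rewrite /fsum /=; case: pselect => [e|_]; last exact: dvdz0.
exact: rpred_sum.
Qed.

Lemma ell_moment_mod5 m : (m %% 5 = 2)%N \/ (m %% 5 = 4)%N ->
  (5 %| cf (ell_moment 3) m - cf (ell_moment 1) m)%Z.
Proof.
move=> m5; rewrite -cfB !ell_momentE.
have sT k : summ2 (fun n s => oddz (n + s).+2%:Z ^+ k * ellterm n s).
  by move=> n; exists n => a b ab; apply/lowzMl/lowz_ellterm.
rewrite -fsumB; try exact: summ2_fsum.
apply: dvdz_fsum => n; rewrite -fsumB; [|exact: (summ2_row n (sT 3%N))|exact: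
  (summ2_row n (sT 1%N))].
apply: dvdz_fsum => s.
pose a : int := 2 * (n + s)%N%:Z + 3.
have -> : oddz (n + s).+2%:Z ^+ 3 * ellterm n s - oddz (n + s).+2%:Z ^+ 1 * ellterm n s =
    (a ^+ 3 - a)%:~R * ((-1) ^+ n.+1 * X (tri n.+2%:Z + n.+1 * s)).
  have -> : oddz (n + s).+2%:Z = a%:~R by rewrite /oddz /a; congr (_%:~R); lia.
  rewrite -mulrBl /ellterm /sgn absz_nat expr1; move: (a) => b.
  by rewrite rmorphB rmorphXn.
rewrite cfZint cf_sign; case: (eqVneq m (tri n.+2%:Z + n.+1 * s)%N) => [E|ne]; last first.
  by rewrite /= (negPf ne) !mulr0.
apply: dvdz_mulr; have T := triE n.+2%:Z.
(* [a^2 = 0, 1, 4] mod 5, and [a^2 = 4] would make [a^2 - 8 m] a non-square. *)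
have {T} E8 : 8 * m%:Z = a ^+ 2 - (2 * s%:Z + 1) ^+ 2.
  by rewrite E PoszD PoszM /a; nia.
have pw (q r : int) : (5 %| r ^+ 3 - r)%Z -> (5 %| (5 * q + r) ^+ 3 - (5 * q + r))%Z.
  move=> H; rewrite (_ : _ - _ = 5 * (q * ((5 * q + r) ^+ 2 + (5 * q + r) * r + r ^+
    2) - q) +
    (r ^+ 3 - r)); last by ring.
  by apply: rpredD => //; apply: dvdz_mulr.
have aE : a = (2 * (n + s) + 3)%N%:Z by rewrite /a; lia.
have bE : 2 * s%:Z + 1 = (2 * s + 1)%N%:Z by lia.
rewrite bE aE in E8; rewrite aE; move: E8 {aE bE}.
move: (2 * (n + s) + 3)%N (2 * s + 1)%N => u v; rewrite !expr2 => E8.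
have [p [uE|uE|uE|[uE|uE]]] := edivn5 u;
  try by rewrite uE PoszD PoszM; apply: pw.
  by rewrite uE PoszM -[_ * _]addr0; apply: pw.
all: have [k uk] : exists k : int, u%:Z * u%:Z = 5 * k + 4
  by first [exists (5 * p%:Z * p%:Z + 4 * p%:Z); rewrite uE; lia
     |exists (5 * p%:Z * p%:Z + 6 * p%:Z + 1); rewrite uE; lia].
all: have [l vl] : exists l : int, v%:Z * v%:Z = 5 * l \/ v%:Z * v%:Z = 5 * l + 1 \/
    v%:Z * v%:Z = 5 * l + 4
  by have [q [vE|vE|vE|[vE|vE]]] := edivn5 v;
     [exists (5 * q%:Z * q%:Z)|exists (5 * q%:Z * q%:Z + 2 * q%:Z)
     |exists (5 * q%:Z * q%:Z + 4 * q%:Z)|exists (5 * q%:Z * q%:Z + 6 * q%:Z + 1)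
     |exists (5 * q%:Z * q%:Z + 8 * q%:Z + 3)]; rewrite vE; lia.
all: by exfalso; lia.
Qed.

Lemma cf_sigma_gf0 m : (0 < m)%N -> cf (sigma_gf m) 0 = 0.
Proof.
move=> m0; have s := @summ_sigma_gf m; rewrite /sigma_gf fsum_recl // exp0n // mul0r
  add0r.
apply: (@lowz_fsum 0) => // [|k]; first by apply: (eq_summ _ (summS 1 s)) => k;
  rewrite addn1.
by apply/lowzMl/lowz_lam.
Qed.

Lemma sigma1_Jac_mod5 n : (n %% 5 != 1)%N -> (5 %| cf (sigma_gf 1 * Jac) n)%Z.
Proof.
move=> n1; set c := cf _ n.
have E : 4%:R * theta (sigma_gf 1 * Jac) =
    10%:R * (theta (sigma_gf 1) * Jac) - 5%:R * (sigma_gf 3 * Jac) - sigma_gf 1 * Jac.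
  rewrite thetaM theta_Jac; apply/eqP; rewrite -subr_eq0; apply/eqP.
  transitivity (- Jac * (12%:R * sigma_gf 1 ^+ 2 - (5%:R * sigma_gf 3 + sigma_gf 1 -
    6%:R * theta (sigma_gf 1))));
    first by ring.
  by rewrite convolution_sigma subrr mulr0.
have := congr1 (fun f => cf f n) E; rewrite !cfB !cfZnat cf_theta -/c !natz.
move: (cf _ n) (cf _ n) => x y H; have {}H : (5 %| (4 * n%:Z + 1) * c)%Z.
  by rewrite (_ : _ * c = 5 * (2 * y - x)); [apply: dvdz_mulr|lia].
have {H} /dvdzP[z H] := H.
(* 4n+1 is invertible modulo 5 unless n = 1 mod 5; each quotient is obtained by multiplying [H] by
   the inverse. *)
by apply/dvdzP; have [q [nE|nE|nE|[nE|nE]]] := edivn5 n; rewrite nE in n1 H; first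
  [lia | exists (z - 4 * q%:Z * c); lia | exists (4 * q%:Z * c + 2 * c - z); lia
  | exists (2 * z - 8 * q%:Z * c - 5 * c); lia | exists (3 * z - 12 * q%:Z * c - 10 *
    c); lia].
Qed.

Lemma cf_sigma1_Jac_1 : cf (sigma_gf 1 * Jac) 1 = 1.
Proof.
rewrite cfM -(big_mkord xpredT (fun i => cf (sigma_gf 1) i * cf Jac (1 - i))).
rewrite big_nat_recr // big_nat1 cf_sigma_gf0 // mul0r subnn cf_Jac0 mulr1.
by rewrite cf_sigma_gf // big_cons big_nil.
Qed.

Definition rhs5 : fps := (sigma_gf 1 - sub3 (sigma_gf 1) - 2%:R * sub3 Lam) * sub3
  (sigma_gf 1).

Lemma rhs5E :
  rhs5 = sigma_gf 1 * sub3 (sigma_gf 1) - sub3 (sigma_gf 1 ^+ 2) - 2%:R * sub3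
    (sigma_gf 1 * Lam).
Proof. by rewrite /rhs5 [sigma_gf 1 ^+ 2]expr2 !sub3M; ring. Qed.

Lemma cf_sigma1_sq k : 12 * cf (sigma_gf 1 ^+ 2) k =
  5 * cf (sigma_gf 3) k + cf (sigma_gf 1) k - 6 * (k%:Z * cf (sigma_gf 1) k).
Proof.
have := congr1 (fun f => cf f k) convolution_sigma.
by rewrite cfB cfD !cfZnat cf_theta !natz.
Qed.

(** Modulo 5 the coefficient 36 is 1 and 30 is 0, so this determines P(q) P(q^3). *)
Lemma cf_sigma1_sub3 k :
  cf (sigma_gf 3) k - cf (sub3 (sigma_gf 3)) k = 6 * cf (sigma_gf 1 ^+ 2) k -
   36 * cf (sigma_gf 1 * sub3 (sigma_gf 1)) k + 30 * cf (sub3 (sigma_gf 1 ^+ 2)) k +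
     cf (sigma_gf 1) k -
   cf (sub3 (sigma_gf 1)) k - 12 * cf (sub3 (theta (sigma_gf 1))) k.
Proof.
have C := convolution_sigma_sub3; cbv zeta in C.
have {}C : sigma_gf 3 - sub3 (sigma_gf 3) = 6%:R * sigma_gf 1 ^+ 2 - 36%:R *
  (sigma_gf 1 * sub3 (sigma_gf 1)) +
   30%:R * sub3 (sigma_gf 1 ^+ 2) + sigma_gf 1 - sub3 (sigma_gf 1) - 12%:R * sub3
     (theta (sigma_gf 1)).
  by rewrite C [in sub3 (sigma_gf 1 ^+ 2)]expr2 sub3M; ring.
rewrite -cfB C !(cfB, cfD) !cfZnat !natz; lia.
Qed.

Lemma sigma1_Lam_mod5 m : (m %% 5 = 2)%N \/ (m %% 5 = 4)%N ->
  (5 %| 2 * cf (sigma_gf 1 * Lam) m - 18 * (m%:Z * cf (sigma_gf 1) m) - 7 * cf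
    (sigma_gf 3) m + cf (sigma_gf 1) m)%Z.
Proof.
move=> /ell_moment_mod5; rewrite ell_moment1 ell_moment3 -mulrA.
rewrite !(cfB, cfD) !cfZnat !natz cf_theta; lia.
Qed.

Lemma mulz_mod5 (n : nat) (x : int) : exists z : int, n%:Z * x = 5 * z + (n %%
  5)%N%:Z * x.
Proof. by exists ((n %/ 5)%N%:Z * x); rewrite {1}(divn_eq n 5) PoszD PoszM; ring. Qed.

Lemma sigma_mod5 n : (n %% 5 != 0)%N -> exists u v w : int,
  [/\ n%:Z * cf (sigma_gf 1) n = 5 * u + (n %% 5)%N%:Z * cf (sigma_gf 1) n,
      (n %% 5)%N%:Z * cf (sigma_gf 3) n = cf (sigma_gf 1) n + 5 * v &
      2 * cf (sigma_gf 1 ^+ 2) n = (1 - (n %% 5)%N%:Z) * cf (sigma_gf 1) n + 5 * w].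
Proof.
move=> n5; have [u uE] := mulz_mod5 n (cf (sigma_gf 1) n).
have [v vE] := mulz_mod5 n (cf (sigma_gf 3) n).
have /dvdzP[t tE] := sigma3_mod5 n5.
exists u, (t - v), (cf (sigma_gf 3) n - 6 * u - (n %% 5)%N%:Z * cf (sigma_gf 1) n -
  2 * cf (sigma_gf 1 ^+ 2) n); split=> //; first by lia.
by have := cf_sigma1_sq n; rewrite uE; lia.
Qed.

Lemma rhs5_mod5 n : (n %% 5 = 1)%N \/ (n %% 5 = 2)%N -> (5 %| cf rhs5 n)%Z.
Proof.
move=> n5; have C := cf_sigma1_sub3 n.
have [|u [v [w []]]] := @sigma_mod5 n; first by lia.
rewrite rhs5E !cfB cfZnat natz; rewrite !cf_sub3 in C *.
move: (cf (sigma_gf 1 ^+ 2) n) (cf (sigma_gf 3) n) (cf (sigma_gf 1) n) C => y s3 s1.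
move: (cf (sigma_gf 1 * sub3 (sigma_gf 1)) n) => z.
case: ifP => n3 C; last first.
  by case: n5 => -> _ E1 E2; lia.
(* Division by 3 sends the classes 1, 2 mod 5 to 2, 4, those of [sigma1_Lam_mod5]. *)
have : exists2 m, (n %/ 3)%N = m &
    (n %% 5 = 1)%N /\ (m %% 5 = 2)%N \/ (n %% 5 = 2)%N /\ (m %% 5 = 4)%N.
  by exists (n %/ 3)%N; lia.
case=> m mE m5; rewrite mE cf_theta [m%:R]natz in C *.
have [|u' [v' [w' []]]] := @sigma_mod5 m; first by lia.
have /sigma1_Lam_mod5/dvdzP[l] : (m %% 5 = 2)%N \/ (m %% 5 = 4)%N by lia.
move: (cf (sigma_gf 1 ^+ 2) m) (cf (sigma_gf 3) m) (cf (sigma_gf 1) m) C => y' t3 t1.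
move: (cf (sigma_gf 1 * Lam) m) => L.
move=> C EL E1; rewrite E1 in C EL; move: C EL {E1}.
case: m5 => -[-> ->] C EL F1 F2 _ G1 G2.
  lia.
lia.
Qed.

(** In the coefficient of [G * F] at N + e, every term but that of [cf F N] is divisible by [d],
    either through [G] or because it involves a smaller index in the class [p]. *)
Lemma dvdz_coef_quotient (d : int) (e : nat) (G F : fps) (p : pred nat) :
  cf G e = 1 ->
  (forall N i : nat, p N -> (i <= N + e)%N -> i != e ->
     (d %| cf G i)%Z \/ (e < i)%N && p (N + e - i)%N) ->
  (forall N : nat, p N -> (d %| cf (G * F) (N + e))%Z) ->
  forall N : nat, p N -> (d %| cf F N)%Z.
Proof.
move=> Ge Gi GF; elim/ltn_ind => N IH pN; have := GF N pN.
have eN : (e < (N + e).+1)%N by lia.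
rewrite cfM (bigD1 (Ordinal eN)) //= Ge mul1r addnK rpredDr //.
apply: rpred_sum => i ie; have iN := ltn_ord i.
case: (Gi N i pN) => [|||/andP[ei pi]]; [lia|by []|exact: dvdz_mulr|].
by apply: dvdz_mull; apply: IH => //; lia.
Qed.

Lemma pptilde_gf_mod3 N : (N %% 3 == 2)%N -> (3 %| cf pptilde_gf N)%Z.
Proof.
move: N; apply: (@dvdz_coef_quotient 3 0 (sub3 Jac)) => [|N i N2 iN i0|N /eqP N2].
- by rewrite cf_sub3 cf_Jac0.
- rewrite cf_sub3; case: ifP => i3; last by left.
  by right; lia.
have N3 : (3 %| N)%N = false by lia.
rewrite addn0 generating_identity !cfB cfZnat !cf_sub3 N3 mulr0 !subr0.
exact: sigma_mod3.
Qed.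

Lemma pptilde_gf_mod5 N : (N %% 5 == 3)%N || (N %% 5 == 4)%N -> (5 %| cf pptilde_gf N)%Z.
Proof.
move: N; apply: (@dvdz_coef_quotient 5 3 (sub3 (sigma_gf 1 * Jac))) => [|N i N5 iN
  i3|N N5].
- by rewrite cf_sub3 cf_sigma1_Jac_1.
- rewrite cf_sub3; case: ifP => [d3|]; last by left.
  (* The surviving indices are i = 3 mod 15, so N + 3 - i stays in the class of N modulo 5. *)
  have [i5|i5] := eqVneq (i %/ 3 %% 5)%N 1%N; last by left; apply: sigma1_Jac_mod5.
  by right; lia.
rewrite sub3M -mulrA mulrC generating_identity; apply: rhs5_mod5; lia.
Qed.

Local Close Scope ring_scope.

Theorem theorem1p1 (n : nat) :
  [/\ pptilde (3 * n + 2) = 0 %[mod 3],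
      pptilde (5 * n + 3) = 0 %[mod 5]
    & pptilde (5 * n + 4) = 0 %[mod 5]].
Proof.
have h3 := @pptilde_gf_mod3 (3 * n + 2) ltac:(lia).
have h5 := @pptilde_gf_mod5 (5 * n + 3) ltac:(lia).
have h5' := @pptilde_gf_mod5 (5 * n + 4) ltac:(lia).
by move: h3 h5 h5'; rewrite /pptilde_gf /=; split; lia.
Qed.
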